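(* Let $\Omega\subset\mathbb{R}^n$ be a bounded domain with smooth boundary $\Gamma$, $p\in(n,\infty)$, $g\in C^\infty(\mathbb{R})$, and let $d>0$ and $\delta\ge0$ be constants. Suppose that there is $\xi_0$ such that $g(\xi)>0$ for $\xi\ge\xi_0$, and that $$\int_{\xi_0}^\infty\frac{d\xi}{g(\xi)}<\infty.$$ Then there is $C>0$ such that for all $u_0\in\mathcal{X}_\delta$ with $u_0\ge C$ the solution of $$\Delta u=0\ \text{ in }(0,T)\times\Omega,\qquad \partial_tu_\Gamma-\delta\Delta_\Gamma u_\Gamma+d\,\partial_\nu u=g(u_\Gamma)\ \text{ on }(0,T)\times\Gamma,\qquad u_\Gamma|_{t=0}=u_0\ \text{ on }\Gamma$$ blows up in finite time.
   Context: $W^{s,p}$ are (real) Sobolev–Slobodetskij spaces; $u_\Gamma=u|_\Gamma$; $\Delta_\Gamma$ is the Laplace–Beltrami operator on $\Gamma$, $\partial_\nu$ the outer normal derivative. The phase space is $\mathcal{X}_\delta:=W^{2-2/p,p}(\Gamma)$ if $\delta>0$ and $\mathcal{X}_\delta:=W^{1-1/p,p}(\Gamma)$ if $\delta=0$. For each $u_0\in\mathcal{X}_\delta$ the problem has a unique maximal solution on $[0,t^+)$, $t^+=t^+(u_0)\in(0,\infty]$, with $u_\Gamma\in C([0,t^+);\mathcal{X}_\delta)$, smooth on $(0,t^+)\times\overline\Omega$, and $t^+<\infty$ implies $\|u_\Gamma(t)\|_{\mathcal{X}_\delta}\to\infty$ as $t\to t^+$. Blow-up in finite time means $t^+(u_0)<\infty$.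 *)

(* Defs.v *)
From HB Require Import structures.
From mathcomp Require Import all_boot all_order all_algebra.
From mathcomp Require Import all_classical all_reals all_analysis.

Set Implicit Arguments.
Unset Strict Implicit.
Unset Printing Implicit Defensive.

Import Order.TTheory GRing.Theory Num.Theory.
Import numFieldNormedType.Exports.

Local Open Scope classical_set_scope.
Local Open Scope ring_scope.

(** * Lebesgue measure on R^m *)

Record sfmeasure_space (R : realType) := SFMeasureSpace {
  sf_display : measure_display;
  sf_carrier : measurableType sf_display;
  sf_measure : {sigma_finite_measure set sf_carrier -> \bar R} }.

Section SigmaFiniteProduct.
Context d1 d2 (T1 : measurableType d1) (T2 : measurableType d2) (R : realType).
Variable m1 : {sigma_finite_measure set T1 -> \bar R}.
Variable m2 : {sigma_finite_measure set T2 -> \bar R}.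

(* Alias on which the sigma-finite structure can be inferred: on [m1 \x m2]
   itself, inference only finds the one for probability measures. *)
Definition sf_product : set (T1 * T2)%type -> \bar R := (m1 \x m2)%E.

HB.instance Definition _ := Measure.on sf_product.

Let sf_product_sigma_finite : sigma_finite setT sf_product.
Proof.
have /sigma_finiteP[F [TF ndF Foo]] := sigma_finiteT m1.
have /sigma_finiteP[G [TG ndG Goo]] := sigma_finiteT m2.
exists (fun n => F n `*` G n).
  rewrite -setXTT TF TG predeqE => -[x y]; split.
    move=> [/= [n _ Fnx] [k _ Gky]]; exists (maxn n k) => //; split.
    - by move: x Fnx; exact/subsetPset/ndF/leq_maxl.
    - by move: y Gky; exact/subsetPset/ndG/leq_maxr.
  by move=> [n _ []/= ? ?]; split; exists n.
move=> k; have [? ?] := Foo k; have [? ?] := Goo k.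
split; first exact: measurableX.
by rewrite /sf_product product_measure1E// lte_mul_pinfty// ge0_fin_numE.
Qed.

HB.instance Definition _ :=
  Measure_isSigmaFinite.Build _ _ _ sf_product sf_product_sigma_finite.

End SigmaFiniteProduct.

(* R^m as the iterated product R * (R * (... * unit)), with the product of m
   copies of the Lebesgue measure; R^0 is a point of mass 1. *)
Fixpoint lebesgue_space (R : realType) (m : nat) : sfmeasure_space R :=
  match m with
  | 0 => SFMeasureSpace (dirac tt : {sigma_finite_measure set unit -> \bar R})
  | m'.+1 =>
      SFMeasureSpace
        (sf_product (@lebesgue_measure R) (sf_measure (lebesgue_space R m'))
         : {sigma_finite_measure set _ -> \bar R})
  end.

Definition Rn (R : realType) (m : nat) := sf_carrier (lebesgue_space R m).
Definition lebesgueRn (R : realType) (m : nat) := sf_measure (lebesgue_space R m).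

Fixpoint rowRn (R : realType) (m : nat) : Rn R m -> 'rV[R]_m :=
  match m return Rn R m -> 'rV[R]_m with
  | 0 => fun _ => 0
  | m'.+1 => fun z => row_mx (z.1)%:M (rowRn z.2) : 'rV[R]_(1 + m')
  end.

(** * Differential calculus *)

Definition euclid_norm (R : realType) (n : nat) (x : 'rV[R]_n) : R :=
  Num.sqrt (\sum_k x 0 k ^+ 2).

Definition partial (R : realType) (n : nat) (k : 'I_n) (f : 'rV[R]_n -> R)
  : 'rV[R]_n -> R := 'D_(delta_mx 0 k) f.

Definition laplacian (R : realType) (n : nat) (f : 'rV[R]_n -> R)
    (x : 'rV[R]_n) : R := \sum_k partial k (partial k f) x.

(* For finite-dimensional V, asking for continuity of the iterated directional
   derivatives in all directions is the same as asking for it along the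
   coordinate axes. *)
Fixpoint Ck (R : realType) (V : normedModType R) (k : nat) (O : set V)
    (f : V -> R) : Prop :=
  (forall x, O x -> {for x, continuous f}) /\
  match k with
  | 0 => True
  | k'.+1 => forall v : V,
      (forall x, O x -> derivable f x v) /\ Ck k' O ('D_v f)
  end.

Definition smooth_open (R : realType) (V : normedModType R) (O : set V)
    (f : V -> R) : Prop := forall k, Ck k O f.

(* Smoothness on an arbitrary set (e.g. up to the boundary): locally the
   restriction of a smooth function on an open set. *)
Definition smooth_on (R : realType) (V : normedModType R) (A : set V)
    (f : V -> R) : Prop :=
  forall z, A z -> exists (O : set V) (F : V -> R),
    [/\ open O, O z, smooth_open O F & forall w, O w -> A w -> F w = f w].

Definition test_function (R : realType) (m : nat) (O : set 'rV[R]_m)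
    (eta : 'rV[R]_m -> R) : Prop :=
  smooth_open setT eta /\
  exists K, [/\ compact K, K `<=` O & forall y, ~ K y -> eta y = 0].

(** * Sobolev-Slobodetskij spaces on R^m *)

Definition measurable_Rn (R : realType) (m : nat) (f : 'rV[R]_m -> R) : Prop :=
  measurable_fun setT ((f \o @rowRn R m) : Rn R m -> R).

Definition Lp_norm (R : realType) (m : nat) (p : R) (f : 'rV[R]_m -> R)
  : \bar R := ('N[ lebesgueRn R m ]_(p%:E) [ EFin \o f \o @rowRn R m ])%E.

(* g is the k-th weak partial derivative of f; only used for f and g in L^p,
   where all the integrals converge. *)
Definition weak_partial (R : realType) (m : nat) (k : 'I_m)
    (f g : 'rV[R]_m -> R) : Prop :=
  measurable_Rn g /\
  forall phi, test_function setT phi ->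
    (\int[lebesgueRn R m]_z (f (rowRn z) * partial k phi (rowRn z))%:E =
     - \int[lebesgueRn R m]_z (g (rowRn z) * phi (rowRn z))%:E)%E.

Definition gagliardo (R : realType) (m : nat) (theta p : R)
    (f : 'rV[R]_m -> R) : \bar R :=
  ((\int[lebesgueRn R m]_z \int[lebesgueRn R m]_w
     (`|f (rowRn z) - f (rowRn w)| `^ p /
      euclid_norm (rowRn z - rowRn w) `^ (m%:R + theta * p))%:E) `^ p^-1)%E.

(* The W^{k + theta, p} norm, for 0 <= theta < 1; its value is +oo outside the
   space. Weak derivatives are unique up to null sets, so that the infimum is
   over at most one finite value. *)
Fixpoint sobolev_norm_rec (R : realType) (m k : nat) (theta p : R)
    (f : 'rV[R]_m -> R) : \bar R :=
  match k with
  | 0 => (Lp_norm p f + (if theta == 0%R then 0 else gagliardo theta p f))%E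
  | k'.+1 =>
     (Lp_norm p f +
      ereal_inf [set (\sum_j sobolev_norm_rec k' theta p (Df j))%E
                | Df in [set Df : 'I_m -> 'rV[R]_m -> R |
                         forall j, weak_partial j f (Df j)]])%E
  end.

Definition sobolev_norm (R : realType) (m : nat) (s p : R)
    (f : 'rV[R]_m -> R) : \bar R :=
  sobolev_norm_rec (Num.truncn s) (s - (Num.truncn s)%:R) p f.

Definition in_sobolev (R : realType) (m : nat) (s p : R)
    (f : 'rV[R]_m -> R) : Prop :=
  measurable_Rn f /\ (sobolev_norm s p f < +oo)%E.

(** * Bounded domains with smooth boundary *)

Definition boundary (T : topologicalType) (A : set T) : set T :=
  closure A `\` interior A.

(* Within [patch], the domain lies on one side of the graph of [height] over
   the hyperplane orthogonal to [axis]: above it, or below it if [below]. *)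
Record graph_chart (R : realType) (m : nat) := GraphChart {
  axis : 'I_m.+1;
  below : bool;
  height : 'rV[R]_m -> R;
  patch : set 'rV[R]_m.+1 }.

Definition is_chart (R : realType) (m : nat) (Omega : set 'rV[R]_m.+1)
    (c : graph_chart R m) : Prop :=
  [/\ open (patch c), smooth_open setT (height c) &
      forall x, patch c x ->
        (Omega x <->
         0 < (-1) ^+ below c * (x 0 (axis c) - height c (col' (axis c) x)))].

Definition smooth_bounded_domain (R : realType) (m : nat)
    (Omega : set 'rV[R]_m.+1) : Prop :=
  [/\ Omega !=set0, open Omega, connected Omega, bounded_set Omega &
      forall x, boundary Omega x -> exists2 c, is_chart Omega c & patch c x].

Section Charts.
Variables (R : realType) (m : nat) (c : graph_chart R m).

Definition chart_map (y : 'rV[R]_m) : 'rV[R]_m.+1 :=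
  \row_j (if unlift (axis c) j is Some k then y 0 k else height c y).

Definition chart_dom : set 'rV[R]_m := chart_map @^-1` patch c.

Definition chart_normal (x : 'rV[R]_m.+1) : 'rV[R]_m.+1 :=
  let w : 'rV[R]_m.+1 := (-1) ^+ below c *:
    \row_j (if unlift (axis c) j is Some k
            then partial k (height c) (col' (axis c) x) else -1) in
  (euclid_norm w)^-1 *: w.

(* Riemannian metric induced by R^(m+1), in the coordinates of the chart. *)
Definition chart_metric (y : 'rV[R]_m) : 'M[R]_m :=
  \matrix_(i, j) \sum_k
    partial i (fun z => chart_map z 0 k) y *
    partial j (fun z => chart_map z 0 k) y.

Definition chart_laplace_beltrami (f : 'rV[R]_m.+1 -> R) (x : 'rV[R]_m.+1) : R :=
  let vol y := Num.sqrt (\det (chart_metric y)) in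
  let y0 := col' (axis c) x in
  (vol y0)^-1 * \sum_i partial i
    (fun y => vol y *
       \sum_j invmx (chart_metric y) i j * partial j (f \o chart_map) y) y0.

End Charts.

(* The next two notions are computed in any chart around x; the result does not
   depend on the chart. *)
Definition outer_normal (R : realType) (m : nat) (Omega : set 'rV[R]_m.+1)
    (x : 'rV[R]_m.+1) : 'rV[R]_m.+1 :=
  get [set v | exists c,
    [/\ is_chart Omega c, patch c x & v = chart_normal c x]].

Definition laplace_beltrami (R : realType) (m : nat) (Omega : set 'rV[R]_m.+1)
    (f : 'rV[R]_m.+1 -> R) (x : 'rV[R]_m.+1) : R :=
  get [set l | exists c,
    [/\ is_chart Omega c, patch c x & l = chart_laplace_beltrami c f x]].

(* One-sided, as f is only meaningful on the closure of Omega. *)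
Definition normal_derivative (R : realType) (m : nat) (Omega : set 'rV[R]_m.+1)
    (f : 'rV[R]_m.+1 -> R) (x : 'rV[R]_m.+1) : R :=
  lim ((h^-1 * (f x - f (x - h *: outer_normal Omega x))) @[h --> 0^'+]).

(** * Sobolev-Slobodetskij spaces on the boundary *)

(* Functions on the boundary are represented by functions on R^(m+1), of which
   only the values on the boundary matter. *)
Definition localize (R : realType) (m : nat) (c : graph_chart R m)
    (eta : 'rV[R]_m -> R) (f : 'rV[R]_m.+1 -> R) (y : 'rV[R]_m) : R :=
  eta y * f (chart_map c y).

Definition in_sobolev_bd (R : realType) (m : nat) (Omega : set 'rV[R]_m.+1)
    (s p : R) (f : 'rV[R]_m.+1 -> R) : Prop :=
  forall c eta, is_chart Omega c -> test_function (chart_dom c) eta ->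
    in_sobolev s p (localize c eta f).

(* As the boundary is compact, finitely many of the seminorms
   f |-> sobolev_norm s p (localize c eta f) add up to the usual norm, which
   dominates all the others: convergence in W^{s,p} of the boundary is
   convergence in all of them. *)
Definition sobolev_bd_continuous (R : realType) (m : nat)
    (Omega : set 'rV[R]_m.+1) (s p : R) (J : set R)
    (u : R -> 'rV[R]_m.+1 -> R) : Prop :=
  (forall t, J t -> in_sobolev_bd Omega s p (u t)) /\
  forall t0, J t0 ->
    forall c eta, is_chart Omega c -> test_function (chart_dom c) eta ->
      sobolev_norm s p (localize c eta (fun x => u t x - u t0 x))
        @[t --> within J (nbhs t0)] --> (0 : \bar R)%E.

(** * The problem *)

Definition phase_order (R : realType) (delta p : R) : R :=
  if 0 < delta then 2 - 2 / p else 1 - 1 / p.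

Definition phase_space (R : realType) (m : nat) (Omega : set 'rV[R]_m.+1)
    (delta p : R) : set ('rV[R]_m.+1 -> R) :=
  [set f | in_sobolev_bd Omega (phase_order delta p) p f].

(* u t x is only meaningful for x in the closure of Omega if 0 < t < T, and for
   x in the boundary if t = 0. *)
Record is_solution (R : realType) (m : nat) (Omega : set 'rV[R]_m.+1)
    (p d delta : R) (g : R -> R) (u0 : 'rV[R]_m.+1 -> R)
    (T : \bar R) (u : R -> 'rV[R]_m.+1 -> R) : Prop := IsSolution {
  sol_time : (0 < T)%E;
  sol_init : forall x, boundary Omega x -> u 0 x = u0 x;
  sol_continuous : sobolev_bd_continuous Omega (phase_order delta p) p
    [set t | 0 <= t /\ (t%:E < T)%E] u;
  sol_smooth : smooth_on
    [set z : R * 'rV[R]_m.+1 |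
      [/\ 0 < z.1, (z.1%:E < T)%E & closure Omega z.2]]
    (fun z => u z.1 z.2);
  sol_harmonic : forall t x, 0 < t -> (t%:E < T)%E -> Omega x ->
    laplacian (u t) x = 0;
  sol_boundary : forall t x, 0 < t -> (t%:E < T)%E -> boundary Omega x ->
    derive1 (u ^~ x) t - delta * laplace_beltrami Omega (u t) x
      + d * normal_derivative Omega (u t) x = g (u t x) }.

(* No solution on a longer interval extends u. *)
Definition is_maximal_solution (R : realType) (m : nat)
    (Omega : set 'rV[R]_m.+1) (p d delta : R) (g : R -> R)
    (u0 : 'rV[R]_m.+1 -> R) (T : \bar R) (u : R -> 'rV[R]_m.+1 -> R) : Prop :=
  is_solution Omega p d delta g u0 T u /\
  forall T' v, is_solution Omega p d delta g u0 T' v ->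
    (forall t x, 0 <= t -> (t%:E < T)%E -> boundary Omega x -> v t x = u t x) ->
    (T' <= T)%E.

(* The lifespan of the maximal solution starting from u0 is finite. *)
Definition blows_up_in_finite_time (R : realType) (m : nat)
    (Omega : set 'rV[R]_m.+1) (p d delta : R) (g : R -> R)
    (u0 : 'rV[R]_m.+1 -> R) : Prop :=
  forall tplus u, is_maximal_solution Omega p d delta g u0 tplus u ->
    (tplus < +oo)%E.

(* Main.v *)
Require Import Defs.
From HB Require Import structures.
From mathcomp Require Import all_boot all_order all_algebra.
From mathcomp Require Import all_classical all_reals all_analysis.
From mathcomp Require Import measurable_realfun.
From mathcomp Require Import ring lra.

(** Suppose that the solution u exists for all times. At a point x of the
    boundary where u t is minimal, the Laplace-Beltrami operator is nonnegative;
    since u t is harmonic, its minimum over the closure of the domain is also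
    attained at x, so that the outer normal derivative is nonpositive. Hence the
    time derivative of u at such a point is at least g (u t x)
    ([boundary_min_growth]): the minimum over the boundary grows at least as fast
    as the solutions of the ordinary differential equation y' = g y. Once above
    xi0 it stays above ([stays_above]), and the travel time K xi, the integral of
    1 / g from xi0 to xi, grows at least linearly along it ([travel_time_grows]).
    As K is bounded, this is impossible.

    What remains is to bring u above xi0 at some positive time
    ([initial_lower_bound]). The initial value is attained in a Sobolev norm only,
    so an embedding into bounded functions is needed. It is obtained from the
    averages of w = eta * (u t - u 0), in a chart, against product bumps on cubes of
    side r0 / 2 ^ i. For delta = 0, the difference of two consecutive averages is
    a double integral of differences of w, controlled by the Gagliardo seminorm
    ([avg_step_gagliardo]). For delta > 0, the difference of two consecutive bumps
    is a divergence, which turns the difference of averages into an integral of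
    the weak gradient ([avg_step_weak]). Both bounds decay geometrically in i
    because p exceeds the dimension, so a small norm makes all the averages
    small, whatever the scale and the centre ([sobolev_avg_small]). If u 0 >= C and u t
    were below C - 1 at a boundary point, then w would be at most -1 on all small
    cubes at that point, and so would be its averages. *)

Import Order.TTheory GRing.Theory Num.Theory.
Import numFieldNormedType.Exports.

Local Open Scope classical_set_scope.
Local Open Scope ring_scope.

Set Implicit Arguments.
Unset Strict Implicit.
Unset Printing Implicit Defensive.

(** * Calculus of functions of class C^k *)

Section CkCalculus.
Context {R : realType}.

Section General.
Context {V : normedModType R}.
Implicit Types (O : set V) (f : V -> R).

Lemma Ck_continuous k O f x : Ck k O f -> O x -> {for x, continuous f}.
Proof. by case: k => [|k] [cf _]; exact: cf. Qed.

Lemma Ck_derivable k O f x v : Ck k.+1 O f -> O x -> derivable f x v.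
Proof. by move=> [_ /(_ v)[df _]]; exact: df. Qed.

Arguments Ck_derivable {k O f x} v _ _.

Lemma Ck_derive k O f v : Ck k.+1 O f -> Ck k O ('D_v f).
Proof. by move=> [_ /(_ v)[]]. Qed.

Lemma CkS k O f : Ck k.+1 O f -> Ck k O f.
Proof.
elim: k f => [|k IH] f [cf df]; first by split.
by split=> // v; have [? /IH] := df v; split.
Qed.

Lemma Ck_leq k l O f : (k <= l)%N -> Ck l O f -> Ck k O f.
Proof.
elim: l => [|l IH]; first by rewrite leqn0 => /eqP ->.
by rewrite leq_eqVlt => /orP[/eqP -> //|/IH h /CkS/h].
Qed.

Lemma Ck_sub k O O' f : O' `<=` O -> Ck k O f -> Ck k O' f.
Proof.
move=> OO'; elim: k f => [|k IH] f [cf df]; split=> //; try by move=> x /OO'/cf.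
move=> v; have [dv /IH cv] := df v; split=> // x /OO'; exact: dv.
Qed.

Lemma near_open O x (P : V -> Prop) : open O -> O x -> (forall y, O y -> P y) ->
  \near x, P x.
Proof. by move=> oO Ox OP; apply: filterS OP _; exact: open_nbhs_nbhs. Qed.

Lemma Ck_eq k O f h : open O -> (forall x, O x -> f x = h x) ->
  Ck k O f -> Ck k O h.
Proof.
move=> oO; elim: k f h => [|k IH] f h fh cf.
  split=> // x Ox; rewrite /prop_for /continuous_at -(fh x Ox).
  apply: cvg_trans (Ck_continuous cf Ox); apply: near_eq_cvg.
  by apply: near_open Ox _ => // y Oy; rewrite fh.
split; first by move=> x; exact: Ck_continuous (IH f h fh (CkS cf)).
have nfh x : O x -> (\near x, f x = h x) by move=> Ox; exact: near_open Ox _.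
move=> v; split=> [x Ox|].
  by have := near_eq_derivable (nfh x Ox) (Ck_derivable v cf Ox); apply.
by apply: IH (Ck_derive v cf) => x Ox; exact/near_eq_derive/nfh.
Qed.

Lemma Ck_cst k O (a : R) : Ck k O (cst a : V -> R).
Proof.
elim: k a => [|k IH] a; split=> //; try by move=> x _; exact: cvg_cst.
move=> v; split; first by move=> x _; exact: derivable_cst.
have -> : 'D_v (cst a : V -> R) = cst 0 by apply/funext => x; exact: derive_cst.
exact: IH.
Qed.

Lemma CkD k O f h : open O -> Ck k O f -> Ck k O h -> Ck k O (f \+ h).
Proof.
move=> oO; elim: k f h => [|k IH] f h cf ch.
  split=> // x Ox.
  by apply: continuousD; [exact: (Ck_continuous cf Ox)|exact: (Ck_continuous ch Ox)].
split.
  move=> x Ox.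
  by apply: continuousD; [exact: (Ck_continuous cf Ox)|exact: (Ck_continuous ch Ox)].
move=> v; split.
  by move=> x Ox; exact: derivableD (Ck_derivable v cf Ox) (Ck_derivable v ch Ox).
apply: Ck_eq (IH _ _ (Ck_derive v cf) (Ck_derive v ch)) => // x Ox /=.
by rewrite -(deriveD (Ck_derivable v cf Ox) (Ck_derivable v ch Ox)).
Qed.

Lemma CkM k O f h : open O -> Ck k O f -> Ck k O h -> Ck k O (f \* h).
Proof.
move=> oO; elim: k f h => [|k IH] f h cf ch.
  split=> // x Ox.
  by apply: continuousM; [exact: (Ck_continuous cf Ox)|exact: (Ck_continuous ch Ox)].
split.
  move=> x Ox.
  by apply: continuousM; [exact: (Ck_continuous cf Ox)|exact: (Ck_continuous ch Ox)].
move=> v; split.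
  by move=> x Ox; exact: derivableM (Ck_derivable v cf Ox) (Ck_derivable v ch Ox).
apply: (@Ck_eq _ _ ((f \* 'D_v h) \+ (h \* 'D_v f))) => // [x Ox /=|].
  by rewrite -(deriveM (Ck_derivable v cf Ox) (Ck_derivable v ch Ox)).
by apply: CkD => //; apply: IH; by [exact: CkS|exact: Ck_derive].
Qed.

Lemma CkZ k O (a : R) f : open O -> Ck k O f -> Ck k O (fun x => a * f x).
Proof. by move=> oO cf; apply: (CkM oO (Ck_cst k O a) cf). Qed.

Lemma CkN k O f : open O -> Ck k O f -> Ck k O (fun x => - f x).
Proof.
by move=> oO /(CkZ (-1) oO); apply: Ck_eq => // x _; rewrite mulN1r.
Qed.

Lemma CkB k O f h : open O -> Ck k O f -> Ck k O h -> Ck k O (fun x => f x - h x).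
Proof. by move=> oO cf /(CkN oO); exact: CkD. Qed.

Lemma CkV k O f : open O -> (forall x, O x -> f x != 0) -> Ck k O f ->
  Ck k O (fun x => (f x)^-1).
Proof.
move=> oO f0; elim: k => [|k IH] cf.
  by split=> // x Ox; apply: continuousV; [exact: f0|exact: (Ck_continuous cf Ox)].
have IHf := IH (CkS cf); split.
  by move=> x Ox; apply: continuousV; [exact: f0|exact: (Ck_continuous cf Ox)].
move=> v; split.
  by move=> x Ox; apply: derivableV; [exact: f0|exact: Ck_derivable cf Ox].
apply: (@Ck_eq _ _ (fun x => - ((f x)^-1 * (f x)^-1 * 'D_v f x))) => // [x Ox /=|].
  rewrite deriveV//; [|exact: f0|exact: Ck_derivable cf Ox].
  by rewrite expr2 invfM scaleNr.
by apply: CkN => //; apply: CkM => //; [exact: CkM|exact: Ck_derive].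
Qed.

Lemma Ck_big (op : R -> R -> R) (idx : R) k O (I : Type) (r : seq I) (P : pred I)
    (F : I -> V -> R) :
  (forall f h, Ck k O f -> Ck k O h -> Ck k O (fun x => op (f x) (h x))) ->
  (forall i, Ck k O (F i)) -> Ck k O (fun x => \big[op/idx]_(i <- r | P i) F i x).
Proof.
move=> cop cF; elim: r => [|i r IH].
  by under eq_fun do rewrite big_nil; exact: Ck_cst.
by under eq_fun do rewrite big_cons; case: (P i) => //; exact: cop.
Qed.

Lemma Ck_sum k O (I : Type) (r : seq I) (P : pred I) (F : I -> V -> R) : open O ->
  (forall i, Ck k O (F i)) -> Ck k O (fun x => \sum_(i <- r | P i) F i x).
Proof. by move=> oO; apply: Ck_big => f h; exact: CkD. Qed.

Lemma Ck_prod k O (I : Type) (r : seq I) (P : pred I) (F : I -> V -> R) : open O ->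
  (forall i, Ck k O (F i)) -> Ck k O (fun x => \prod_(i <- r | P i) F i x).
Proof. by move=> oO; apply: Ck_big => f h; exact: CkM. Qed.

Lemma Ck_local k O f : (forall x, O x -> exists W, W x /\ Ck k W f) -> Ck k O f.
Proof.
elim: k f => [|k IH] f H.
  by split=> // x /H[W [Wx [cf _]]]; exact: cf.
split; first by move=> x /H [W [Wx cf]]; exact: Ck_continuous cf Wx.
move=> v; split; first by move=> x /H [W [Wx cf]]; exact: (Ck_derivable v cf Wx).
by apply: IH => x /H [W [Wx cf]]; exists W; split=> //; exact: Ck_derive.
Qed.

Lemma Ck_affine k O (l : V -> R) (a : V -> R) : open O ->
  continuous l -> (forall x v, is_derive x v l (a v)) -> Ck k O l.
Proof.
move=> oO cl dl; case: k => [|k]; split=> //; try by move=> x _; exact: cl.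
move=> v; split; first by move=> x _; have [] := dl x v.
by apply: Ck_eq (Ck_cst k O (a v)) => // x _; have [_ ->] := dl x v.
Qed.

End General.

End CkCalculus.

Arguments Ck_derivable {R V k O f x} v _ _.

(** * Differentiability and the chain rule *)

Section Differentiability.
Context {R : realType}.

Section Lines.
Context {V : normedModType R}.
Implicit Types (O : set V) (f : V -> R).

Lemma is_derive_line f (a v : V) (s : R) : derivable f (s *: v + a) v ->
  is_derive s 1 (fun t : R => f (t *: v + a)) ('D_v f (s *: v + a)).
Proof.
have E : (fun h : R => h^-1 *: (((fun t : R => f (t *: v + a)) \o shift s) (h *: 1) -
           f (s *: v + a))) =
         (fun h : R => h^-1 *: ((f \o shift (s *: v + a)) (h *: v) - f (s *: v + a))).
  by apply/funext => h /=; rewrite [_%:A]mulr1 scalerDl addrA.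
by move=> df; apply: DeriveDef; rewrite /derivable /derive E.
Qed.

Lemma derive_line f (a v : V) : derivable f a v ->
  is_derive (0 : R) 1 (fun t : R => f (t *: v + a)) ('D_v f a).
Proof.
by move=> df; rewrite -[a in 'D_v f a]add0r -(scale0r v); apply: is_derive_line;
  rewrite scale0r add0r.
Qed.

Lemma is_derive_scale f (a v : V) (c : R) : derivable f a v ->
  is_derive a (c *: v) f (c * 'D_v f a).
Proof.
move=> df; have dl := derive_line df.
have dc : is_derive (0 : R) 1 (fun t : R => t * c) c.
  by apply: is_derive_eq; rewrite scaler0 add0r [_%:A]mulr1.
have dl0 : is_derive (0 * c) 1 (fun t : R => f (t *: v + a)) ('D_v f a).
  by rewrite mul0r.
have [D1 D2] := @is_derive1_comp R (fun t : R => f (t *: v + a)) (fun t => t * c)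
  0 _ _ dl0 dc.
have E : (fun h : R => h^-1 *: ((f \o shift a) (h *: (c *: v)) - f a)) =
    (fun h : R => h^-1 *: ((((fun t : R => f (t *: v + a)) \o (fun t => t * c))
      \o shift 0)
       (h *: 1) - ((fun t : R => f (t *: v + a)) \o (fun t => t * c)) 0)).
  apply/funext => h /=.
  by rewrite mul0r scale0r add0r scalerA [_%:A]mulr1 addr0.
by rewrite mulrC; apply: DeriveDef; rewrite /derivable /derive E.
Qed.

(** The mean value theorem along a segment, comparing the increment with a
    fixed slope. *)
Lemma derive_mean f (a v : V) (c e l : R) :
  (forall s : R, 0 <= s <= 1 -> derivable f ((s * c) *: v + a) v) ->
  (forall s : R, 0 <= s <= 1 -> `|'D_v f ((s * c) *: v + a) - l| <= e) ->
  `|f (c *: v + a) - f a - c * l| <= `|c| * e.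
Proof.
move=> df de.
have d1 (s : R) : 0 <= s <= 1 ->
    is_derive s 1 (fun t : R => f ((t * c) *: v + a)) (c * 'D_v f ((s * c) *: v + a)).
  move=> s01; have dc : is_derive s 1 (fun t : R => t * c) c.
    by apply: is_derive_eq; rewrite scaler0 add0r [_%:A]mulr1.
  by rewrite mulrC; apply: (@is_derive1_comp R (fun t : R => f (t *: v + a))
    (fun t => t * c) s _ _ (is_derive_line (df s s01)) dc).
have [||s s01] := @MVT R (fun t : R => f ((t * c) *: v + a))
   (fun s => c * 'D_v f ((s * c) *: v + a)) 0 1 ltr01.
- by move=> s; rewrite in_itv /= => /andP[s0 s1]; apply: d1; rewrite !ltW.
- apply: derivable_within_continuous => s; rewrite in_itv /= => s01.
  by have [] := d1 s s01.
rewrite /= mul1r mul0r scale0r add0r subr0 mulr1 => ->.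
rewrite -mulrBr normrM ler_wpM2l//; apply: de.
by move: s01; rewrite in_itv /= => /andP[s0 s1]; rewrite !ltW.
Qed.

End Lines.

(** The truncations of h form a path from 0 to h that moves along one
    coordinate direction at a time. *)
Definition row_head n (h : 'rV[R]_n) (k : nat) : 'rV[R]_n :=
  \row_j (if (j < k)%N then h 0 j else 0).

Lemma row_head0 n (h : 'rV[R]_n) : row_head h 0 = 0.
Proof. by apply/rowP => j; rewrite !mxE. Qed.

Lemma row_head_full n (h : 'rV[R]_n) : row_head h n = h.
Proof. by apply/rowP => j; rewrite !mxE ltn_ord. Qed.

Lemma row_headS n (h : 'rV[R]_n) (k : 'I_n) :
  row_head h k.+1 = h 0 k *: delta_mx 0 k + row_head h k.
Proof.
apply/rowP => j; rewrite !mxE eqxx /= ltnS leq_eqVlt.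
have [jk|/= jk] := eqVneq j k; first by rewrite jk eqxx ltnn mulr1 addr0.
have -> : (j == k :> nat) = false by apply/negbTE.
by rewrite mulr0 add0r.
Qed.

Lemma row_norm_le n (h : 'rV[R]_n) (e : R) : 0 <= e ->
  (forall j, `|h 0 j| <= e) -> `|h| <= e.
Proof.
move=> e0 he; rewrite [`|h|]mx_normrE; apply: bigmax_le => //= -[i j] _ /=.
by rewrite ord1.
Qed.

Lemma coord_norm_le n (h : 'rV[R]_n) j : `|h 0 j| <= `|h|.
Proof.
rewrite [leRHS]mx_normrE; exact: (le_bigmax _ (fun i : 'I_1 * 'I_n => `|h i.1 i.2|)
  (0, j)).
Qed.

Lemma is_derive_coord n (y v : 'rV[R]_n) j :
  is_derive y v (fun h : 'rV[R]_n => h 0 j : R) (v 0 j).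
Proof.
apply: DeriveDef; first exact/diff_derivable/differentiable_coord.
rewrite /derive; apply: cvg_lim => //.
apply: cvg_trans (@cvg_cst _ (v 0 j) _ (0^') _); apply: near_eq_cvg; near=> h => /=.
have h0 : h != 0 by near: h; exact: nbhs_dnbhs_neq.
by rewrite !mxE addrK scalerA mulVf// scale1r.
Unshelve. all: by end_near.
Qed.

Lemma Ck_coord n k (j : 'I_n) (O : set 'rV[R]_n) : open O ->
  Ck k O (fun h : 'rV[R]_n => h 0 j : R).
Proof.
move=> oO; apply: (@Ck_affine _ _ k O _ (fun v : 'rV_n => v 0 j)) => //.
  exact: coord_continuous.
by move=> x v; exact: is_derive_coord.
Qed.

(** Membership in C^1 only speaks of directional derivatives. Going from x to h
    + x one coordinate at a time, the mean value theorem turns each increment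
    into h_k times a partial derivative at a point near x, and the continuity
    of the partial derivatives makes the expansion uniform in the direction of
    h. *)
Lemma C1_increment n (O : set 'rV[R]_n) f x : open O -> O x -> Ck 1 O f ->
  forall e, 0 < e -> \forall h \near (0 : 'rV[R]_n),
    `|f (h + x) - f x - \sum_k h 0 k * partial k f x| <= e * `|h|.
Proof.
move=> oO Ox cf e e0.
(* n + 1 rather than n, which may be 0 *)
have e1 : 0 < e / n.+1%:R by rewrite divr_gt0.
have : \forall y \near x, O y /\ forall k,
  `|partial k f y - partial k f x| <= e / n.+1%:R.
  suff H : \forall y \near x, forall k, `|partial k f y - partial k f x| <= e / n.+1%:R.
    by near=> y; split; [near: y; exact: open_nbhs_nbhs|near: y].
  apply: (@filter_forall _ _ (fun k y => `|partial k f y - partial k f x| <= e / n.+1%:R)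
    _ (nbhs_filter x)) => k.
  have := Ck_continuous (Ck_derive (delta_mx 0 k) cf) Ox.
  by move=> /cvgrPdist_le/(_ _ e1); apply: filterS => y; rewrite distrC.
move=> /nbhs_ballP[r /= r0 hr]; near=> h.
have hh : `|h| < r.
  by near: h; apply/nbhs_ballP; exists r => //= y; rewrite -ball_normE /= sub0r normrN.
have tail k (s : R) : 0 <= s <= 1 ->
    ball x r ((s * h 0 k) *: delta_mx 0 k + (row_head h k + x)).
  move=> /andP[s0 s1]; rewrite -ball_normE /= addrA opprD addrCA subrr addr0.
  rewrite normrN; apply: le_lt_trans hh; apply: row_norm_le => // j.
  rewrite !mxE eqxx /=; have [->|jk] := eqVneq j k.
    rewrite ltnn addr0 mulr1 normrM (le_trans _ (coord_norm_le h k))//.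
    by rewrite ger0_norm// ler_piMl.
  rewrite mulr0 add0r; case: ifP => _; first exact: coord_norm_le.
  by rewrite normr0.
have -> : f (h + x) - f x = \sum_(k < n) (f (row_head h k.+1 + x) - f (row_head h k + x)).
  rewrite -(big_mkord xpredT (fun k : nat => f (row_head h k.+1 + x)
    - f (row_head h k + x))).
  by rewrite (telescope_sumr (fun k => f (row_head h k + x)))// row_head_full row_head0
    add0r.
rewrite -sumrB; apply: le_trans (ler_norm_sum _ _ _) _.
have -> : e * `|h| = \sum_(k < n.+1) (`|h| * (e / n.+1%:R)).
  by rewrite sumr_const card_ord -[RHS]mulr_natr -mulrA divfK 1?mulrC// pnatr_eq0.
rewrite big_ord_recr /= -[leLHS]addr0; apply: lerD; last first.
  by rewrite mulr_ge0// ltW.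
apply: ler_sum => k _; rewrite row_headS -(addrA _ _ x).
apply: le_trans (derive_mean (e := e / n.+1%:R) _ _) _.
- by move=> s s01; have [Oy _] := hr _ (tail k s s01); exact: (Ck_derivable _ cf Oy).
- by move=> s s01; have [_ Py] := hr _ (tail k s s01); exact: Py.
- by apply: ler_wpM2r; [exact: ltW|exact: coord_norm_le].
Unshelve. all: by end_near.
Qed.

Lemma diff_of_increment (V W : normedModType R) (f : V -> W) (L : {linear V -> W}) x :
  continuous L ->
  (forall e, 0 < e -> \forall h \near 0, `|f (h + x) - f x - L h| <= e * `|h|) ->
  differentiable f x /\ 'd f x = L :> (V -> W).
Proof.
move=> cL dL; have dL' : f \o shift x = cst (f x) + L +o_ 0 id.
  apply/eqaddoP => e e0; apply: filterS (dL e e0) => h /=.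
  by rewrite opprD addrA.
have E := diff_unique cL dL'; split=> //.
by apply/diff_locallyP; rewrite E.
Qed.

Lemma C1_diff n (O : set 'rV[R]_n) f x : open O -> O x -> Ck 1 O f ->
  differentiable f x /\ forall v, 'd f x v = \sum_k v 0 k * partial k f x.
Proof.
move=> oO Ox cf.
pose L (h : 'rV[R]_n) : R := \sum_k h 0 k * partial k f x.
have L_lin : linear L.
  move=> u y z; rewrite /L scaler_sumr -big_split /=; apply: eq_bigr => k _.
  by rewrite !mxE mulrDl -mulrA.
pose sLM := GRing.isLinear.Build _ _ _ _ _ L_lin.
pose sL : {linear 'rV[R]_n -> R} := HB.pack L sLM.
have cL : continuous sL.
  have [cL _] : Ck 0 setT L.
    apply: Ck_sum => [|k]; first exact: openT.
    exact: (CkM openT (Ck_coord 0 k openT) (Ck_cst 0 setT (partial k f x))).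
  by move=> y; exact: cL.
have [df E] := diff_of_increment cL (C1_increment oO Ox cf).
by split=> // v; rewrite E.
Qed.

Lemma C1_derive n (O : set 'rV[R]_n) f x v : open O -> O x -> Ck 1 O f ->
  'D_v f x = \sum_k v 0 k * partial k f x.
Proof.
by move=> oO Ox cf; have [df <-] := C1_diff oO Ox cf; rewrite deriveE.
Qed.

(** Reduces a directional derivative to a derivative in one real variable, to
    which the chain rule applies. *)
Lemma derive_on_line (V W : normedModType R) (f : V -> W) y v :
  derivable f y v = derivable (fun h : R => f (h *: v + y)) 0 1 /\
  'D_v f y = 'D_1 (fun h : R => f (h *: v + y)) 0.
Proof.
have E : (fun h : R => h^-1 *: ((f \o shift y) (h *: v) - f y)) =
  (fun h : R => h^-1 *: (((fun h : R => f (h *: v + y)) \o shift 0) (h *: 1)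
    - f (0 *: v + y))).
  by apply/funext => h /=; rewrite scale0r add0r addr0 [_%:A]mulr1.
by rewrite /derivable /derive E.
Qed.

Lemma is_derive_comp_row (W : normedModType R) n (O : set 'rV[R]_n)
    (f : 'rV[R]_n -> R) (phi : W -> 'rV[R]_n) y v (a : 'I_n -> R) :
  open O -> O (phi y) -> Ck 1 O f ->
  (forall k, is_derive y v (fun z => phi z 0 k) (a k)) ->
  is_derive y v (f \o phi) (\sum_k a k * partial k f (phi y)).
Proof.
move=> oO Oy cf dphi; have [df dfE] := C1_diff oO Oy cf.
have dp : derivable phi y v.
  by apply/derivable_mxP => i j; rewrite ord1; have [] := dphi j.
have dpE := derive_mx dp.
pose gam (h : R) := phi (h *: v + y).
have [Ed ED] := derive_on_line phi y v.
have dg : differentiable gam 0 by apply/derivable1_diffP; rewrite -Ed.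
have df0 : differentiable f (gam 0) by rewrite /gam scale0r add0r.
have dfg : differentiable (f \o gam) 0 by exact: differentiable_comp.
have [Fd FD] := derive_on_line (f \o phi) y v.
apply: DeriveDef; first by rewrite Fd; apply/derivable1_diffP.
have -> : 'D_v (f \o phi) y = 'd (f \o gam) 0 1.
  by rewrite FD; exact: (@deriveE _ _ _ (f \o gam) 0 1 dfg).
have -> : 'd (f \o gam) 0 1 = 'd f (gam 0) ('d gam 0 1).
  by rewrite (diff_comp dg df0).
have -> : 'd gam 0 1 = 'D_v phi y by rewrite ED; symmetry;
  exact: (@deriveE _ _ _ gam 0 1 dg).
have -> : gam 0 = phi y by rewrite /gam scale0r add0r.
rewrite dfE.
apply: eq_bigr => k _; congr (_ * _); rewrite dpE mxE.
by have [_ ->] := dphi k.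
Qed.

Lemma continuous_row (W : normedModType R) n (phi : W -> 'rV[R]_n) y :
  (forall j, {for y, continuous (fun z => phi z 0 j : R)}) -> {for y, continuous phi}.
Proof.
move=> cphi; apply/cvgrPdist_le => e e0.
have H : \forall z \near y, forall j, `|phi y 0 j - phi z 0 j| <= e.
  apply: (@filter_forall _ _ (fun j z => `|phi y 0 j - phi z 0 j| <= e)
    _ (nbhs_filter y)) => j.
  by have /cvgrPdist_le/(_ _ e0) := cphi j.
by apply: filterS H => z Hz; apply: row_norm_le => [|j]; rewrite ?mxE// ltW.
Qed.

Lemma Ck_comp_row (W : normedModType R) n k (O : set 'rV[R]_n) (U : set W)
    (f : 'rV[R]_n -> R) (phi : W -> 'rV[R]_n) :
  open O -> open U -> (forall y, U y -> O (phi y)) ->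
  Ck k O f -> (forall j, Ck k U (fun z => phi z 0 j)) -> Ck k U (f \o phi).
Proof.
move=> oO oU UO; elim: k f => [|k IH] f cf cphi.
  split=> // y Uy; apply: continuous_comp (Ck_continuous cf (UO _ Uy)).
  by apply: continuous_row => j; exact: Ck_continuous (cphi j) Uy.
have IHf : Ck k U (f \o phi) by apply: IH => [|j]; apply: CkS.
have d y v : U y -> is_derive y v (f \o phi)
    (\sum_j 'D_v (fun z => phi z 0 j) y * partial j f (phi y)).
  move=> Uy; apply: (is_derive_comp_row (O := O)) => //; first exact: UO.
    exact: Ck_leq cf.
  by move=> j; apply/derivableP; exact: (Ck_derivable _ (cphi j) Uy).
split; first by move=> y; exact: Ck_continuous IHf.
move=> v; split; first by move=> y Uy; have [] := d y v Uy.
apply: (@Ck_eq _ _ _ _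
    (fun y => \sum_j 'D_v (fun z => phi z 0 j) y * partial j f (phi y))) => //.
  by move=> y Uy; have [_ ->] := d y v Uy.
apply: Ck_sum => // j; apply: CkM => //; first exact: Ck_derive.
by apply: IH => [|i]; [exact: Ck_derive|exact: CkS].
Qed.

Lemma derive_slice (V : normedModType R) (F : R * V -> R) (t : R) x v :
  derivable (fun y => F (t, y)) x v = derivable F (t, x) (0, v) /\
  'D_v (fun y => F (t, y)) x = 'D_(0, v) F (t, x).
Proof.
have E : (fun h : R => h^-1 *: (((fun y => F (t, y)) \o shift x) (h *: v) - F (t, x)))
  = (fun h : R => h^-1 *: ((F \o shift (t, x)) (h *: (0, v)) - F (t, x))).
  by apply/funext => h /=; rewrite /shift /= -[_ + (t, x)]/(h *: 0 + t, h *: v + x)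
    scaler0 add0r.
by rewrite /derivable /derive E.
Qed.

Lemma continuous_pairl (V : normedModType R) (t : R) : continuous (fun z : V => (t, z)).
Proof.
move=> z.
exact: (@cvg_pair _ _ _ (nbhs z) (nbhs t) (nbhs z) _ _ _ (fun _ => t) id (cvg_cst t)
  cvg_id).
Qed.

Lemma continuous_pairr (V : normedModType R) (x : V) : continuous (fun s : R => (s, x)).
Proof.
move=> s.
exact: (@cvg_pair _ _ _ (nbhs s) (nbhs s) (nbhs x) _ _ _ id (fun _ => x)
  cvg_id (cvg_cst x)).
Qed.

Lemma open_slice (V : normedModType R) (O : set (R * V)) (t : R) :
  open O -> open [set z | O (t, z)].
Proof.
by move=> oO; apply: (@open_comp _ _ (fun z : V => (t, z))) => // z _;
  exact: continuous_pairl.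
Qed.

Lemma Ck_slice (V : normedModType R) k (O : set (R * V)) (F : R * V -> R) (t : R) :
  Ck k O F -> Ck k [set x | O (t, x)] (fun x => F (t, x)).
Proof.
have cF G : Ck 0 O G -> forall x, O (t, x) -> {for x, continuous (fun x => G (t, x))}.
  move=> [cG _] x Ox; apply: (continuous_comp (g := G)) (cG _ Ox).
  exact: continuous_pairl.
elim: k F => [|k IH] F cf; first by split=> // x; apply: cF.
split; first exact: (cF F (Ck_leq (leq0n _) cf)).
move=> v; split=> [x Ox|].
  by have [-> _] := derive_slice F t x v; exact: (Ck_derivable _ cf Ox).
have -> : 'D_v (fun x => F (t, x)) = (fun x => 'D_(0, v) F (t, x)).
  by apply/funext => x; have [_ ->] := derive_slice F t x v.
exact: (IH ('D_(0, v) F) (Ck_derive _ cf)).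
Qed.

Lemma derive_slice_time (V : normedModType R) (F : R * V -> R) (t : R) x :
  derivable (fun s => F (s, x)) t 1 = derivable F (t, x) (1, 0) /\
  'D_1 (fun s => F (s, x)) t = 'D_(1, 0) F (t, x).
Proof.
have E : (fun h : R => h^-1 *: (((fun s => F (s, x)) \o shift t) (h *: 1) - F (t, x)))
  = (fun h : R => h^-1 *: ((F \o shift (t, x)) (h *: (1, 0)) - F (t, x))).
  by apply/funext => h /=; rewrite /shift /= -[_ + (t, x)]/(h *: 1 + t, h *: 0 + x)
    scaler0 add0r.
by rewrite /derivable /derive E.
Qed.

End Differentiability.

(** * Smooth steps and bumps *)

Section Bump.
Context {R : realType}.

Lemma Ck_real k (f df : R -> R) : (forall x : R, is_derive x 1 f (df x)) ->
  Ck k setT df -> Ck k.+1 setT f.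
Proof.
move=> dfx cdf; split.
  move=> x _; apply: differentiable_continuous; apply/derivable1_diffP.
  by have [] := dfx x.
have d v x : is_derive x v f (v * df x).
  have [d1 E1] := dfx x; have := is_derive_scale v d1.
  by rewrite [v%:A]mulr1 E1.
move=> v; split=> [x _|]; first by have [] := d v x.
apply: (@Ck_eq _ _ _ _ (fun x => v * df x)); first exact: openT.
  by move=> x _; have [_ ->] := d v x.
by apply: CkZ => //; exact: openT.
Qed.

Lemma Ck_comp_real (W : normedModType R) k (U : set W) (f : R -> R) (l : W -> R) :
  open U -> Ck k setT f -> Ck k U l -> Ck k U (f \o l).
Proof.
move=> oU; elim: k f => [|k IH] f cf cl.
  by split=> // y Uy; apply: continuous_comp (Ck_continuous cl Uy) (Ck_continuous cf I).
have d y v : U y -> is_derive y v (f \o l) ('D_1 f (l y) * 'D_v l y).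
  move=> Uy; have [Ed ED] := derive_on_line (f \o l) y v.
  have [Fd FD] := derive_on_line l y v.
  pose l1 := fun h : R => l (h *: v + y).
  have dl : is_derive (0 : R) 1 l1 ('D_v l y).
    by apply: DeriveDef; [rewrite -Fd; exact: (Ck_derivable _ cl Uy)|rewrite FD].
  have df : is_derive (l1 0) 1 f ('D_1 f (l y)).
    rewrite /l1 scale0r add0r; apply/derivableP; exact: (Ck_derivable _ cf).
  have [D1 D2] := is_derive1_comp df dl.
  by apply: DeriveDef; [rewrite Ed|rewrite ED].
split; first by move=> y; exact: Ck_continuous (IH f (CkS cf) (CkS cl)).
move=> v; split; first by move=> y Uy; have [] := d y v Uy.
apply: (@Ck_eq _ _ _ _ (('D_1 f \o l) \* 'D_v l)) => //.
  by move=> y Uy; have [_ ->] := d y v Uy.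
by apply: CkM => //; [apply: IH; [exact: Ck_derive|exact: CkS]|exact: Ck_derive].
Qed.

(** The functions x^-n exp (-1/x) include the classical smooth function exp
    (-1/x) that is flat at 0, and their linear combinations are stable under
    derivation. *)
Definition expinv (n : nat) (x : R) : R :=
  if 0 < x then x^-1 ^+ n * expR (- x^-1) else 0.

Lemma expinv_ge0 n x : 0 <= expinv n x.
Proof.
rewrite /expinv; case: ifP => // x0; apply: mulr_ge0; last exact: expR_ge0.
by rewrite exprn_ge0// invr_ge0 ltW.
Qed.

Lemma expinv_gt0 n x : 0 < x -> 0 < expinv n x.
Proof.
by move=> x0; rewrite /expinv x0 mulr_gt0 ?expR_gt0// exprn_gt0// invr_gt0.
Qed.

(** Since y^(n+1) <= (n+1)! exp y at y = 1/x. Gaining one power of x at every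
    order n is what gives differentiability at 0. *)
Lemma expinv_le n x : expinv n x <= n.+1`!%:R * `|x|.
Proof.
rewrite /expinv; case: ifP => x0; last by rewrite mulr_ge0.
rewrite gtr0_norm// expRN.
have xi0 : 0 < x^-1 by rewrite invr_gt0.
have e0 := expR_gt0 (x^-1).
rewrite ler_pdivrMr// -ler_pdivrMl; last by rewrite mulr_gt0// ltr0n fact_gt0.
apply: le_trans (expR_ge1Dxn n (ltW xi0)).
by rewrite invfM -mulrA -exprS mulrC lerDr.
Qed.

(** At 0 the difference quotient of [expinv n] is [expinv n.+1], which tends to
    0 by [expinv_le]. *)
Lemma is_derive_expinv n (x : R) :
  is_derive x 1 (expinv n) (expinv n.+2 x - n%:R * expinv n.+1 x).
Proof.
have [x0|x0|->] := ltgtP x 0.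
- have -> : expinv n.+2 x - n%:R * expinv n.+1 x = 0.
    by rewrite /expinv !(lt_gtF x0) mulr0 subr0.
  have dcst := @is_derive_cst R R R 0 x 1; apply: near_eq_is_derive dcst.
  by near=> y; rewrite /expinv lt_gtF//; near: y; exact: lt_nbhsl.
- have dinv : is_derive x 1 (fun y : R => y^-1) (- x ^- 2).
    have x0' : x != 0 by rewrite gt_eqF.
    apply: DeriveDef; first exact: (@derivableV R R id x 1 x0' (@derivable_id _ _ x 1)).
    by rewrite (@deriveV R R id x 1 x0' (@derivable_id _ _ x 1)) derive_id [_%:A]mulr1.
  have dexp : is_derive x 1 (fun y => expR (- y^-1)) (expR (- x^-1) * x ^- 2).
    apply: (@is_derive1_comp _ expR (fun y => - y^-1)).
    by apply: is_derive_eq; rewrite opprK.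
  have dpow : is_derive x 1 (fun y : R => y^-1 ^+ n) (n%:R * x^-1 ^+ n.-1 * (- x ^- 2)).
    have -> : (fun y : R => y^-1 ^+ n) = (fun y : R => y^-1) ^+ n.
      by apply/funext => y; rewrite exprfctE.
    exact: is_deriveX.
  apply: (near_eq_is_derive (f := (fun y : R => y^-1 ^+ n) \* (fun y => expR (- y^-1)))).
    by near=> y; have y0 : 0 < y by [near: y; exact: lt_nbhsr]; rewrite /expinv y0.
  apply: is_derive_eq; rewrite /expinv x0 /= /GRing.scale /=.
  rewrite -exprVn; case: n {dpow} => [|n] /=; first by rewrite !expr0; ring.
  by rewrite !exprS; ring.
have E0 m : expinv m 0 = 0 by rewrite /expinv ltxx.
rewrite !E0 mulr0 subr0.
have L : h^-1 *: ((expinv n \o shift 0) (h *: 1) - expinv n 0) @[h --> (0:R)^'] --> (0:R).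
  apply/cvgrPdist_le => e e0; near=> h.
  have h0 : h != 0 by near: h; exact: nbhs_dnbhs_neq.
  rewrite /= addr0 [_%:A]mulr1 E0 subr0 sub0r normrN.
  have -> : h^-1 *: expinv n h = expinv n.+1 h.
    rewrite /expinv; case: ifP => _; last by rewrite scaler0.
    by rewrite exprS /GRing.scale /= mulrA.
  rewrite ger0_norm ?expinv_ge0//; apply: le_trans (expinv_le _ _) _.
  rewrite -ler_pdivlMl ?ltr0n ?fact_gt0//; near: h; apply: dnbhs0_le.
  by rewrite mulr_gt0// invr_gt0 ltr0n fact_gt0.
by apply: DeriveDef; [apply/cvg_ex; exists 0|exact/cvg_lim].
Unshelve. all: by end_near.
Qed.

Lemma smooth_expinv n : smooth_open setT (expinv n).
Proof.
move=> k; elim: k n => [|k IH] n.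
  split=> // x _; apply: differentiable_continuous; apply/derivable1_diffP.
  by have [] := is_derive_expinv n x.
apply: (Ck_real (is_derive_expinv n)); apply: CkB; [exact: openT|exact: IH|].
by apply: CkZ; [exact: openT|exact: IH].
Qed.

Lemma Ck_id k : Ck k setT (id : R -> R).
Proof.
case: k => [|k]; first by split=> // x _; exact: cvg_id.
by apply: (@Ck_real _ _ (cst 1)) ; exact: Ck_cst.
Qed.

Definition unit_step (s : R) : R := expinv 0 s / (expinv 0 s + expinv 0 (1 - s)).

Lemma unit_step_den_gt0 (s : R) : 0 < expinv 0 s + expinv 0 (1 - s).
Proof.
have [s0|s0] := ltP 0 s; first by rewrite ltr_pwDl ?expinv_gt0 ?expinv_ge0.
by rewrite ltr_pwDr ?expinv_ge0// expinv_gt0//; lra.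
Qed.

Lemma unit_step0 s : s <= 0 -> unit_step s = 0.
Proof. by move=> s0; rewrite /unit_step {1}/expinv ltNge s0 mul0r. Qed.

Lemma unit_step1 s : 1 <= s -> unit_step s = 1.
Proof.
move=> s1; have s0 : 0 < s by lra.
rewrite /unit_step; have -> : expinv 0 (1 - s) = 0.
  by rewrite /expinv ifF//; apply/negbTE; rewrite -leNgt; lra.
by rewrite addr0 divff// gt_eqF// expinv_gt0.
Qed.

Lemma unit_step_ge0 s : 0 <= unit_step s.
Proof. by rewrite divr_ge0 ?expinv_ge0// ltW// unit_step_den_gt0. Qed.

Lemma unit_step_le1 s : unit_step s <= 1.
Proof. by rewrite ler_pdivrMr ?unit_step_den_gt0// mul1r lerDl expinv_ge0. Qed.

Lemma smooth_unit_step : smooth_open setT unit_step.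
Proof.
have cflip k : Ck k setT (fun s : R => expinv 0 (1 - s)).
  apply: (@Ck_comp_real _ k setT (expinv 0)); [exact: openT|exact: smooth_expinv|].
  by apply: CkB; [exact: openT|exact: Ck_cst|exact: Ck_id].
move=> k; apply: CkM; [exact: openT|exact: smooth_expinv|].
apply: CkV; [exact: openT|by move=> x _; rewrite gt_eqF// unit_step_den_gt0|].
by apply: CkD; [exact: openT|exact: smooth_expinv|exact: cflip].
Qed.

(** Taking the bump as a derivative makes its integral 1 by the fundamental
    theorem of calculus, with an explicit primitive. *)
Definition bump : R -> R := 'D_1 unit_step.

Lemma is_derive_unit_step (s : R) : is_derive s 1 unit_step (bump s).
Proof. by apply/derivableP; exact: (Ck_derivable _ (smooth_unit_step 1)). Qed.

Lemma smooth_bump : smooth_open setT bump.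
Proof. by move=> k; apply: Ck_derive; exact: smooth_unit_step. Qed.

Lemma bump_ge0 s : 0 <= bump s.
Proof.
have dE : is_derive s 1 (expinv 0) (expinv 2 s).
  by have := is_derive_expinv 0 s; rewrite mul0r subr0.
have dF : is_derive s 1 (fun s => expinv 0 (1 - s)) (- expinv 2 (1 - s)).
  have dl : is_derive s 1 (fun s : R => 1 - s) (-1).
    by have : is_derive s 1 (cst (1 : R) - (id : R -> R)) (0 - 1);
      [apply: is_deriveB|rewrite sub0r].
  have dE1 : is_derive (1 - s) 1 (expinv 0) (expinv 2 (1 - s)).
    by have := is_derive_expinv 0 (1 - s); rewrite mul0r subr0.
  by have := @is_derive1_comp _ (expinv 0) (fun s : R => 1 - s) s _ _ dE1 dl;
    rewrite mulrN1.
have D0 := unit_step_den_gt0 s.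
have dN : is_derive s 1 (fun s => (expinv 0 s + expinv 0 (1 - s))^-1)
   (- (expinv 0 s + expinv 0 (1 - s)) ^- 2 * (expinv 2 s - expinv 2 (1 - s))).
  have dD : is_derive s 1 (expinv 0 \+ (fun s => expinv 0 (1 - s)))
    (expinv 2 s - expinv 2 (1 - s)).
    exact: is_deriveD.
  have N0 : (expinv 0 \+ (fun s => expinv 0 (1 - s))) s != 0 by rewrite gt_eqF.
  apply: DeriveDef; first by apply: derivableV => //; have [] := dD.
  rewrite (deriveV N0); last by have [] := dD.
  by have [_ ->] := dD.
have [_] := is_deriveM dE dN; rewrite -/unit_step -/(bump s) => ->.
rewrite /GRing.scale /=.
set a := expinv 0 s; set b := expinv 0 (1 - s); set a' := expinv 2 s;
  set b' := expinv 2 (1 - s).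
have -> : a * (- (a + b) ^- 2 * (a' - b')) + (a + b)^-1 * a' =
    (a' * b + a * b') / (a + b) ^+ 2.
  by field; rewrite gt_eqF.
by rewrite divr_ge0 ?sqr_ge0// addr_ge0// mulr_ge0// expinv_ge0.
Qed.

Lemma bump_out s : s < 0 \/ 1 < s -> bump s = 0.
Proof.
move=> s01; have dc (c : R) : (\near s, unit_step s = c) -> bump s = 0.
  by move=> h; rewrite /bump (near_eq_derive (g := cst c))// derive_cst.
case: s01 => [s0|s1]; [apply: (dc 0)|apply: (dc 1)]; near=> y.
  by apply: unit_step0; apply: ltW; near: y; exact: lt_nbhsl.
by apply: unit_step1; apply: ltW; near: y; exact: lt_nbhsr.
Unshelve. all: by end_near.
Qed.

Lemma bump_bounded : exists2 M : R, 0 < M & forall s, bump s <= M.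
Proof.
have c : continuous bump by move=> s; exact: (Ck_continuous (smooth_bump 0) I).
have [x x01 xmax] := @EVT_max R bump 0 1 ler01 (continuous_subspaceT c).
exists (bump x + 1) => [|s]; first by rewrite ltr_wpDl// bump_ge0.
apply: ler_wpDr => //; have [s0|s0] := ltP s 0.
  by rewrite bump_out ?bump_ge0//; left.
have [s1|s1] := ltP 1 s; first by rewrite bump_out ?bump_ge0//; right.
by apply: xmax; rewrite in_itv /= s0 s1.
Qed.

End Bump.

(** * Integrals of products over R^m *)

Section LebesgueRn.
Context {R : realType}.

Lemma integral_sf_product d1 d2 (T1 : measurableType d1) (T2 : measurableType d2)
    (m1 : {sigma_finite_measure set T1 -> \bar R})
    (m2 : {sigma_finite_measure set T2 -> \bar R}) (f : (T1 * T2)%type -> \bar R) :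
  (forall z, 0 <= f z)%E -> measurable_fun [set: _] f ->
  (\int[sf_product m1 m2]_z f z = \int[m1]_x \int[m2]_y f (x, y))%E.
Proof. by move=> f0 mf; exact: (fubini_tonelli1 f mf f0). Qed.

Lemma integral_Rn0 (f : Rn R 0 -> \bar R) : measurable_fun setT f ->
  (\int[lebesgueRn R 0]_z f z = f tt)%E.
Proof. by move=> mf; rewrite integral_dirac// diracT mul1e. Qed.

Lemma integral_RnS m (f : Rn R m.+1 -> \bar R) :
  (forall z, 0 <= f z)%E -> measurable_fun [set: _] f ->
  (\int[lebesgueRn R m.+1]_z f z =
   \int[lebesgue_measure]_x \int[lebesgueRn R m]_y f (x, y))%E.
Proof. by move=> f0 mf; exact: integral_sf_product. Qed.

Lemma rowRn_fst m (z : Rn R m.+1) : rowRn z 0 ord0 = z.1.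
Proof.
have -> : (ord0 : 'I_m.+1) = lshift m (ord0 : 'I_1) by apply/val_inj.
by apply: etrans (row_mxEl ((z.1)%:M : 'M[R]_1) (rowRn z.2) 0 ord0) _; rewrite mxE mulr1n.
Qed.

Lemma rowRn_snd m (z : Rn R m.+1) k : rowRn z 0 (lift ord0 k) = rowRn z.2 0 k.
Proof.
have -> : lift ord0 k = rshift 1 k by apply/val_inj.
exact: (row_mxEr ((z.1)%:M : 'M[R]_1) (rowRn z.2) 0 k).
Qed.

Lemma measurable_coordRn m k : measurable_fun setT (fun z : Rn R m => rowRn z 0 k).
Proof.
elim: m k => [|m IH] k; first by case: k.
have [j ->|->] := unliftP ord0 k.
  under eq_fun do rewrite rowRn_snd.
  exact: measurableT_comp (IH j) (@measurable_snd _ _ _ _).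
under eq_fun do rewrite rowRn_fst.
exact: measurable_fst.
Qed.

Lemma measurable_prodRn m (h : 'I_m -> R -> R) :
  (forall k, measurable_fun setT (h k)) ->
  measurable_fun setT (fun z : Rn R m => \prod_k h k (rowRn z 0 k)).
Proof.
move=> mh; apply: measurable_prod => k _.
exact: measurableT_comp (mh k) (measurable_coordRn k).
Qed.

(** Tonelli's theorem, one coordinate at a time. *)
Lemma integral_prodRn m (h : 'I_m -> R -> R) (c : 'I_m -> R) :
  (forall k, measurable_fun setT (h k)) -> (forall k x, 0 <= h k x) ->
  (forall k, \int[lebesgue_measure]_x (h k x)%:E = (c k)%:E)%E ->
  (\int[lebesgueRn R m]_z (\prod_k h k (rowRn z 0 k))%:E = (\prod_k c k)%:E)%E.
Proof.
elim: m h c => [|m IH] h c mh h0 hc.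
  rewrite integral_Rn0; first by rewrite !big_ord0.
  by apply/measurable_EFinP; exact: measurable_prodRn.
rewrite integral_RnS; last 2 first.
- by move=> z; rewrite lee_fin prodr_ge0.
- by apply/measurable_EFinP; exact: measurable_prodRn.
have E x : (\int[lebesgueRn R m]_y (\prod_k h k (rowRn ((x, y) : Rn R m.+1) 0 k))%:E =
    (\prod_k c (lift ord0 k))%:E * (h ord0 x)%:E)%E.
  rewrite muleC -(IH (fun k => h (lift ord0 k)) (fun k => c (lift ord0 k))) //.
  rewrite -ge0_integralZl_EFin//.
  - by apply: eq_integral => y _; rewrite big_ord_recl rowRn_fst -EFinM; congr (_ * _)%:E;
      apply: eq_bigr => k _; rewrite rowRn_snd.
  - by move=> y _; rewrite lee_fin prodr_ge0.
  - by apply/measurable_EFinP; exact: (@measurable_prodRn m (fun k => h (lift ord0 k))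
    (fun k => mh _)).
under eq_integral do rewrite E.
rewrite ge0_integralZl_EFin//; last first.
- apply: prodr_ge0 => k _; rewrite -lee_fin -hc integral_ge0// => x _.
  by rewrite lee_fin.
- by apply/measurable_EFinP; exact: mh.
- by move=> x _; rewrite lee_fin.
by rewrite hc big_ord_recl muleC EFinM.
Qed.

End LebesgueRn.

(** * A Young-type inequality *)

Section YoungIntegral.
Context {R : realType}.

(** Either a <= l, or a / l >= 1 is at most its own p-th power. This replaces
    Hoelder's inequality: the parameter l is free and is chosen at the end so
    as to balance the two terms. *)
Lemma young_pointwise (p l a : R) : 1 <= p -> 0 < l -> 0 <= a ->
  a <= l + l `^ (1 - p) * a `^ p.
Proof.
move=> p1 l0 a0; have [al|la] := leP a l.
  by apply: le_trans al _; rewrite lerDl mulr_ge0// powR_ge0.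
apply: ler_wpDl; first exact: ltW.
have al1 : 1 <= a / l by rewrite ler_pdivlMr// mul1r ltW.
have h := le1r_powR al1 p1.
have -> : l `^ (1 - p) * a `^ p = l * (a / l) `^ p.
  rewrite powRM// ?invr_ge0 ?(ltW l0)//.
  rewrite -powR_inv1 ?(ltW l0)// -powRrM mulN1r.
  rewrite powRD; last by apply/implyP => _; rewrite gt_eqF.
  by rewrite powRr1 ?(ltW l0)// -mulrA (mulrC (l `^ (- p))).
by rewrite -ler_pdivrMl// mulrC.
Qed.

Context d (T : measurableType d) (mu : {measure set T -> \bar R}).
Variables (w phi : T -> R) (p l B V q : R).
Hypotheses (mw : measurable_fun setT w) (mphi : measurable_fun setT phi).
Hypotheses (phi0 : forall x, 0 <= phi x) (phiB : forall x, phi x <= B).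
Hypothesis phiV : (\int[mu]_x (phi x)%:E <= V%:E)%E.
Hypothesis wq : (\int[mu]_x (`|w x| `^ p)%:E <= q%:E)%E.
Hypotheses (p1 : 1 <= p) (l0 : 0 < l) (B0 : 0 <= B).

(** The mass V of phi multiplies the first term of [young_pointwise] and its
    supremum B the second one, so that no norm of phi with a conjugate exponent
    is involved. *)
Lemma young_integral :
  (\int[mu]_x (`|w x| * phi x)%:E <= (l * V + l `^ (1 - p) * B * q)%:E)%E.
Proof.
have mpow : measurable_fun setT (fun x => `|w x| `^ p).
  exact: measurableT_comp (measurable_powR p)
    (measurableT_comp (@normr_measurable R setT) mw).
have c0 : 0 <= l `^ (1 - p) * B.
  by rewrite mulr_ge0 ?powR_ge0.
apply: (@le_trans _ _ (\int[mu]_x (l%:E * (phi x)%:E + (l `^ (1 - p)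
  * B)%:E * (`|w x| `^ p)%:E))%E).
  apply: ge0_le_integral => //.
  - by move=> x _; rewrite lee_fin mulr_ge0.
  - by apply/measurable_EFinP; apply: measurable_funM => //; exact: measurableT_comp.
  - by apply: emeasurable_funD; apply: measurable_funeM; apply/measurable_EFinP.
  move=> x _; rewrite -!EFinM -EFinD lee_fin.
  have := young_pointwise p1 l0 (normr_ge0 (w x)) => /(ler_wpM2r (phi0 x)) h.
  apply: le_trans h _; rewrite mulrDl lerD2l.
  rewrite -2!mulrA; apply: ler_wpM2l; first exact: powR_ge0.
  by rewrite mulrC ler_wpM2r ?powR_ge0.
rewrite ge0_integralD//; last 4 first.
- by move=> x _; rewrite -EFinM lee_fin mulr_ge0// ltW.
- by apply: measurable_funeM; apply/measurable_EFinP.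
- by move=> x _; rewrite -EFinM lee_fin mulr_ge0// powR_ge0.
- by apply: measurable_funeM; apply/measurable_EFinP.
have mphiE : measurable_fun setT (fun x => (phi x)%:E) by exact/measurable_EFinP.
have mpowE : measurable_fun setT (fun x => (`|w x| `^ p)%:E) by exact/measurable_EFinP.
have phiE0 x : [set: T] x -> (0 <= (phi x)%:E)%E by rewrite lee_fin.
have powE0 x : [set: T] x -> (0 <= (`|w x| `^ p)%:E)%E by rewrite lee_fin powR_ge0.
rewrite (ge0_integralZl_EFin mu measurableT phiE0 mphiE (ltW l0)).
rewrite (ge0_integralZl_EFin mu measurableT powE0 mpowE c0).
rewrite EFinD !EFinM; apply: leeD.
  by apply: lee_wpmul2l => //; rewrite lee_fin ltW.
by rewrite -EFinM; apply: lee_wpmul2l.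
Qed.

Section Dominated.
Variable psi : T -> R.
Hypotheses (mpsi : measurable_fun setT psi) (psi_le : forall x, `|psi x| <= phi x).

Lemma young_integral_dom :
  (\int[mu]_x (`|w x * psi x|)%:E <= (l * V + l `^ (1 - p) * B * q)%:E)%E.
Proof.
apply: le_trans young_integral; apply: ge0_le_integral => //.
- by apply/measurable_EFinP; apply: measurableT_comp => //; exact: measurable_funM.
- by apply/measurable_EFinP; apply: measurable_funM => //; exact: measurableT_comp.
- by move=> x _; rewrite lee_fin normrM ler_wpM2l.
Qed.

Lemma young_integrable : mu.-integrable setT (fun x => (w x * psi x)%:E).
Proof.
apply/integrableP; split; first by apply/measurable_EFinP; exact: measurable_funM.
exact: le_lt_trans young_integral_dom (ltry _).
Qed.

Lemma young_abs_Rintegral :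
  `|\int[mu]_x (w x * psi x)| <= l * V + l `^ (1 - p) * B * q.
Proof.
rewrite -lee_fin; have yi := young_integrable.
apply: le_trans young_integral_dom.
apply: (@le_trans _ _ (\int[mu]_x `|w x * psi x|)%:E).
  by rewrite lee_fin; apply: le_normr_Rintegral.
rewrite /Rintegral fineK//.
apply: integrable_fin_num => //; exact: integrable_norm.
Qed.

End Dominated.

End YoungIntegral.

(** * Product mollifiers and their differences *)

Section Kernels.
Context {R : realType}.
Implicit Types (r s : R).

Definition step_at (a r s : R) : R := unit_step ((s - a) / r).
Definition bump_at (a r s : R) : R := r^-1 * bump ((s - a) / r).

Lemma Ck_rescale k a r : Ck k setT (fun s : R => (s - a) / r).
Proof.
have := CkM openT (CkB openT (Ck_id k) (Ck_cst k setT a)) (Ck_cst k setT r^-1).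
exact.
Qed.

Lemma smooth_step_at a r : smooth_open setT (step_at a r).
Proof.
by move=> k; apply: Ck_comp_real (Ck_rescale k a r);
  [exact: openT|exact: smooth_unit_step].
Qed.

Lemma smooth_bump_at a r : smooth_open setT (bump_at a r).
Proof.
move=> k; apply: CkZ; first exact: openT.
by apply: Ck_comp_real (Ck_rescale k a r); [exact: openT|exact: smooth_bump].
Qed.

Lemma is_derive_step_at a r s : is_derive s 1 (step_at a r) (bump_at a r s).
Proof.
have d1 : is_derive s 1 (fun s : R => (s - a) / r) r^-1.
  have dB : is_derive s 1 ((id : R -> R) - cst a) (1 - 0) by apply: is_deriveB.
  have := is_deriveM dB (@is_derive_cst R R R r^-1 s 1).
  by rewrite scaler0 add0r subr0 [r^-1%:A]mulr1.
have := @is_derive1_comp R unit_step (fun s : R => (s - a) / r)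
  s _ _ (is_derive_unit_step _) d1.
by rewrite mulrC.
Qed.

Lemma bump_at_ge0 a r s : 0 < r -> 0 <= bump_at a r s.
Proof. by move=> r0; rewrite mulr_ge0 ?bump_ge0// invr_ge0 ltW. Qed.

Lemma bump_at_out a r s : 0 < r -> s < a \/ a + r < s -> bump_at a r s = 0.
Proof.
move=> r0 sa; rewrite /bump_at bump_out ?mulr0//.
case: sa => sa; [left|right]; first by rewrite pmulr_llt0 ?invr_gt0// subr_lt0.
by rewrite ltr_pdivlMr// mul1r; lra.
Qed.

Lemma step_at_out a r s : 0 < r ->
  (s < a -> step_at a r s = 0) /\ (a + r < s -> step_at a r s = 1).
Proof.
move=> r0; split=> sa; [apply: unit_step0|apply: unit_step1].
  by rewrite pmulr_lle0 ?invr_gt0// subr_le0 ltW.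
by rewrite ler_pdivlMr// mul1r; lra.
Qed.

Lemma continuous_bump_at a r : continuous (bump_at a r).
Proof. by move=> s; exact: (Ck_continuous (smooth_bump_at a r 0) I). Qed.

Lemma measurable_bump_at a r : measurable_fun setT (bump_at a r).
Proof. by apply: continuous_measurable_fun => s; exact: continuous_bump_at. Qed.

Lemma integral_bump_at a r : 0 < r ->
  (\int[lebesgue_measure]_s (bump_at a r s)%:E = 1%:E)%E.
Proof.
move=> r0; have ar : a < a + r by rewrite ltrDl.
have -> : (\int[lebesgue_measure]_s (bump_at a r s)%:E =
    \int[lebesgue_measure]_(s in `[a, (a + r)%R]) (bump_at a r s)%:E)%E.
  rewrite [RHS]integral_mkcond; apply: eq_integral => s _.
  rewrite patchE; case: ifPn => // /negP sa; rewrite bump_at_out//.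
  have [sa1|sa1] := ltP s a; [by left|right].
  rewrite ltNge; apply/negP => sa2; apply: sa.
  by rewrite inE /= in_itv /= sa1 sa2.
have cstep : continuous (step_at a r) by move=> s;
  exact: (Ck_continuous (smooth_step_at a r 0) I).
rewrite (@continuous_FTC2 R (bump_at a r) (step_at a r) a (a + r)) //.
- have -> : step_at a r a = 0 by rewrite /step_at subrr mul0r unit_step0.
  have -> : step_at a r (a + r) = 1.
    by rewrite /step_at addrAC subrr add0r divff ?gt_eqF// unit_step1.
  by rewrite sube0.
- exact/continuous_subspaceT/continuous_bump_at.
- split.
  + by move=> s _; have [] := is_derive_step_at a r s.
  + exact/cvg_at_right_filter/cstep.
  + exact/cvg_at_left_filter/cstep.
- by move=> s _; rewrite derive1E; have [_ ->] := is_derive_step_at a r s.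
Qed.

Lemma integral_indic_itv a r : 0 < r ->
  (\int[lebesgue_measure]_s (\1_`[a, (a + r)%R] s)%:E = r%:E)%E.
Proof.
move=> r0; rewrite integral_indic// setIT.
apply: etrans (lebesgue_measure_itv `[a, a + r]) _; rewrite /= lte_fin ltrDl r0.
by rewrite -EFinD addrAC subrr add0r.
Qed.

Section Products.
Context {m : nat}.
Implicit Types (a y : 'rV[R]_m).

Definition cube (a : 'rV[R]_m) (r : R) : set 'rV[R]_m :=
  [set y | forall k, `[a 0 k, a 0 k + r]%classic (y 0 k)].

Lemma cube_compact (a : 'rV[R]_m) (r : R) : compact (cube a r).
Proof.
apply: (rV_compact (A := fun k => `[a 0 k, a 0 k + r]%classic)) => k.
exact: segment_compact.
Qed.

Definition mollifier (a : 'rV[R]_m) r y := \prod_k bump_at (a 0 k) r (y 0 k).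

Lemma mollifier_ge0 a r y : 0 < r -> 0 <= mollifier a r y.
Proof. by move=> r0; rewrite prodr_ge0// => k _; exact: bump_at_ge0. Qed.

Lemma mollifier_out a r y : 0 < r -> ~ cube a r y -> mollifier a r y = 0.
Proof.
move=> r0 /existsNP[k yk]; rewrite /mollifier (bigD1 k)//= bump_at_out ?mul0r//.
have [ya|ya] := ltP (y 0 k) (a 0 k); [by left|right].
by rewrite ltNge; apply/negP => ya2; apply: yk; rewrite /= in_itv /= ya ya2.
Qed.

Lemma mollifier_le a r y (M : R) : 0 < r -> (forall s, bump s <= M) ->
  mollifier a r y <= (M / r) ^+ m.
Proof.
move=> r0 rM; rewrite -[m in _ ^+ m]card_ord -prodr_const.
apply: ler_prod => k _; rewrite bump_at_ge0//= /bump_at mulrC.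
by rewrite ler_wpM2r// invr_ge0 ltW.
Qed.

Lemma measurable_mollifier a r : measurable_fun setT (mollifier a r \o @rowRn R m).
Proof. exact: (@measurable_prodRn R m (fun k => bump_at (a 0 k) r)
  (fun k => measurable_bump_at _ _)). Qed.

Lemma integral_mollifier a r : 0 < r ->
  (\int[lebesgueRn R m]_z (mollifier a r (rowRn z))%:E = 1%:E)%E.
Proof.
move=> r0; rewrite (@integral_prodRn R m (fun k => bump_at (a 0 k) r) (fun _ => 1));
  last 3 first.
- by move=> k; exact: measurable_bump_at.
- by move=> k s; exact: bump_at_ge0.
- by move=> k; exact: integral_bump_at.
by rewrite big1.
Qed.

(** Only the j-th factor depends on the j-th coordinate. *)
Lemma partial_prod (h : 'I_m -> R -> R) (j : 'I_m) y (dh : R) :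
  is_derive (y 0 j) 1 (h j) dh ->
  partial j (fun y => \prod_k h k (y 0 k)) y = dh * \prod_(k | k != j) h k (y 0 k).
Proof.
move=> dhj; rewrite /partial.
have [_ ->] := derive_on_line (fun y : 'rV[R]_m => \prod_k h k (y 0 k)) y (delta_mx 0 j).
have -> : (fun s : R => \prod_k h k ((s *: delta_mx 0 j + y) 0 k)) =
    (h j \o (fun s => s + y 0 j)) \* cst (\prod_(k | k != j) h k (y 0 k)).
  apply/funext => s /=; rewrite (bigD1 j)//=; congr (_ * _).
    by rewrite !mxE !eqxx mulr1.
  by apply: eq_bigr => k kj; rewrite !mxE (negbTE kj) andbF mulr0 add0r.
have ds : is_derive (0 : R) 1 (fun s => s + y 0 j) 1.
  have : is_derive (0 : R) 1 ((id : R -> R) + cst (y 0 j)) (1 + 0) by apply: is_deriveD.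
  by rewrite addr0.
have dh0 : is_derive (0 + y 0 j) 1 (h j) dh by rewrite add0r.
have d1 := @is_derive1_comp R (h j) (fun s => s + y 0 j) 0 _ _ dh0 ds.
have [_ ->] := is_deriveM d1 (@is_derive_cst R R R (\prod_(k | k != j) h k (y 0 k)) 0 1).
by rewrite scaler0 add0r mulr1 [_ *: _]mulrC.
Qed.

(** The j-th term in the telescoping of a difference of two products: factors
    of b before j, of c after j. *)
Definition splice (T : Type) (b c e : T) (j k : 'I_m) : T :=
  if (k < j)%N then b else if k == j then e else c.

Lemma telescope_prod (b c : 'I_m -> R) :
  \sum_j (c j - b j) * \prod_(k | k != j) splice (b k) (c k) 0 j k =
  \prod_k c k - \prod_k b k.
Proof.
pose P (i : nat) := \prod_(k < m) (if (k < i)%N then b k else c k).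
have -> : \prod_k c k = P 0 by [].
have -> : \prod_k b k = P m by apply: eq_bigr => k _; rewrite ltn_ord.
have -> : P 0 - P m = - (P m - P 0) by rewrite opprB.
rewrite -(telescope_sumr P (leq0n m)) big_mkord -sumrN; apply: eq_bigr => j _.
rewrite opprB /P [in RHS](bigD1 j)//= ltnn [X in _ = _ - X](bigD1 j)//= ltnS leqnn.
rewrite mulrBl; congr (_ * _ - _ * _); apply: eq_bigr => k kj;
  rewrite /splice (negbTE kj)//.
have kj' : (k == j :> nat) = false by apply/negbTE.
by rewrite [(k < j.+1)%N]ltnS [(k <= j)%N]leq_eqVlt kj'.
Qed.

(** The j-th factor is a primitive of the difference of the bumps at scales r
    and r / 2. It has compact support because both bumps have integral 1. *)
Definition flux_factor (a : 'rV[R]_m) r (j k : 'I_m) : R -> R :=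
  splice (bump_at (a 0 k) (r / 2)) (bump_at (a 0 k) r)
      (step_at (a 0 k) r \- step_at (a 0 k) (r / 2)) j k.

Definition flux a r j y := \prod_k flux_factor a r j k (y 0 k).

Definition dflux_factor (a : 'rV[R]_m) r (j k : 'I_m) : R -> R :=
  splice (bump_at (a 0 k) (r / 2)) (bump_at (a 0 k) r)
      (bump_at (a 0 k) r \- bump_at (a 0 k) (r / 2)) j k.

Lemma partial_fluxE a r j y :
  partial j (flux a r j) y = \prod_k dflux_factor a r j k (y 0 k).
Proof.
have dj : is_derive (y 0 j) 1 (flux_factor a r j j) (dflux_factor a r j j (y 0 j)).
  rewrite /flux_factor /dflux_factor /splice ltnn eqxx.
  exact: is_deriveB (is_derive_step_at _ _ _) (is_derive_step_at _ _ _).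
rewrite (@partial_prod (flux_factor a r j) j y _ dj) [RHS](bigD1 j)//=; congr (_ * _).
by apply: eq_bigr => k kj; rewrite /flux_factor /dflux_factor /splice (negbTE kj);
  case: ifP.
Qed.

(** The difference of two mollifiers at scales r and r / 2 is the divergence of
    a compactly supported field, one component for each term of
    [telescope_prod]; it can therefore be tested against a weak gradient. *)
Lemma partial_flux a r y :
  \sum_j partial j (flux a r j) y = mollifier a r y - mollifier a (r / 2) y.
Proof.
rewrite /mollifier -telescope_prod; apply: eq_bigr => j _.
rewrite partial_fluxE (bigD1 j)//= {1}/dflux_factor {1}/splice ltnn eqxx; congr (_ * _).
by apply: eq_bigr => k kj; rewrite /dflux_factor /splice (negbTE kj); case: ifP.
Qed.

(** The product of these functions over the coordinates dominates both
    mollifiers and every partial derivative of the flux, with a mass that does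
    not depend on r. *)
Definition two_bumps (a : 'rV[R]_m) r (k : 'I_m) (s : R) : R :=
  bump_at (a 0 k) r s + bump_at (a 0 k) (r / 2) s.

Lemma two_bumps_ge0 a r k s : 0 < r -> 0 <= two_bumps a r k s.
Proof. by move=> r0; rewrite addr_ge0 ?bump_at_ge0// divr_gt0. Qed.

Lemma measurable_two_bumps a r k : measurable_fun setT (two_bumps a r k).
Proof. by apply: measurable_funD; exact: measurable_bump_at. Qed.

Lemma measurable_dflux_factor a r j k : measurable_fun setT (dflux_factor a r j k).
Proof.
rewrite /dflux_factor /splice; case: ifP => _; first exact: measurable_bump_at.
by case: ifP => _; [apply: measurable_funB|]; exact: measurable_bump_at.
Qed.

Lemma partial_flux_dom a r j y : 0 < r ->
  `|partial j (flux a r j) y| <= \prod_k two_bumps a r k (y 0 k).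
Proof.
move=> r0; rewrite partial_fluxE normr_prod; apply: ler_prod => k _.
have r2 : 0 < r / 2 by rewrite divr_gt0.
have k1 := bump_at_ge0 (a 0 k) (y 0 k) r0; have k2 := bump_at_ge0 (a 0 k) (y 0 k) r2.
rewrite normr_ge0 /= /dflux_factor /splice /two_bumps.
case: ifP => _; first by rewrite (ger0_norm k2) lerDr; exact: k1.
case: ifP => _; last by rewrite (ger0_norm k1) lerDl; exact: k2.
by apply: le_trans (ler_normB _ _) _; rewrite (ger0_norm k1) (ger0_norm k2).
Qed.

Lemma mollifier_dom2 a r y : 0 < r ->
  `|mollifier a r y| <= \prod_k two_bumps a r k (y 0 k) /\
  `|mollifier a (r / 2) y| <= \prod_k two_bumps a r k (y 0 k).
Proof.
move=> r0; have r2 : 0 < r / 2 by rewrite divr_gt0.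
rewrite (ger0_norm (mollifier_ge0 a y r0)) (ger0_norm (mollifier_ge0 a y r2)).
split; apply: ler_prod => k _;
  have k1 := bump_at_ge0 (a 0 k) (y 0 k) r0; have k2 := bump_at_ge0 (a 0 k) (y 0 k) r2.
  by apply/andP; split; [exact: k1|rewrite lerDl; exact: k2].
by apply/andP; split; [exact: k2|rewrite lerDr; exact: k1].
Qed.

Lemma integral_two_bumps a r : 0 < r ->
  (\int[lebesgueRn R m]_z (\prod_k two_bumps a r k (rowRn z 0 k))%:E = (2 ^+ m)%:E)%E.
Proof.
move=> r0; have r2 : 0 < r / 2 by rewrite divr_gt0.
rewrite (@integral_prodRn R m (two_bumps a r) (fun _ => 2)).
- by rewrite prodr_const card_ord.
- by move=> k; exact: measurable_two_bumps.
- by move=> k s; exact: two_bumps_ge0.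
move=> k; rewrite /two_bumps; under eq_integral do rewrite EFinD.
rewrite ge0_integralD//.
- by rewrite !integral_bump_at// -EFinD.
- by move=> x _; rewrite lee_fin bump_at_ge0.
- by apply/measurable_EFinP; exact: measurable_bump_at.
- by move=> x _; rewrite lee_fin bump_at_ge0.
- by apply/measurable_EFinP; exact: measurable_bump_at.
Qed.

Lemma two_bumps_le a r y (M : R) : 0 < r -> (forall s, bump s <= M) ->
  \prod_k two_bumps a r k (y 0 k) <= (3 * M / r) ^+ m.
Proof.
move=> r0 rM; have r2 : 0 < r / 2 by rewrite divr_gt0.
rewrite -[m in _ ^+ m]card_ord -prodr_const; apply: ler_prod => k _.
rewrite two_bumps_ge0//= /two_bumps /bump_at invf_div.
have ri : 0 <= r^-1 by rewrite invr_ge0 ltW.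
have r2i : 0 <= 2 / r by rewrite mulr_ge0.
have -> : 3 * M / r = r^-1 * M + 2 / r * M by ring.
exact: lerD (ler_wpM2l ri (rM _)) (ler_wpM2l r2i (rM _)).
Qed.

Lemma flux_factor_out a r j k s : 0 < r ->
  ~ `[a 0 k, a 0 k + r]%classic s -> flux_factor a r j k s = 0.
Proof.
move=> r0 sa; have sa' : s < a 0 k \/ a 0 k + r < s.
  have [ya|ya] := ltP s (a 0 k); [by left|right].
  by rewrite ltNge; apply/negP => ya2; apply: sa; rewrite /= in_itv /= ya ya2.
have r2 : 0 < r / 2 by rewrite divr_gt0.
have sa2 : s < a 0 k \/ a 0 k + r / 2 < s.
  by case: sa' => h; [left|right]; lra.
rewrite /flux_factor /splice; case: ifP => _; first exact: bump_at_out.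
case: ifP => _; last exact: bump_at_out.
have [p0 p1] := step_at_out (a 0 k) s r0; have [q0 q1] := step_at_out (a 0 k) s r2.
case: sa' => h /=; first by rewrite p0// q0// subrr.
by rewrite p1// q1 ?subrr//; lra.
Qed.

Lemma flux_test a r j : 0 < r -> test_function setT (flux a r j).
Proof.
move=> r0; split.
  move=> k; apply: Ck_prod => [|i]; first exact: openT.
  apply: Ck_comp_real; [exact: openT| |exact: Ck_coord openT].
  rewrite /flux_factor /splice; case: ifP => _; first exact: smooth_bump_at.
  case: ifP => _; last exact: smooth_bump_at.
  by apply: CkB; [exact: openT|exact: smooth_step_at|exact: smooth_step_at].
exists (cube a r); split=> //; first exact: cube_compact.
move=> y /existsNP[k yk]; rewrite /flux (bigD1 k)//= flux_factor_out ?mul0r//.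
Qed.

(** The j-th factor of the flux has values in [-1, 1] and lives on an interval
    of length r: compared with the mollifiers, the flux has a mass smaller by a
    factor r. *)
Definition flux_bound a r j (k : 'I_m) : R -> R :=
  splice (bump_at (a 0 k) (r / 2)) (bump_at (a 0 k) r) \1_`[a 0 k, a 0 k + r] j k.

Lemma flux_bound_ge0 a r j k s : 0 < r -> 0 <= flux_bound a r j k s.
Proof.
move=> r0; rewrite /flux_bound /splice; case: ifP => _;
  first by rewrite bump_at_ge0// divr_gt0.
by case: ifP => _; rewrite ?bump_at_ge0// indicE.
Qed.

Lemma flux_dom a r j y : 0 < r ->
  `|flux a r j y| <= \prod_k flux_bound a r j k (y 0 k).
Proof.
move=> r0; rewrite normr_prod; apply: ler_prod => k _; rewrite normr_ge0 /=.
have r2 : 0 < r / 2 by rewrite divr_gt0.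
have [yk|yk] := pselect (`[a 0 k, a 0 k + r]%classic (y 0 k)); last first.
  by rewrite flux_factor_out// normr0 flux_bound_ge0.
rewrite /flux_factor /flux_bound /splice; case: ifP => _;
  first by rewrite ger0_norm// bump_at_ge0.
case: ifP => _; last by rewrite ger0_norm// bump_at_ge0.
rewrite indicE mem_set//= /step_at.
have := unit_step_ge0 ((y 0 k - a 0 k) / r); have := unit_step_le1 ((y 0 k - a 0 k) / r).
have := unit_step_ge0 ((y 0 k - a 0 k) / (r / 2));
  have := unit_step_le1 ((y 0 k - a 0 k) / (r / 2)).
by rewrite ler_norml => *; apply/andP; split; lra.
Qed.

Lemma measurable_flux_bound a r j k : measurable_fun setT (flux_bound a r j k).
Proof.
rewrite /flux_bound /splice; case: ifP => _; first exact: measurable_bump_at.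
by case: ifP => _; [exact: measurable_indic|exact: measurable_bump_at].
Qed.

Lemma integral_flux_bound a r j : 0 < r ->
  (\int[lebesgueRn R m]_z (\prod_k flux_bound a r j k (rowRn z 0 k))%:E = r%:E)%E.
Proof.
move=> r0; have r2 : 0 < r / 2 by rewrite divr_gt0.
rewrite (@integral_prodRn R m (flux_bound a r j) (fun k => if k == j then r else 1));
  last 3 first.
- by move=> k; exact: measurable_flux_bound.
- by move=> k s; exact: flux_bound_ge0.
- move=> k; rewrite /flux_bound /splice; have [->|kj] := eqVneq k j.
    by rewrite ltnn; exact: integral_indic_itv.
  by case: ifP => _; exact: integral_bump_at.
by rewrite (bigD1 j)//= eqxx big1 ?mulr1// => k /negbTE ->.
Qed.

Lemma flux_bound_le a r j y (M : R) : 0 < r -> (forall s, bump s <= M) ->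
  \prod_k flux_bound a r j k (y 0 k) <= (2 * M / r) ^+ m.-1.
Proof.
move=> r0 rM; have r2 : 0 < r / 2 by rewrite divr_gt0.
have M0 : 0 <= M by exact: le_trans (bump_ge0 0) (rM 0).
rewrite (bigD1 j)//= -[leRHS]mul1r; apply: ler_pM.
- exact: flux_bound_ge0.
- by apply: prodr_ge0 => k _; exact: flux_bound_ge0.
- by rewrite /flux_bound /splice ltnn eqxx indicE; case: (_ \in _).
have -> : (2 * M / r) ^+ m.-1 = \prod_(k < m | k != j) (2 * M / r).
  by rewrite prodr_const cardC1 card_ord.
apply: ler_prod => k kj; rewrite flux_bound_ge0//= /flux_bound /splice (negbTE kj).
case: ifP => _; rewrite /bump_at.
  by rewrite invf_div mulrAC; apply: ler_wpM2r; [rewrite invr_ge0 ltW|exact: ler_wpM2l].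
rewrite mulrC; apply: ler_wpM2r; first by rewrite invr_ge0 ltW.
apply: le_trans (rM _) _.
by rewrite mulrC ler_peMr// ler1n.
Qed.

End Products.
End Kernels.

(** * Consecutive averages and weak derivatives *)

Section Averages.
Context {R : realType} {m : nat}.
Variables (p M : R).
Hypotheses (p1 : 1 <= p) (M0 : 0 < M) (rM : forall s : R, bump s <= M).
Implicit Types (a : 'rV[R]_m) (w : 'rV[R]_m -> R) (r : R).

Let mu := lebesgueRn R m.

Definition avg a r w : R := \int[mu]_z (w (rowRn z) * mollifier a r (rowRn z)).

(** Here q bounds the p-th power of the norm, the quantity that enters
    [young_integral]. *)
Definition Lp_le (q : R) w : Prop :=
  measurable_Rn w /\ (\int[mu]_z (`|w (rowRn z)| `^ p)%:E <= q%:E)%E.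

Let Phi a r (z : Rn R m) := \prod_k two_bumps a r k (rowRn z 0 k).

Let mPhi a r : measurable_fun setT (Phi a r).
Proof. exact: (@measurable_prodRn R m (two_bumps a r)
  (fun k => measurable_two_bumps _ _ _)). Qed.

Let Phi0 a r z : 0 < r -> 0 <= Phi a r z.
Proof. by move=> r0; apply: prodr_ge0 => k _; exact: two_bumps_ge0. Qed.

Let PhiB a r z : 0 < r -> Phi a r z <= (3 * M / r) ^+ m.
Proof. by move=> r0; exact: two_bumps_le. Qed.

Let B0 r : 0 < r -> 0 <= (3 * M / r) ^+ m.
Proof. by move=> r0; rewrite exprn_ge0// divr_ge0 ?ltW// mulr_gt0. Qed.

Let PhiV a r : 0 < r -> (\int[mu]_z (Phi a r z)%:E <= (2 ^+ m)%:E)%E.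
Proof. by move=> r0; rewrite integral_two_bumps. Qed.

Lemma integrable_dom a r w q (psi : Rn R m -> R) : 0 < r -> Lp_le q w ->
  measurable_fun setT psi -> (forall z, `|psi z| <= Phi a r z) ->
  mu.-integrable setT (fun z => (w (rowRn z) * psi z)%:E).
Proof.
move=> r0 [mw wq] mpsi psile.
exact: (young_integrable mw (mPhi a r) (fun z => Phi0 a z r0) (fun z => PhiB a z r0)
  (PhiV a r0) wq p1 ltr01 (B0 r0) mpsi psile).
Qed.

Lemma integral_dom_le a r w q (psi : Rn R m -> R) l : 0 < r -> 0 < l -> Lp_le q w ->
  measurable_fun setT psi -> (forall z, `|psi z| <= Phi a r z) ->
  `|\int[mu]_z (w (rowRn z) * psi z)| <= l * 2 ^+ m + l `^ (1 - p) * (3 * M / r) ^+ m * q.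
Proof.
move=> r0 l0 [mw wq] mpsi psile.
exact: (young_abs_Rintegral mw (mPhi a r) (fun z => Phi0 a z r0) (fun z => PhiB a z r0)
  (PhiV a r0) wq p1 l0 (B0 r0) mpsi psile).
Qed.

Let mollifier_dom a r : 0 < r ->
  forall z, `|(mollifier a r \o @rowRn R m) z| <= Phi a r z.
Proof. by move=> r0 z; have [h _] := mollifier_dom2 a (rowRn z) r0; exact: h. Qed.

Lemma avg_le a r w q l : 0 < r -> 0 < l -> Lp_le q w ->
  `|avg a r w| <= l * 2 ^+ m + l `^ (1 - p) * (3 * M / r) ^+ m * q.
Proof.
move=> r0 l0 wq.
exact: (integral_dom_le r0 l0 wq (measurable_mollifier a r) (mollifier_dom a r0)).
Qed.

Lemma integrable_mollifier a r w q : 0 < r -> Lp_le q w ->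
  mu.-integrable setT (fun z => (w (rowRn z) * mollifier a r (rowRn z))%:E).
Proof.
move=> r0 wq.
exact: (integrable_dom r0 wq (measurable_mollifier a r) (mollifier_dom a r0)).
Qed.

Lemma avg_sub_half a r w q : 0 < r -> Lp_le q w ->
  avg a r w - avg a (r / 2) w =
  \int[mu]_z (w (rowRn z) * (mollifier a r (rowRn z) - mollifier a (r / 2) (rowRn z))).
Proof.
move=> r0 wq; rewrite /avg -RintegralB//.
- by apply: eq_Rintegral => z _; rewrite mulrBr.
- exact: integrable_mollifier wq.
- by apply: integrable_mollifier wq; rewrite divr_gt0.
Qed.

(** By [partial_flux], the difference of the averages is minus the sum of the
    integrals of the weak derivatives against the components of the flux, whose
    mass is at most r. *)
Lemma avg_step_weak a r w q0 (Dw : 'I_m -> 'rV[R]_m -> R) q l :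
  0 < r -> 0 < l -> Lp_le q0 w ->
  (forall j, weak_partial j w (Dw j)) -> (forall j, Lp_le q (Dw j)) ->
  `|avg a r w - avg a (r / 2) w| <=
    m%:R * (l * r + l `^ (1 - p) * (2 * M / r) ^+ m.-1 * q).
Proof.
move=> r0 l0 wq wD Dq.
have mpart j : measurable_fun setT (fun z : Rn R m => partial j (flux a r j) (rowRn z)).
  under eq_fun do rewrite partial_fluxE.
  exact: (@measurable_prodRn R m (dflux_factor a r j)
    (fun k => measurable_dflux_factor _ _ _ _)).
have ipart j : mu.-integrable setT
    (fun z => (w (rowRn z) * partial j (flux a r j) (rowRn z))%:E).
  exact: (integrable_dom r0 wq (mpart j) (fun z => partial_flux_dom a j (rowRn z) r0)).
have E n (F : 'I_n -> Rn R m -> R) : (forall j, mu.-integrable setT (EFin \o F j)) ->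
    \int[mu]_z (\sum_j F j z) = \sum_j \int[mu]_z (F j z).
  elim: n F => [|n IH] F iF.
    rewrite big_ord0; under eq_Rintegral do rewrite big_ord0.
    by rewrite Rintegral_cst// mul0r.
  under eq_Rintegral do rewrite big_ord_recl.
  rewrite RintegralD//; last first.
    have -> : (EFin \o (fun x => \sum_(i < n) F (lift ord0 i) x)) =
        (fun x => \sum_(i < n) (F (lift ord0 i) x)%:E)%E.
      by apply/funext => x; rewrite /= sumEFin.
    by apply: integrable_sum => // j _; exact: iF.
  by rewrite big_ord_recl IH.
rewrite (avg_sub_half _ r0 wq).
under eq_Rintegral do rewrite -partial_flux mulr_sumr.
rewrite E//; apply: le_trans (ler_norm_sum _ _ _) _.
rewrite mulr_natl -[X in _ *+ X]card_ord -sumr_const; apply: ler_sum => j _.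
have [mD wDj] := wD j.
have [_ Dj] := Dq j.
have := wDj _ (flux_test a j r0) => /(congr1 fine).
rewrite fineN -!/(Rintegral _ _ _) => ->; rewrite normrN.
apply: (@young_abs_Rintegral _ _ _ mu (Dw j \o @rowRn R m)
  (fun z => \prod_k flux_bound a r j k (rowRn z 0 k)) p l _ _ q) => //.
- exact: (@measurable_prodRn R m (flux_bound a r j)
  (fun k => measurable_flux_bound _ _ _ _)).
- by move=> z; apply: prodr_ge0 => k _; exact: flux_bound_ge0.
- by move=> z; exact: flux_bound_le.
- by rewrite integral_flux_bound.
- by rewrite exprn_ge0// divr_ge0 ?ltW// mulr_gt0.
- apply: (@measurable_prodRn R m (flux_factor a r j)) => k.
  apply: continuous_measurable_fun => s.
  rewrite /flux_factor /splice; case: ifP => _; first exact: continuous_bump_at.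
  case: ifP => _; last exact: continuous_bump_at.
  by apply: continuousB; exact: (Ck_continuous (smooth_step_at _ _ 0) I).
- by move=> z; exact: flux_dom.
Qed.

End Averages.

(** * Consecutive averages and the Gagliardo seminorm *)

Section GagliardoStep.
Context {R : realType} {m : nat}.
Variables (p M : R).
Hypotheses (p1 : 1 <= p) (M0 : 0 < M) (rM : forall s : R, bump s <= M).
Implicit Types (a : 'rV[R]_m) (w : 'rV[R]_m -> R) (r : R).

Let mu := lebesgueRn R m.

Lemma euclid_norm_eq0 (x : 'rV[R]_m) : euclid_norm x = 0 -> x = 0.
Proof.
move/eqP; rewrite sqrtr_eq0 => h; apply/rowP => k; rewrite mxE; apply/eqP.
rewrite -sqrf_eq0 eq_le sqr_ge0 andbT; apply: le_trans h.
by rewrite (bigD1 k)//= lerDl sumr_ge0// => j _; exact: sqr_ge0.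
Qed.

Lemma euclid_norm_cube a r (x y : 'rV[R]_m) : 0 < r ->
  cube a r x -> cube a r y -> euclid_norm (x - y) <= Num.sqrt m%:R * r.
Proof.
move=> r0 ax ay; rewrite -[X in _ * X](gtr0_norm r0) -sqrtr_sqr -sqrtrM//.
apply: ler_wsqrtr; rewrite mulr_natl -[X in _ *+ X]card_ord -sumr_const.
apply: ler_sum => k _; rewrite !mxE -[leLHS]real_normK ?num_real//.
rewrite ler_sqr ?nnegrE ?(ltW r0)// ler_norml.
move: (ax k) (ay k); rewrite /= !in_itv /= => /andP[? ?] /andP[? ?].
by apply/andP; split; lra.
Qed.

Definition gagliardo_kernel (e : R) w (x : Rn R m * Rn R m) : R :=
  `|w (rowRn x.1) - w (rowRn x.2)| `^ p / euclid_norm (rowRn x.1 - rowRn x.2) `^ e.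

Lemma gagliardo_kernel_ge0 e w x : 0 <= gagliardo_kernel e w x.
Proof. by rewrite mulr_ge0 ?invr_ge0 ?powR_ge0. Qed.

Lemma measurable_gagliardo_kernel e w :
  measurable_Rn w -> measurable_fun setT (gagliardo_kernel e w).
Proof.
move=> mw.
have m1 k : measurable_fun setT (fun x : Rn R m * Rn R m => rowRn x.1 0 k).
  exact: measurableT_comp (measurable_coordRn k) (@measurable_fst _ _ _ _).
have m2 k : measurable_fun setT (fun x : Rn R m * Rn R m => rowRn x.2 0 k).
  exact: measurableT_comp (measurable_coordRn k) (@measurable_snd _ _ _ _).
apply: measurable_funM.
  apply: (measurableT_comp (measurable_powR p)).
  apply: (measurableT_comp (@normr_measurable R setT)).
  apply: measurable_funB.
    exact: measurableT_comp mw (@measurable_fst _ _ _ _).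
  exact: measurableT_comp mw (@measurable_snd _ _ _ _).
under eq_fun do rewrite -powRN.
apply: (measurableT_comp (measurable_powR (- e))).
apply: (measurableT_comp (f := @Num.sqrt R)).
  apply: continuous_measurable_fun; exact: sqrt_continuous.
apply: measurable_sum => k; apply: measurable_funX.
under eq_fun do rewrite !mxE.
by apply: measurable_funB.
Qed.

(** On the support of the mollifiers the distance between the two points is at
    most sqrt m * r, which bounds the weight of the Gagliardo integral from
    below. *)
Lemma gagliardo_kernel_pointwise a r e w l z y : 0 < r -> 0 < l -> 0 <= e ->
  `|w (rowRn z) - w (rowRn y)| *
    (mollifier a r (rowRn z) * mollifier a (r / 2) (rowRn y)) <=
  l * (mollifier a r (rowRn z) * mollifier a (r / 2) (rowRn y)) +
  l `^ (1 - p) * ((M / r) ^+ m * (M / (r / 2)) ^+ m * (Num.sqrt m%:R * r) `^ e) *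
    gagliardo_kernel e w (z, y).
Proof.
move=> r0 l0 e0; have r2 : 0 < r / 2 by rewrite divr_gt0.
set f := mollifier a r _; set h := mollifier a _ _; set dw := `|_ - _|.
have f0 : 0 <= f by exact: mollifier_ge0.
have h0 : 0 <= h by exact: mollifier_ge0.
have fh0 : 0 <= f * h := mulr_ge0 f0 h0.
apply: le_trans (ler_wpM2r fh0 (young_pointwise p1 l0 (normr_ge0 _))) _.
rewrite mulrDl lerD2l -!(mulrA (l `^ _)); apply: ler_wpM2l; first exact: powR_ge0.
have B1 : 0 <= (M / r) ^+ m by rewrite exprn_ge0// divr_ge0// ltW.
have B2 : 0 <= (M / (r / 2)) ^+ m by rewrite exprn_ge0// divr_ge0// ltW.
have rhs0 : 0 <= (M / r) ^+ m * (M / (r / 2)) ^+ m * (Num.sqrt m%:R * r)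
  `^ e * gagliardo_kernel e w (z, y).
  rewrite mulr_ge0 ?gagliardo_kernel_ge0// mulr_ge0 ?powR_ge0// mulr_ge0//.
have [zc|zc] := pselect (cube a r (rowRn z)); last first.
  by rewrite /f (mollifier_out r0 zc) mul0r mulr0.
have [yc|yc] := pselect (cube a (r / 2) (rowRn y)); last first.
  by rewrite /h (mollifier_out r2 yc) !mulr0.
have yc' : cube a r (rowRn y).
  by move=> k; move: (yc k); rewrite /= !in_itv /= => /andP[-> ?] /=; lra.
have dist := euclid_norm_cube r0 zc yc'.
have [d0|d0] := eqVneq (euclid_norm (rowRn z - rowRn y)) 0.
  have /subr0_eq zy := euclid_norm_eq0 d0.
  by rewrite /dw zy subrr normr0 powR0 ?mul0r// gt_eqF// (lt_le_trans ltr01).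
rewrite mulrC -(mulrA _ (_ `^ e)); apply: ler_pM => //.
- exact: (ler_pM f0 h0 (mollifier_le a (rowRn z) r0 rM) (mollifier_le a (rowRn y) r2 rM)).
rewrite /gagliardo_kernel /= -/dw mulrCA -[leLHS]mulr1 ler_wpM2l ?powR_ge0//.
have dpos : 0 < euclid_norm (rowRn z - rowRn y) by rewrite lt_neqAle eq_sym d0 sqrtr_ge0.
rewrite ler_pdivlMr ?powR_gt0// mul1r.
by apply: ge0_ler_powR => //; rewrite nnegrE ?mulr_ge0 ?sqrtr_ge0// ltW.
Qed.

(** Both mollifiers have mass 1, so the difference of the averages is the
    integral of w z - w y against their product; the Gagliardo integral then
    enters through [gagliardo_kernel_pointwise]. *)
Lemma avg_step_gagliardo a r e w q g l :
  0 < r -> 0 < l -> 0 <= e -> Lp_le p q w ->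
  (\int[mu]_z \int[mu]_y (gagliardo_kernel e w (z, y))%:E <= g%:E)%E ->
  `|avg a r w - avg a (r / 2) w| <=
    l + l `^ (1 - p) * ((M / r) ^+ m * (M / (r / 2)) ^+ m * (Num.sqrt m%:R * r) `^ e) * g.
Proof.
move=> r0 l0 e0 wq wg; have r2 : 0 < r / 2 by rewrite divr_gt0.
have [mw _] := wq.
set c := l `^ (1 - p) * _.
have c0 : 0 <= c.
  rewrite mulr_ge0 ?powR_ge0// mulr_ge0 ?powR_ge0// mulr_ge0// exprn_ge0// divr_ge0//
    ltW//.
pose f (z : Rn R m) := mollifier a r (rowRn z).
pose h (z : Rn R m) := mollifier a (r / 2) (rowRn z).
have mf : measurable_fun setT f := measurable_mollifier a r.
have mh : measurable_fun setT h := measurable_mollifier a (r / 2).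
have f0 z : 0 <= f z by exact: mollifier_ge0.
have h0 z : 0 <= h z by exact: mollifier_ge0.
have If : (\int[mu]_z (f z)%:E = 1%:E)%E by exact: integral_mollifier.
have Ih : (\int[mu]_z (h z)%:E = 1%:E)%E by exact: integral_mollifier.
have inorm (F : Rn R m -> R) : measurable_fun setT F -> (forall z, 0 <= F z) ->
    (\int[mu]_z (F z)%:E = 1%:E)%E -> mu.-integrable setT (EFin \o F).
  move=> mF F0 IF; apply/integrableP; split; first exact/measurable_EFinP.
  by under eq_integral do rewrite /= ger0_norm//; rewrite IF ltry.
have iff := inorm f mf f0 If.
have ih := inorm h mh h0 Ih.
have iwf : mu.-integrable setT (EFin \o (fun z => w (rowRn z) * f z)) :=
  integrable_mollifier p1 M0 rM a r0 wq.
have iwh : mu.-integrable setT (EFin \o (fun z => w (rowRn z) * h z)) :=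
  integrable_mollifier p1 M0 rM a r2 wq.
(* subtracting a constant from w shifts an average of mass 1 by that constant *)
have sub (F : Rn R m -> R) (t : R) : mu.-integrable setT (EFin \o F) ->
    mu.-integrable setT (EFin \o (fun z => w (rowRn z) * F z)) ->
    (\int[mu]_z (F z)%:E = 1%:E)%E ->
    mu.-integrable setT (EFin \o (fun z => (w (rowRn z) - t) * F z)) /\
    \int[mu]_z ((w (rowRn z) - t) * F z) = \int[mu]_z (w (rowRn z) * F z) - t.
  move=> iF iwF IF.
  have itF : mu.-integrable setT (EFin \o (fun z => t * F z)).
    by apply: (integrableZl measurableT t iF).
  have -> : (fun z => (w (rowRn z) - t) * F z) = (fun z => w (rowRn z) * F z)
    \- (fun z => t * F z).
    by apply/funext => z /=; rewrite mulrBl.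
  split; first by have := integrableB measurableT iwF itF; apply: eq_integrable.
  have IFR : \int[mu]_z (F z) = 1 by rewrite /Rintegral IF.
  by rewrite RintegralB// RintegralZl// IFR mulr1.
set A := avg a (r / 2) w.
have [iA EA] := sub f A iff iwf If.
rewrite -[avg a r w - A]EA -lee_fin.
pose G z := (\int[mu]_y (gagliardo_kernel e w (z, y))%:E)%E.
have mgE : measurable_fun setT (fun x : Rn R m * Rn R m => (gagliardo_kernel e w x)%:E).
  by apply/measurable_EFinP; exact: measurable_gagliardo_kernel.
have mG : measurable_fun setT G.
  by apply: (measurable_fun_fubini_tonelli_F (m2 := mu)
    (fun x => (gagliardo_kernel e w x)%:E)) => // x;
    rewrite lee_fin gagliardo_kernel_ge0.
have G0 z : (0 <= G z)%E by apply: integral_ge0 => y _;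
  rewrite lee_fin gagliardo_kernel_ge0.
have mgz z : measurable_fun setT (fun y => (gagliardo_kernel e w (z, y))%:E).
  exact: measurableT_comp mgE (measurable_pair1 z).
have key z : ((`|(w (rowRn z) - A) * f z|)%:E <= (l * f z)%:E + c%:E * G z)%E.
  have [iz Ez] := sub h (w (rowRn z)) ih iwh Ih.
  have -> : `|(w (rowRn z) - A) * f z| = `|\int[mu]_y ((w (rowRn y) - w (rowRn z))
    * h y)| * f z.
    by rewrite Ez -/(avg a (r / 2) w) -/A distrC normrM (ger0_norm (f0 z)).
  apply: (@le_trans _ _ (\int[mu]_y (`|w (rowRn y) - w (rowRn z)| * (f z * h y))%:E)%E).
    have -> : (\int[mu]_y (`|w (rowRn y) - w (rowRn z)| * (f z * h y))%:E =
        (f z)%:E * \int[mu]_y (`|(w (rowRn y) - w (rowRn z)) * h y|)%:E)%E.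
      rewrite -ge0_integralZl_EFin//.
      - by apply: eq_integral => y _; rewrite -EFinM normrM (ger0_norm (h0 y)) mulrCA.
      - have /integrableP[+ _] := iz; move=> /measurable_EFinP miz.
        by apply/measurable_EFinP; exact: measurableT_comp.
    rewrite mulrC EFinM; apply: lee_wpmul2l; first by rewrite lee_fin.
    rewrite EFin_normr_Rintegral//; apply: le_abse_integral => //.
    by have /integrableP[] := iz.
  have -> : ((l * f z)%:E + c%:E * G z = \int[mu]_y ((l * f z)%:E * (h y)%:E +
      c%:E * (gagliardo_kernel e w (z, y))%:E))%E.
    rewrite ge0_integralD//.
    - rewrite ge0_integralZl_EFin// ?Ih ?mule1//.
      + by rewrite ge0_integralZl_EFin// => y _; rewrite lee_fin gagliardo_kernel_ge0.
      + by move=> y _; rewrite lee_fin.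
      + exact/measurable_EFinP.
      + by rewrite mulr_ge0// ltW.
    - by move=> y _; rewrite -EFinM lee_fin !mulr_ge0// ltW.
    - by apply: measurable_funeM; apply/measurable_EFinP.
    - by move=> y _; rewrite -EFinM lee_fin mulr_ge0// gagliardo_kernel_ge0.
    - by apply: measurable_funeM.
  apply: ge0_le_integral => //.
  - by move=> y _; rewrite lee_fin !mulr_ge0.
  - apply/measurable_EFinP; apply: measurable_funM.
      by apply: measurableT_comp => //; apply: measurable_funB.
    exact: measurable_funM (@measurable_cst _ _ _ _ setT (f z)) mh.
  - by apply: emeasurable_funD; apply: measurable_funeM => //; apply/measurable_EFinP.
  move=> y _; rewrite -!EFinM -EFinD lee_fin distrC -(mulrA l).
  exact: gagliardo_kernel_pointwise.
apply: (@le_trans _ _ (\int[mu]_z (`|(w (rowRn z) - A) * f z|)%:E)%E).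
  rewrite EFin_normr_Rintegral//; apply: le_abse_integral => //.
  by have /integrableP[] := iA.
have P2 : measurable_fun setT (fun z => (l * f z)%:E).
  by apply/measurable_EFinP; exact: measurable_funM (@measurable_cst _ _ _ _ setT l) mf.
have P4 : measurable_fun setT (fun z => (c%:E * G z)%E) := measurable_funeM c%:E mG.
apply: (@le_trans _ _ (\int[mu]_z ((l * f z)%:E + c%:E * G z))%E).
  apply: ge0_le_integral => //.
  - have /integrableP[+ _] := iA; move=> /measurable_EFinP miA.
    by apply/measurable_EFinP; exact: measurableT_comp.
  - exact: emeasurable_funD.
have P1 z : [set: Rn R m] z -> (0 <= (l * f z)%:E)%E by rewrite lee_fin mulr_ge0// ltW.
have P3 z : [set: Rn R m] z -> (0 <= c%:E * G z)%E.
  by move=> _; apply: mule_ge0; rewrite ?lee_fin.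
rewrite (ge0_integralD mu measurableT P1 P2 P3 P4).
have Q1 z : [set: Rn R m] z -> (0 <= (f z)%:E)%E by rewrite lee_fin.
have Q2 : measurable_fun setT (fun z => (f z)%:E) by exact/measurable_EFinP.
have Q3 z : [set: Rn R m] z -> (0 <= G z)%E by [].
have -> : (\int[mu]_z (l * f z)%:E = l%:E)%E.
  under eq_integral do rewrite EFinM.
  by rewrite (ge0_integralZl_EFin mu measurableT Q1 Q2 (ltW l0)) If mule1.
rewrite (ge0_integralZl_EFin mu measurableT Q3 mG c0) EFinD (EFinM c).
by apply: leeD2l; apply: lee_wpmul2l; [rewrite lee_fin|exact: wg].
Qed.

End GagliardoStep.

(** * Averages at all scales *)

Section SupBound.
Context {R : realType}.

Lemma geometric_steps (u : nat -> R) (e0 eta rho : R) : 0 <= rho < 1 -> 0 <= eta ->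
  `|u 0%N| <= e0 -> (forall i, `|u i - u i.+1| <= eta * rho ^+ i) ->
  forall i, `|u i| <= e0 + eta / (1 - rho).
Proof.
move=> /andP[rho0 rho1] eta0 u0 du i.
have rho1' : 0 < 1 - rho by rewrite subr_gt0.
have H : `|u i| <= e0 + eta * (1 - rho ^+ i) / (1 - rho).
  elim: i => [|i IH]; first by rewrite expr0 subrr mulr0 mul0r addr0.
  have -> : u i.+1 = u i - (u i - u i.+1) by rewrite opprB addrC subrK.
  apply: le_trans (ler_normB _ _) _; apply: le_trans (lerD IH (du i)) _.
  rewrite le_eqVlt; apply/orP; left; apply/eqP.
  by rewrite exprS; field; rewrite gt_eqF.
apply: le_trans H _; rewrite lerD2l ler_wpM2r ?invr_ge0 ?(ltW rho1')//.
by rewrite ler_piMr// gerBl exprn_ge0.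
Qed.

Lemma small_power (p K e : R) : 1 <= p -> 0 <= K -> 0 < e ->
  exists2 dt : R, 0 < dt & forall q : R, 0 <= q <= dt `^ p -> K * q <= e.
Proof.
move=> p1 K0 e0; have K1 : 0 < K + 1 by rewrite ltr_wpDl.
exists (Num.min 1 (e / (K + 1))); first by rewrite lt_min ltr01 divr_gt0.
move=> q /andP[q0 qd]; set dt := Num.min _ _ in qd.
have d0 : 0 < dt by rewrite lt_min ltr01 divr_gt0.
have d1 : dt <= 1 by rewrite ge_min lexx.
have d2 : dt <= e / (K + 1) by rewrite ge_min lexx orbT.
have qdt : q <= dt by apply: le_trans qd _; apply: ge1r_powR; rewrite ?d0.
apply: (@le_trans _ _ ((K + 1) * q)); first by rewrite ler_wpM2r// lerDl.
by rewrite mulrC -ler_pdivlMr// (le_trans qdt).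
Qed.

Context {m : nat}.
Variables (p M : R).
Hypotheses (p1 : 1 <= p) (M0 : 0 < M) (rM : forall s : R, bump s <= M).

(** The average at scale r0 is small by [avg_le], and as al > 0 the differences
    between consecutive scales form a geometric series. The weight ep of the
    part that does not involve w is chosen first, then dt controls the part
    proportional to q. The predicate P stands for a bound on the seminorm that
    controls the steps. *)
Lemma avg_small_of_steps (P : R -> ('rV[R]_m -> R) -> Prop) (al c1 r0 : R) (c2 : R -> R) :
  0 < al -> 0 <= c1 -> (forall ep : R, 0 < ep -> 0 <= c2 ep) -> 0 < r0 ->
  (forall q w, P q w -> Lp_le p q w) ->
  (forall (ep q : R) a w (r : R), 0 < ep -> 0 <= q -> 0 < r -> P q w ->
     `|avg a r w - avg a (r / 2) w| <= r `^ al * (c1 * ep + c2 ep * q)) ->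
  forall e : R, 0 < e -> exists2 dt : R, 0 < dt & forall q a w,
    0 <= q <= dt `^ p -> P q w ->
    forall i, `|avg a (r0 / 2 ^+ i) w| <= e.
Proof.
move=> al0 c10 c20 r00 PL step e e0.
pose rho : R := 2^-1 `^ al.
have rho0 : 0 < rho by rewrite powR_gt0// invr_gt0.
have rho1 : rho < 1.
  have E1 : (1 : R) `^ al = 1 by rewrite powR1.
  rewrite -[ltRHS]E1; apply: gt0_ltr_powR; rewrite ?nnegrE ?invr_ge0//.
  by rewrite invf_lt1// ltr1n.
have rho1' : 0 < 1 - rho by rewrite subr_gt0.
(* the sum of the factors r^al over all the scales *)
pose S := r0 `^ al / (1 - rho).
have S0 : 0 < S by rewrite divr_gt0 ?powR_gt0.
pose ep := e / (4 * (S * c1 + 1)).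
have ep0 : 0 < ep.
  by rewrite divr_gt0// mulr_gt0// ltr_wpDl// mulr_ge0// ltW.
pose l := e / (4 * 2 ^+ m).
have l0 : 0 < l by rewrite divr_gt0// mulr_gt0// exprn_gt0.
have K1 : 0 <= S * c2 ep by rewrite mulr_ge0 ?c20// ltW.
have K2 : 0 <= l `^ (1 - p) * (3 * M / r0) ^+ m.
  by rewrite mulr_ge0 ?powR_ge0// exprn_ge0// divr_ge0 ?ltW// mulr_gt0.
have e4 : 0 < e / 4 by rewrite divr_gt0.
have [d1 d10 H1] := small_power p1 K1 e4.
have [d2 d20 H2] := small_power p1 K2 e4.
exists (Num.min d1 d2); first by rewrite lt_min d10.
move=> q a w /andP[q0 qd] Pw.
have d0 : 0 <= Num.min d1 d2 by rewrite le_min !ltW.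
have qd1 : q <= d1 `^ p.
  apply: le_trans qd _; apply: ge0_ler_powR; rewrite ?nnegrE ?(ltW d10)//.
    exact: le_trans p1.
  by rewrite ge_min lexx.
have qd2 : q <= d2 `^ p.
  apply: le_trans qd _; apply: ge0_ler_powR; rewrite ?nnegrE ?(ltW d20)//.
    exact: le_trans p1.
  by rewrite ge_min lexx orbT.
have {}H1 := H1 q; have {}H2 := H2 q; rewrite q0 qd1 qd2 in H1 H2.
have {}H1 := H1 isT; have {}H2 := H2 isT.
have base : `|avg a (r0 / 2 ^+ 0) w| <= e / 2.
  rewrite expr0 divr1; apply: le_trans (avg_le p1 M0 rM a r00 l0 (PL _ _ Pw)) _.
  have -> : e / 2 = e / 4 + e / 4 by field.
  apply: lerD => //; rewrite /l le_eqVlt; apply/orP; left; apply/eqP.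
  by field; rewrite expf_neq0.
have eta0 : 0 <= r0 `^ al * (c1 * ep + c2 ep * q).
  by rewrite mulr_ge0 ?powR_ge0// addr_ge0// mulr_ge0 ?c20// ltW.
have rho01 : 0 <= rho < 1 by rewrite (ltW rho0).
have steps i : `|avg a (r0 / 2 ^+ i) w - avg a (r0 / 2 ^+ i.+1) w| <=
    r0 `^ al * (c1 * ep + c2 ep * q) * rho ^+ i.
  have ri0 : 0 < r0 / 2 ^+ i by rewrite divr_gt0// exprn_gt0.
  have -> : r0 / 2 ^+ i.+1 = r0 / 2 ^+ i / 2 by rewrite exprS invfM mulrCA mulrC.
  apply: le_trans (step _ _ a w _ ep0 q0 ri0 Pw) _.
  rewrite powRM ?(ltW r00) ?invr_ge0 ?exprn_ge0//.
  have -> : (2 ^+ i)^-1 `^ al = rho ^+ i.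
    rewrite /rho -exprVn -powR_mulrn ?invr_ge0// -powRrM mulrC powRrM.
    by rewrite powR_mulrn// powR_ge0.
  by rewrite mulrAC.
move=> i; apply: le_trans (@geometric_steps (fun i => avg a (r0 / 2 ^+ i) w)
  _ _ _ rho01 eta0 base steps i) _.
rewrite [leRHS](_ : e = e / 2 + (e / 4 + e / 4)); last by field.
rewrite lerD2l mulrAC -/S mulrDr; apply: lerD; last by rewrite mulrA.
have Sc : 0 <= S * c1 by rewrite mulr_ge0// ltW.
rewrite /ep invfM (_ : S * (c1 * _) = S * c1 / (S * c1 + 1) * (e / 4)); last by ring.
apply: ler_piMl; first exact: ltW.
by rewrite ler_pdivrMr ?ltr_wpDl// mul1r lerDl.
Qed.

End SupBound.

(** * Small averages from small Sobolev norms *)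

Section SobolevCases.
Context {R : realType} {m : nat}.
Variables (p M : R).
Hypotheses (p1 : 1 <= p) (M0 : 0 < M) (rM : forall s : R, bump s <= M).

Let mu := lebesgueRn R m.

Let rD (r x y : R) : 0 < r -> r `^ (x + y) = r `^ x * r `^ y.
Proof. by move=> r0; rewrite powRD//; apply/implyP => _; rewrite gt_eqF. Qed.

Let rX (r : R) n : 0 < r -> r^-1 ^+ n = r `^ (- n%:R).
Proof. by move=> r0; rewrite powR_invn ?(ltW r0)// exprVn. Qed.

Definition gagliardo_le_pow (th q : R) (w : 'rV[R]_m -> R) : Prop :=
  Lp_le p q w /\
  (\int[mu]_z \int[mu]_y (gagliardo_kernel p (m%:R + th * p) w (z, y))%:E <= q%:E)%E.

(** With l = ep * r^al and al = th - m / p, both terms of [avg_step_gagliardo]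
    are proportional to r^al; the exponent is positive exactly when th * p
    exceeds the dimension. *)
Lemma avg_small_gagliardo (th r0 : R) : 0 < th -> m%:R < th * p -> 0 < r0 ->
  forall e : R, 0 < e -> exists2 dt : R, 0 < dt & forall (q : R) a w,
    0 <= q <= dt `^ p -> gagliardo_le_pow th q w ->
    forall i, `|avg a (r0 / 2 ^+ i) w| <= e.
Proof.
move=> th0 mth r00; have p0 : 0 < p by exact: lt_le_trans ltr01 p1.
pose al := (th * p - m%:R) / p.
have al0 : 0 < al by rewrite divr_gt0// subr_gt0.
pose e := m%:R + th * p.
have e0 : 0 <= e by rewrite addr_ge0// mulr_ge0// ltW.
pose c2 (ep : R) := ep `^ (1 - p) * (M ^+ m * (2 * M) ^+ m * Num.sqrt m%:R `^ e).
apply: (@avg_small_of_steps _ _ _ M p1 M0 rM (gagliardo_le_pow th) al 1 r0 c2) => //.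
- move=> ep ep0; rewrite mulr_ge0 ?powR_ge0// mulr_ge0 ?powR_ge0// mulr_ge0//.
    by rewrite exprn_ge0// ltW.
  by rewrite exprn_ge0// mulr_ge0// ltW.
- by move=> q w [].
move=> ep q a w r ep0 q0 r0' [wq wg].
have l0 : 0 < ep * r `^ al by rewrite mulr_gt0// powR_gt0.
apply: le_trans (avg_step_gagliardo p1 M0 rM a r0' l0 e0 wq wg) _.
rewrite le_eqVlt; apply/orP; left; apply/eqP.
rewrite mul1r mulrDr; congr (_ + _); first by rewrite mulrC.
rewrite !mulrA; congr (_ * q).
rewrite /c2 invf_div powRM ?(ltW ep0) ?powR_ge0// powRM ?sqrtr_ge0 ?(ltW r0')//.
have -> : M * (2 / r) = 2 * M / r by rewrite mulrCA mulrA.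
rewrite (exprMn m M) (exprMn _ (2 * M)) !rX//.
have E : r `^ al = (r `^ al) `^ (1 - p) * r `^ (- m%:R) * r `^ (- m%:R) * r `^ e.
  rewrite -powRrM -!rD//; congr (_ `^ _); rewrite /al /e; field.
  by rewrite gt_eqF.
by rewrite [in RHS]E; ring.
Qed.

Definition weak_le (q : R) (w : 'rV[R]_m -> R) : Prop :=
  Lp_le p q w /\ exists Dw : 'I_m -> 'rV[R]_m -> R,
    (forall j, weak_partial j w (Dw j)) /\ (forall j, Lp_le p q (Dw j)).

(** With l = ep * r^(- m / p), both terms of [avg_step_weak] are proportional
    to r^(1 - m / p). *)
Lemma avg_small_weak (r0 : R) : (0 < m)%N -> m%:R < p -> 0 < r0 ->
  forall e : R, 0 < e -> exists2 dt : R, 0 < dt & forall (q : R) a w,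
    0 <= q <= dt `^ p -> weak_le q w ->
    forall i, `|avg a (r0 / 2 ^+ i) w| <= e.
Proof.
move=> m0 mp r00; have p0 : 0 < p by exact: lt_le_trans ltr01 p1.
pose be := m%:R / p; pose al := 1 - be.
have al0 : 0 < al by rewrite subr_gt0 ltr_pdivrMr// mul1r.
pose c2 (ep : R) := m%:R * (ep `^ (1 - p) * (2 * M) ^+ m.-1).
apply: (@avg_small_of_steps _ _ _ M p1 M0 rM weak_le al m%:R r0 c2) => //.
- move=> ep ep0; rewrite mulr_ge0// mulr_ge0 ?powR_ge0//.
  by rewrite exprn_ge0// mulr_ge0// ltW.
- by move=> q w [].
move=> ep q a w r ep0 q0 r0' [wq [Dw [wD Dq]]].
have l0 : 0 < ep * r `^ (- be) by rewrite mulr_gt0// powR_gt0.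
apply: le_trans (avg_step_weak p1 M0 rM a r0' l0 wq wD Dq) _.
rewrite le_eqVlt; apply/orP; left; apply/eqP.
transitivity (m%:R * (ep * r `^ al + ep `^ (1 - p) * ((2 * M) ^+ m.-1 * r `^ al) * q));
  last first.
  by rewrite /c2; ring.
congr (_ * (_ + _ * q)).
  by rewrite -mulrA -{2}(powRr1 (ltW r0')) -rD// addrC.
rewrite powRM ?(ltW ep0) ?powR_ge0// (exprMn _ (2 * M)) rX//.
have E : r `^ al = (r `^ - be) `^ (1 - p) * r `^ (- m.-1%:R).
  rewrite -powRrM -rD//; congr (_ `^ _).
  have -> : m.-1%:R = m%:R - 1 :> R by rewrite -subn1 natrB.
  by rewrite /al /be; field; rewrite gt_eqF.
by rewrite [in RHS]E; ring.
Qed.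

Lemma poweR_inv_le (X : \bar R) (dt : R) : (0 <= X)%E -> 0 <= dt ->
  (X `^ p^-1 <= dt%:E)%E -> (X <= (dt `^ p)%:E)%E.
Proof.
move=> X0 d0 h; have p0 : 0 < p by exact: lt_le_trans ltr01 p1.
have -> : X = ((X `^ p^-1) `^ p)%E.
  by rewrite -poweRrM mulVf ?gt_eqF// poweRe1.
rewrite -poweR_EFin; apply: (gt0_ler_poweR (ltW p0)) h.
  by rewrite in_itv /= poweR_ge0 leey.
by rewrite in_itv /= lee_fin d0 leey.
Qed.

Lemma Lp_le_norm (dt : R) (w : 'rV[R]_m -> R) : 0 <= dt -> measurable_Rn w ->
  (Lp_norm p w <= dt%:E)%E -> Lp_le p (dt `^ p) w.
Proof.
move=> d0 mw; rewrite /Lp_norm unlock => h; split=> //.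
by apply: poweR_inv_le => //; apply: integral_ge0 => z _; rewrite lee_fin powR_ge0.
Qed.

Lemma gagliardo_le (dt th : R) (w : 'rV[R]_m -> R) : 0 <= dt ->
  (gagliardo th p w <= dt%:E)%E ->
  (\int[mu]_z \int[mu]_y (gagliardo_kernel p (m%:R + th * p)
    w (z, y))%:E <= (dt `^ p)%:E)%E.
Proof.
move=> d0 h; apply: poweR_inv_le => //.
by apply: integral_ge0 => z _; apply: integral_ge0 => y _;
  rewrite lee_fin gagliardo_kernel_ge0.
Qed.

Lemma Lp_norm_ge0 (w : 'rV[R]_m -> R) : (0 <= Lp_norm p w)%E.
Proof. exact: Lnorm_ge0. Qed.

Lemma gagliardo_ge0 (th : R) (w : 'rV[R]_m -> R) : (0 <= gagliardo th p w)%E.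
Proof. exact: poweR_ge0. Qed.

Lemma sobolev_norm_rec_ge0 k (th : R) (w : 'rV[R]_m -> R) :
  (0 <= sobolev_norm_rec k th p w)%E.
Proof.
elim: k w => [|k IH] w /=.
  by rewrite adde_ge0 ?Lp_norm_ge0//; case: ifP => // _; exact: gagliardo_ge0.
rewrite adde_ge0 ?Lp_norm_ge0//; apply: le_ereal_inf_tmp => _ [Df _ <-].
by apply: sume_ge0 => j _.
Qed.

Lemma sobolev_norm_rec_ge k (th : R) (w : 'rV[R]_m -> R) :
  (Lp_norm p w <= sobolev_norm_rec k th p w)%E.
Proof.
case: k => [|k] /=; apply: leeDl.
  by case: ifP => // _; exact: gagliardo_ge0.
apply: le_ereal_inf_tmp => _ [Df _ <-].
by apply: sume_ge0 => j _; exact: sobolev_norm_rec_ge0.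
Qed.

End SobolevCases.

(** The embedding into bounded functions, expressed by averages so that it
    holds for every representative of w. For delta > 0 the order 2 - 2 / p lies
    between 1 and 2 in positive dimension, and the first weak derivatives
    suffice. Otherwise the order 1 - 1 / p lies between 0 and 1, and multiplied
    by p it is p - 1, which exceeds the dimension. *)
Lemma sobolev_avg_small (R : realType) (m : nat) (p delta r0 e : R) :
  m.+1%:R < p -> 0 < r0 -> 0 < e ->
  exists2 dt : R, 0 < dt & forall (a : 'rV[R]_m) (w : 'rV[R]_m -> R),
    measurable_Rn w -> (sobolev_norm (phase_order delta p) p w < dt%:E)%E ->
    forall i, `|avg a (r0 / 2 ^+ i) w| <= e.
Proof.
move=> mp r00 e0.
have [M M0 rM] := @bump_bounded R.
have p1' : 1 < p by apply: le_lt_trans mp; rewrite ler1n.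
have p1 := ltW p1'; have p0 : 0 < p by exact: lt_trans p1'.
(* in dimension 0 the averages do not depend on the scale *)
case: m mp => [|m] mp.
  have avg0 (a : 'rV[R]_0) (w : 'rV[R]_0 -> R) r :
      avg a r w = \int[lebesgueRn R 0]_z w (rowRn z).
    by apply: eq_Rintegral => z _; rewrite /mollifier big_ord0 mulr1.
  have step (ep q : R) (a : 'rV[R]_0) (w : 'rV[R]_0 -> R) (r : R) :
      0 < ep -> 0 <= q -> 0 < r -> Lp_le p q w ->
      `|avg a r w - avg a (r / 2) w| <= r `^ 1 * (0 * ep + 0 * q).
    by move=> _ _ _ _; rewrite !avg0 subrr normr0 !mul0r addr0 mulr0.
  have [dt dt0 H] := avg_small_of_steps p1 M0 rM ltr01 (lexx _) (fun _ _ => lexx _) r00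
    (fun _ _ h => h) step e0.
  exists dt => // a w mw ws i.
  apply: (H (dt `^ p)) => //; first by rewrite powR_ge0 lexx.
  apply: Lp_le_norm => //; first exact: ltW.
  apply: le_trans (ltW ws); exact: sobolev_norm_rec_ge.
have [d0|d0] := ltP 0 delta; last first.
  pose th := 1 - 1 / p.
  have th0 : 0 < th by rewrite subr_gt0 ltr_pdivrMr// mul1r.
  have thp : th * p = p - 1 by rewrite /th; field; rewrite gt_eqF.
  have mth : m.+1%:R < th * p.
    by rewrite thp ltrBrDr natr1.
  have [dt dt0 H] := @avg_small_gagliardo R m.+1 p M p1 M0 rM th r0 th0 mth r00 e e0.
  exists dt => // a w mw ws i.
  apply: (H (dt `^ p)) => //; first by rewrite powR_ge0 lexx.
  have tr0 : Num.truncn (1 - 1 / p) = 0%N.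
    apply: Num.Theory.truncn_def; rewrite -/th (ltW th0) /= /th gtrBl.
    by rewrite divr_gt0.
  move: ws; rewrite /sobolev_norm /phase_order (le_gtF d0) tr0 subr0 /= gt_eqF// => ws.
  split.
    apply: Lp_le_norm => //; first exact: ltW.
    by apply: le_trans (ltW ws); rewrite leeDl// gagliardo_ge0.
  apply: gagliardo_le => //; first exact: ltW.
  by apply: le_trans (ltW ws); rewrite leeDr// Lp_norm_ge0.
have mp' : m.+1%:R < p by apply: lt_trans mp; rewrite ltr_nat.
have [dt dt0 H] := @avg_small_weak R m.+1 p M p1 M0 rM r0 isT mp' r00 e e0.
exists dt => // a w mw ws i.
apply: (H (dt `^ p)) => //; first by rewrite powR_ge0 lexx.
have p2 : 2 < p by apply: le_lt_trans mp; rewrite ler_nat.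
have tr1 : Num.truncn (2 - 2 / p) = 1%N.
  have h1 : 0 < 2 / p by rewrite divr_gt0.
  have h2 : 2 / p < 1 by rewrite ltr_pdivrMr// mul1r.
  by apply: Num.Theory.truncn_def; apply/andP; split; lra.
move: ws; rewrite /sobolev_norm /phase_order d0 tr1 /=.
set s := 2 - 2 / p - 1%:R; set I := ereal_inf _ => ws.
have I0 : (0 <= I)%E.
  apply: le_ereal_inf_tmp => _ [Df _ <-]; apply: sume_ge0 => j _.
  exact: (sobolev_norm_rec_ge0 p 0 s (Df j)).
have Is : (I < dt%:E)%E.
  by apply: le_lt_trans ws; rewrite leeDr// Lp_norm_ge0.
split.
  apply: Lp_le_norm => //; first exact: ltW.
  by apply: le_trans (ltW ws); rewrite leeDl.
have [_ [Df wD <-] Ds] := ereal_inf_lt Is.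
exists Df; split=> // j; apply: Lp_le_norm => //; first exact: ltW.
  by have [] := wD j.
apply: le_trans (ltW Ds); rewrite (bigD1 j)//=.
apply: le_trans (sobolev_norm_rec_ge p 0 s (Df j)) _.
apply: leeDl; apply: sume_ge0 => k _; exact: (sobolev_norm_rec_ge0 p 0 s (Df k)).
Qed.

(** * Local minima *)

Section Extrema.
Context {R : realType}.

Lemma derive_pos_right (f : R -> R) (d : R) :
  is_derive (0 : R) 1 f d -> 0 < d -> f 0 = 0 ->
  exists2 e : R, 0 < e & forall s, 0 < s < e -> 0 < f s.
Proof.
move=> [df Df] d0 f0.
have : \forall h \near (0 : R)^', 0 < h^-1 *: ((f \o shift 0) (h *: 1) - f 0).
  by apply: (cvgr_gt d) => //; rewrite -Df; exact: df.
move=> /nbhs_ballP[e /= e0 H]; exists e => // s /andP[s0 se].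
have := H s; rewrite /= addr0 [_%:A]mulr1 f0 subr0 /GRing.scale /= => {}H.
have : 0 < s^-1 * f s.
  by apply: H; rewrite ?gt_eqF// -ball_normE /= sub0r normrN gtr0_norm.
by rewrite pmulr_rgt0 ?invr_gt0.
Qed.

Lemma near_line (V : normedModType R) (O : set V) (x v : V) : open O -> O x ->
  exists2 e : R, 0 < e & forall s : R, `|s| < e -> O (s *: v + x).
Proof.
move=> oO Ox.
have c : (fun s : R => s *: v + x) @ (0 : R) --> 0 *: v + x.
  by apply: cvgD; [apply: cvgZr_tmp; exact: cvg_id|exact: cvg_cst].
have : \forall s \near (0 : R), O (s *: v + x).
  apply: c; rewrite scale0r add0r; exact: open_nbhs_nbhs.
move=> /nbhs_ballP[e /= e0 H]; exists e => // s se; apply: H.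
by rewrite -ball_normE /= sub0r normrN.
Qed.

Lemma local_min_derive (V : normedModType R) (O : set V) (f : V -> R) (x v : V) :
  open O -> O x -> Ck 1 O f -> (forall y, O y -> f x <= f y) -> 'D_v f x = 0.
Proof.
move=> oO Ox cf fmin; have [e e0 Oe] := near_line v oO Ox.
have d (s : R) : s \in `]- e, e[ ->
    is_derive s 1 (fun t : R => f (t *: v + x)) ('D_v f (s *: v + x)).
  rewrite in_itv /= -ltr_norml => se; apply: is_derive_line.
  exact: (Ck_derivable v cf (Oe s se)).
have [] := @derive1_at_min R (fun t => f (t *: v + x)) (- e) e 0.
- by rewrite ge0_cp// ltW.
- by move=> s /d[].
- by rewrite in_itv /= oppr_lt0 e0.
- move=> s; rewrite in_itv /= -ltr_norml => se.
  by rewrite scale0r add0r; apply: fmin; exact: Oe.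
have i0 : (0 : R) \in `]- e, e[ by rewrite in_itv /= oppr_lt0 e0.
by have [_ ->] := d 0 i0; rewrite scale0r add0r.
Qed.

(** If the second derivative in the direction v were negative, the first one
    would be negative just after x, and by the mean value theorem f would fall
    below f x. *)
Lemma local_min_derive2 (V : normedModType R) (O : set V) (f : V -> R) (x v : V) :
  open O -> O x -> Ck 2 O f -> (forall y, O y -> f x <= f y) ->
  0 <= 'D_v ('D_v f) x.
Proof.
move=> oO Ox cf fmin; rewrite leNgt; apply/negP => neg.
have D0 := local_min_derive v oO Ox (CkS cf) fmin.
have [e e0 Oe] := near_line v oO Ox.
have d2 : is_derive (0 : R) 1 (fun t : R => - 'D_v f (t *: v + x)) (- 'D_v ('D_v f) x).
  by apply: is_deriveN; apply: derive_line; exact: (Ck_derivable v (Ck_derive v cf) Ox).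
have [||e' e'0 H] := derive_pos_right d2.
- by rewrite oppr_gt0.
- by rewrite scale0r add0r D0 oppr0.
pose s := Num.min e e' / 2.
have s0 : 0 < s by rewrite divr_gt0// lt_min e0.
have se : s < e.
  by rewrite ltr_pdivrMr// (@le_lt_trans _ _ e) ?ge_min ?lexx// mulr2n mulrDr mulr1 ltrDl.
have se' : s < e'.
  by rewrite ltr_pdivrMr// (@le_lt_trans _ _ e')
    ?ge_min ?lexx ?orbT// mulr2n mulrDr mulr1 ltrDl.
have d1 (t : R) : `|t| < e ->
    is_derive t 1 (fun t : R => f (t *: v + x)) ('D_v f (t *: v + x)).
  by move=> te; apply: is_derive_line; exact: (Ck_derivable v (CkS cf) (Oe t te)).
have [||c] := @MVT R (fun t : R => f (t *: v + x)) (fun t => 'D_v f (t *: v + x)) 0 s s0.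
- move=> t; rewrite in_itv /= => /andP[t0 ts]; apply: d1.
  by rewrite gtr0_norm// (lt_trans ts).
- apply: derivable_within_continuous => t; rewrite in_itv /= => /andP[t0 ts].
  by have [] := d1 t; rewrite ?ger0_norm// (le_lt_trans ts).
rewrite in_itv /= => /andP[c0 cs]; rewrite scale0r add0r subr0 => E.
have : 0 <= f (s *: v + x) - f x.
  by rewrite subr_ge0; apply: fmin; apply: Oe; rewrite gtr0_norm.
rewrite E pmulr_lge0// leNgt -oppr_gt0.
by rewrite H// c0 (lt_trans cs).
Qed.

End Extrema.

(** * Boundary charts *)

Section Charts.
Context {R : realType} {m : nat}.
Variables (Omega : set 'rV[R]_m.+1).
Hypothesis oOmega : open Omega.

Lemma open_interior_id (A : set 'rV[R]_m.+1) : open A -> interior A = A.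
Proof.
by move=> oA; apply/seteqP; split; [exact: interior_subset|move: oA; rewrite openE].
Qed.

Lemma boundaryE x : boundary Omega x <-> closure Omega x /\ ~ Omega x.
Proof. by rewrite /boundary open_interior_id. Qed.

Variable c : graph_chart R m.
Hypothesis hc : is_chart Omega c.

Let sg : R := (-1) ^+ below c.

Let sg2 : sg * sg = 1.
Proof. by rewrite /sg -expr2 sqrr_sign. Qed.

(** Up to the sign carried by the chart, a defining function of the domain. *)
Definition level (x : 'rV[R]_m.+1) : R := x 0 (axis c) - height c (col' (axis c) x).

Lemma Ck_col' k (U : set 'rV[R]_m.+1) (f : 'rV[R]_m -> R) :
  open U -> Ck k setT f -> Ck k U (f \o col' (axis c)).
Proof.
move=> oU cf; apply: (Ck_comp_row (O := setT)) => //; first exact: openT.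
move=> j; have := @Ck_coord R _ k (lift (axis c) j) U oU.
by apply: Ck_eq => // y _; rewrite mxE.
Qed.

Lemma smooth_level k : Ck k setT level.
Proof.
have [_ ch _] := hc.
by apply: CkB; [exact: openT|exact: Ck_coord openT|apply: Ck_col';
  [exact: openT|exact: ch]].
Qed.

Lemma col'_chart_map y : col' (axis c) (chart_map c y) = y.
Proof. by apply/rowP => j; rewrite !mxE liftK. Qed.

Lemma chart_map_axis y : chart_map c y 0 (axis c) = height c y.
Proof. by rewrite mxE unlift_none. Qed.

Lemma level_chart_map y : level (chart_map c y) = 0.
Proof. by rewrite /level chart_map_axis col'_chart_map subrr. Qed.

Lemma level0_chart_map x : level x = 0 -> chart_map c (col' (axis c) x) = x.
Proof.
move=> /eqP; rewrite subr_eq0 => /eqP lx; apply/rowP => j; rewrite mxE.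
by case: unliftP => [k ->|->]; rewrite ?mxE.
Qed.

(** Where the level function does not vanish it keeps its sign nearby, so that
    a neighbourhood is entirely inside or entirely outside the domain. *)
Lemma boundary_level x : Defs.patch c x -> boundary Omega x -> level x = 0.
Proof.
have [op _ cO] := hc.
move=> px /boundaryE[clx nOx].
have [//|l0] := eqVneq (level x) 0; exfalso.
have sl : sg * level x < 0.
  rewrite lt_neqAle leNgt; apply/andP; split.
    by rewrite mulf_neq0// signr_eq0.
  by apply/negP => h; apply: nOx; apply/cO.
have nx : \forall y \near x, Defs.patch c y /\ sg * level y < 0.
  have h1 : \forall y \near x, Defs.patch c y by exact: open_nbhs_nbhs.
  have h2 : \forall y \near x, sg * level y < 0.
    have cs : {for x, continuous (fun y => sg * level y)}.
      exact: (Ck_continuous (CkZ sg openT (smooth_level 0)) I).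
    exact: (cvgr_lt _ cs _ sl).
  by near=> y; split; near: y.
have [y [Oy [py ly]]] := clx _ nx.
by move/(cO _ py) : Oy; rewrite ltNge (ltW ly).
Unshelve. all: by end_near.
Qed.

(** A point of the graph is not in the open side of the chart, but moving it
    along the axis reaches that side at once. *)
Lemma chart_map_boundary y :
  Defs.patch c (chart_map c y) -> boundary Omega (chart_map c y).
Proof.
have [op _ cO] := hc => px; apply/boundaryE; split; last first.
  by move/(cO _ px); rewrite -/(level (chart_map c y)) level_chart_map mulr0 ltxx.
set x := chart_map c y in px *.
move=> B nB.
have [e e0 He] := @near_line R _ (Defs.patch c `&` interior B)
  x (sg *: delta_mx 0 (axis c))
   (openI op (@open_interior _ B)) (conj px nB).
have e2 : 0 < e / 2 by rewrite divr_gt0.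
have [|p1 /interior_subset B1] := He (e / 2).
  by rewrite gtr0_norm// ltr_pdivrMr// mulr2n mulrDr mulr1 ltrDl.
exists ((e / 2) *: (sg *: delta_mx 0 (axis c)) + x); split=> //.
apply/(cO _ p1).
have E : col' (axis c) ((e / 2) *: (sg *: delta_mx 0 (axis c)) + x) = y.
  apply/rowP => j; rewrite !mxE liftK /= (_ : (lift _ j == axis c) = false) ?andbF;
    last first.
    by rewrite eq_sym; apply/negbTE; exact: neq_lift.
  by rewrite !mulr0 add0r.
rewrite E !mxE unlift_none !eqxx /= mulr1 addrK mulrCA -/sg sg2 mulr1//.
Qed.

(** Along the opposite of the normal, the signed level function starts from 0
    with the slope (1 + |grad height|^2) / |w| > 0, where w is the normal
    before normalization. *)
Lemma chart_normal_inward x : Defs.patch c x -> boundary Omega x ->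
  exists2 e : R, 0 < e & forall h, 0 < h < e -> Omega (x - h *: chart_normal c x).
Proof.
move=> px bx; have [op ch cO] := hc.
have l0 := boundary_level px bx.
set y := col' (axis c) x.
pose gr k := partial k (height c) y.
pose w : 'rV[R]_m.+1 := sg *:
    \row_j (if unlift (axis c) j is Some k then gr k else -1).
have nE : chart_normal c x = (euclid_norm w)^-1 *: w by [].
have S0 : 0 < \sum_j w 0 j ^+ 2.
  rewrite (bigD1 (axis c))//= ltr_pwDl//; last by apply: sumr_ge0 => j _; exact: sqr_ge0.
  by rewrite !mxE unlift_none mulrN1 sqrrN expr2 sg2 ltr01.
have N0 : 0 < euclid_norm w by rewrite sqrtr_gt0.
pose v := - chart_normal c x.
pose f (h : R) := sg * level (h *: v + x).
have df : is_derive (0 : R) 1 f ((euclid_norm w)^-1 * (1 + \sum_k gr k ^+ 2)).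
  have D : is_derive (0 : R) 1 (fun h : R => level (h *: v + x)) ('D_v level x).
    by apply: derive_line; exact: (Ck_derivable v (smooth_level 1) I).
  have DL : 'D_v level x = sg * ((euclid_norm w)^-1 * (1 + \sum_k gr k ^+ 2)).
    have dh : is_derive x v (height c \o col' (axis c))
       (\sum_k v 0 (lift (axis c) k) * partial k (height c) (col' (axis c) x)).
      apply: (is_derive_comp_row (O := setT)) => //; first exact: openT.
      move=> k; have := is_derive_coord x v (lift (axis c) k).
      have -> // : (fun z : 'rV[R]_m.+1 => z 0 (lift (axis c) k)) =
         (fun z => col' (axis c) z 0 k) by apply/funext => z; rewrite mxE.
    have dl := is_deriveB (is_derive_coord x v (axis c)) dh.
    have [_ E] := dl; rewrite [LHS]E /v nE !mxE unlift_none.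
    under eq_bigr do rewrite !mxE liftK /=.
    have -> : \sum_k - ((euclid_norm w)^-1 * (sg * gr k)) * partial k (height c)
      (col' (axis c) x)
       = - (sg * (euclid_norm w)^-1 * \sum_k gr k ^+ 2).
      rewrite mulr_sumr -sumrN; apply: eq_bigr => k _; rewrite -/y -/(gr k); ring.
    ring.
  have := is_deriveM (@is_derive_cst R R R sg 0 1) D.
  by rewrite scaler0 addr0 DL /GRing.scale /= mulrA sg2 mul1r.
have [|| e e0 He] := derive_pos_right df.
- by rewrite mulr_gt0 ?invr_gt0// ltr_pwDl// sumr_ge0// => k _; exact: sqr_ge0.
- by rewrite /f scale0r add0r l0 mulr0.
have [e' e'0 He'] := near_line v op px.
exists (Num.min e e'); first by rewrite lt_min e0.
move=> h /andP[h0]; rewrite lt_min => /andP[he he'].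
have -> : x - h *: chart_normal c x = h *: v + x by rewrite /v scalerN addrC.
have ph : Defs.patch c (h *: v + x) by apply: He'; rewrite gtr0_norm.
by apply/(cO _ ph); apply: He; rewrite h0.
Qed.

End Charts.

(** * Minimum principle for harmonic functions *)

Section HarmonicMin.
Context {R : realType} {m : nat}.
Variables (Omega : set 'rV[R]_m.+1).
Hypotheses (oOmega : open Omega) (bOmega : bounded_set Omega).

Lemma closure_bounded : exists2 B : R, 0 < B & forall x, closure Omega x -> `|x| <= B.
Proof.
have [M [_ HM]] := bOmega.
pose B := `|M| + 1.
have B0 : 0 < B by rewrite ltr_wpDl.
have MB : M < B by rewrite (le_lt_trans (ler_norm M))// ltrDl.
exists B => // x clx; rewrite leNgt; apply/negP => Bx.
have nc : (fun y : 'rV[R]_m.+1 => `|y|) @ x --> `|x| by exact: norm_continuous.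
have nx : \forall y \near x, B < `|y| by exact: (cvgr_gt _ nc _ Bx).
have [y [Oy yB]] := clx _ nx.
by have /= := HM B MB y Oy; rewrite leNgt yB.
Qed.

Lemma closure_compact : compact (closure Omega).
Proof.
apply: bounded_closed_compact; last exact: closed_closure.
have [B B0 HB] := closure_bounded; exists B; split; first exact: num_real.
by move=> M BM x /HB xB; apply: le_trans xB (ltW BM).
Qed.

Lemma boundary_compact : compact (boundary Omega).
Proof.
apply: (subclosed_compact _ closure_compact); last by move=> x /(boundaryE oOmega)[].
have -> : boundary Omega = closure Omega `&` ~` Omega.
  by apply/seteqP; split=> x /(boundaryE oOmega).
by apply: closedI; [exact: closed_closure|exact: open_closedC].
Qed.

(** A point of the closure where the first coordinate is maximal cannot belong
    to the open domain. *)
Lemma boundary_nonempty : Omega !=set0 -> boundary Omega !=set0.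
Proof.
move=> [x0 Ox0].
have A0 : closure Omega !=set0 by exists x0; exact: subset_closure.
have [|z] := @compact_EVT_max _ R (fun x : 'rV[R]_m.+1 => x 0 ord0 : R)
  _ A0 closure_compact.
  by apply: continuous_subspaceT => x; exact: coord_continuous.
rewrite inE => zc zmax; exists z; apply/boundaryE => //; split=> // Oz.
have [e e0 He] := near_line (delta_mx 0 ord0) oOmega Oz.
have e2 : 0 < e / 2 by rewrite divr_gt0.
have := zmax ((e / 2) *: delta_mx 0 ord0 + z).
rewrite !mxE eqxx /= mulr1 gerDr leNgt e2 => /(_ _)/negP; apply=> //.
rewrite inE; apply: subset_closure; apply: He.
by rewrite gtr0_norm// ltr_pdivrMr// mulr2n mulrDr mulr1 ltrDl.
Qed.

(** Subtracting a small multiple of x_0^2 makes the Laplacian negative, which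
    [local_min_derive2] forbids at an interior minimum. *)
Lemma harmonic_min (f : 'rV[R]_m.+1 -> R) (c : R) :
  {within closure Omega, continuous f} -> Ck 2 Omega f ->
  (forall x, Omega x -> laplacian f x = 0) ->
  (forall x, boundary Omega x -> c <= f x) ->
  forall x, closure Omega x -> c <= f x.
Proof.
move=> cf sf lapf bf x1 clx1; rewrite leNgt; apply/negP => fx1.
have [B B0 HB] := closure_bounded.
(* the perturbation is at most half of c - f x1 on the closure *)
pose ep := (c - f x1) / (2 * B ^+ 2).
have B20 : 0 < 2 * B ^+ 2 by rewrite mulr_gt0// exprn_gt0.
have ep0 : 0 < ep by rewrite divr_gt0// subr_gt0.
pose q (x : 'rV[R]_m.+1) : R := x 0 ord0 * x 0 ord0.
pose v (x : 'rV[R]_m.+1) : R := f x - ep * q x.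
have cq k : Ck k setT q.
  exact: CkM openT (Ck_coord k ord0 openT) (Ck_coord k ord0 openT).
have cv : {within closure Omega, continuous v}.
  rewrite (_ : v = f + (fun x => - (ep * q x))) => // x.
  apply: continuousD _; first exact: cf.
  move: x; apply: continuous_subspaceT => y.
  exact: (Ck_continuous (CkN openT (CkZ ep openT (cq 0%N))) I).
have A0 : closure Omega !=set0 by exists x1.
have [z] := @compact_EVT_min _ R v _ A0 closure_compact cv.
rewrite inE => zc zmin.
have vz : v z <= f x1.
  apply: le_trans (zmin x1 _) _; first by rewrite inE.
  by rewrite /v gerBl mulr_ge0 ?(ltW ep0)// /q -expr2 sqr_ge0.
have [Oz|nOz] := pselect (Omega z); last first.
  have bz : c <= f z by apply: bf; apply/boundaryE.
  have qz : q z <= B ^+ 2.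
    rewrite /q -expr2 -real_normK ?num_real// ler_sqr ?nnegrE ?(ltW B0)//.
    by apply: le_trans (HB z zc); exact: coord_norm_le.
  have h1 : ep * q z <= (c - f x1) / 2.
    apply: le_trans (ler_wpM2l (ltW ep0) qz) _.
    rewrite le_eqVlt; apply/orP; left; apply/eqP; rewrite /ep; field.
    by rewrite gt_eqF.
  by move: vz; rewrite /v; lra.
have cqO : Ck 2 Omega q := Ck_sub (@subsetT _ Omega) (cq 2%N).
have sv : Ck 2 Omega v := CkB oOmega sf (CkZ ep oOmega cqO).
have dq x (w : 'rV[R]_m.+1) : is_derive x w q (2 * w 0 ord0 * x 0 ord0).
  have := is_deriveM (is_derive_coord x w ord0) (is_derive_coord x w ord0).
  rewrite [X in is_derive _ _ _ X](_ : _ = 2 * w 0 ord0 * x 0 ord0)//.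
  by rewrite /GRing.scale /=; ring.
have ddq x (w : 'rV[R]_m.+1) : 'D_w ('D_w q) x = 2 * w 0 ord0 ^+ 2.
  have -> : 'D_w q = (fun x => (2 * w 0 ord0) * x 0 ord0).
    by apply/funext => y; have [_ ->] := dq y w.
  have := is_deriveM (@is_derive_cst _ _ R (2 * w 0 ord0) x w) (is_derive_coord x w ord0).
  by move=> [_ ->]; rewrite scaler0 addr0 /GRing.scale /=; ring.
have zminO y : Omega y -> v z <= v y.
  by move=> Oy; apply: zmin; rewrite inE; exact: subset_closure.
have ddv k : 'D_(delta_mx 0 k) ('D_(delta_mx 0 k) v) z =
    partial k (partial k f) z - ep * (2 * (delta_mx 0 k : 'rV[R]_m.+1) 0 ord0 ^+ 2).
  set w : 'rV[R]_m.+1 := delta_mx 0 k.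
  have e1 y : Omega y -> 'D_w v y = 'D_w f y - ep * 'D_w q y.
    move=> Oy; have df := Ck_derivable w (CkS sf) Oy.
    have dqy := (dq y w).
    have := is_deriveB (derivableP df) (is_deriveM (@is_derive_cst _ _ R ep y w) dqy).
    by move=> [_ ->]; rewrite scaler0 addr0; have [_ ->] := dqy.
  have e2 : 'D_w ('D_w v) z = 'D_w (fun y => 'D_w f y - ep * 'D_w q y) z.
    by apply: near_eq_derive; exact: near_open Oz e1.
  rewrite e2; have dDf := Ck_derivable w (Ck_derive w sf) Oz.
  have dDq := Ck_derivable w (Ck_derive w (cq 2%N)) (I : setT z).
  have := is_deriveB (derivableP dDf) (is_deriveM (@is_derive_cst _ _ R ep z w)
    (derivableP dDq)).
  by move=> [_ ->]; rewrite scaler0 addr0 ddq.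
have : 0 <= \sum_k 'D_(delta_mx 0 k) ('D_(delta_mx 0 k) v) z.
  by apply: sumr_ge0 => k _; exact: (local_min_derive2 _ oOmega Oz sv zminO).
under eq_bigr do rewrite ddv.
rewrite sumrB -/(laplacian f z) lapf// sub0r oppr_ge0 leNgt; apply/negP/negPn.
rewrite (bigD1 ord0)//= ltr_pwDl//; last first.
  by apply: sumr_ge0 => k _; rewrite mulr_ge0 ?(ltW ep0)// mulr_ge0// sqr_ge0.
by rewrite !mxE !eqxx expr1n mulr1 mulr_gt0.
Qed.

End HarmonicMin.

(** * The Laplace-Beltrami operator at a minimum *)

Section LaplaceBeltrami.
Context {R : realType} {m : nat}.

Lemma Ck_det (V : normedModType R) k n (U : set V) (A : V -> 'M[R]_n) : open U ->
  (forall i j, Ck k U (fun y => A y i j)) -> Ck k U (fun y => \det (A y)).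
Proof.
move=> oU cA; rewrite /determinant; apply: Ck_sum => // s.
apply: CkM => //; first exact: Ck_cst.
by apply: Ck_prod => // i; exact: cA.
Qed.

Lemma Ck_adj (V : normedModType R) k n (U : set V) (A : V -> 'M[R]_n) : open U ->
  (forall i j, Ck k U (fun y => A y i j)) -> forall i j, Ck k U (fun y => (\adj (A y))
    i j).
Proof.
move=> oU cA i j; under eq_fun do rewrite mxE /cofactor.
apply: CkM => //; first exact: Ck_cst.
apply: Ck_det => // i' j'.
by under eq_fun do rewrite !mxE; exact: cA.
Qed.

(** Where b vanishes, the product rule only asks for the continuity of a. This
    spares the derivatives of the volume density and of the inverse metric. *)
Lemma is_derive_mul0 (V : normedModType R) (a b : V -> R) (y v : V) :
  {for y, continuous a} -> derivable b y v -> b y = 0 ->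
  is_derive y v (fun z => a z * b z) (a y * 'D_v b y).
Proof.
move=> ca db b0.
have L : (fun h : R => h^-1 *: (((fun z => a z * b z) \o shift y) (h *: v) - a y * b y))
  @ (0:R)^'
    --> a y * 'D_v b y.
  have E : (fun h : R => h^-1 *: (((fun z => a z * b z) \o shift y) (h *: v)
    - a y * b y)) =
      (fun h : R => a (h *: v + y)) \* (fun h : R => h^-1 *: ((b \o shift y) (h *: v)
        - b y)).
    by apply/funext => h /=; rewrite b0 mulr0 !subr0 /GRing.scale /=; ring.
  rewrite E; apply: cvgM; last exact: db.
  have c : (fun h : R => a (h *: v + y)) @ (0 : R) --> a y.
    have c0 : (fun h : R => h *: v + y) @ (0 : R) --> y.
      rewrite -[X in _ --> X]add0r -[X in _ --> X + _](scale0r v).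
      by apply: cvgD; [apply: cvgZr_tmp; exact: cvg_id|exact: cvg_cst].
    exact: continuous_cvg ca c0.
  exact: cvg_trans (cvg_app _ (@nbhs_dnbhs _ (0 : R))) c.
by apply: DeriveDef; [apply/cvg_ex; exists (a y * 'D_v b y)|exact/cvg_lim].
Qed.

Variable c : graph_chart R m.
Hypothesis ch : smooth_open setT (height c).

Lemma smooth_chart_map j k : Ck k setT (fun y => chart_map c y 0 j).
Proof.
under eq_fun do rewrite mxE.
by case: (unlift _ _) => [i|]; [exact: Ck_coord openT|exact: ch].
Qed.

Definition chart_jac (y : 'rV[R]_m) : 'M[R]_(m.+1, m) :=
  \matrix_(k, i) partial i (fun z => chart_map c z 0 k) y.

Lemma chart_metricE y : chart_metric c y = (chart_jac y)^T *m chart_jac y.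
Proof.
by apply/matrixP => i j; rewrite !mxE; apply: eq_bigr => k _; rewrite !mxE.
Qed.

(** The Gram matrix of the Jacobian J of the chart is invertible as soon as J
    is injective, and the rows of J other than the one of the axis form an
    identity matrix. *)
Lemma chart_metric_unit y : chart_metric c y \in unitmx.
Proof.
rewrite unitmxE unitfE; apply/negP => /det0P[v v0 vG]; apply: (negP v0); apply/eqP.
have E : (v *m (chart_jac y)^T) *m (v *m (chart_jac y)^T)^T = 0.
  by rewrite trmx_mul trmxK mulmxA -(mulmxA v) -chart_metricE vG mul0mx.
have S : \sum_k (v *m (chart_jac y)^T) 0 k ^+ 2 = 0.
  set J := v *m _ in E *; have /= := congr1 (fun M : 'M[R]_1 => M 0 0) E.
  rewrite [RHS]mxE => E0; apply: etrans E0; rewrite [RHS]mxE.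
  by apply: eq_bigr => k _; rewrite [J^T k 0]mxE expr2.
apply/rowP => i; rewrite mxE.
have Z : (v *m (chart_jac y)^T) 0 (lift (axis c) i) = 0.
  apply/eqP; rewrite -sqrf_eq0; apply/eqP; move: S.
  move/eqP; rewrite psumr_eq0; last by move=> k _; exact: sqr_ge0.
  by move/allP => /(_ (lift (axis c) i)); rewrite mem_index_enum => /(_ isT)/eqP.
rewrite -Z mxE (bigD1 i)//= !mxE big1 ?addr0.
  have -> : (fun z : 'rV[R]_m => chart_map c z 0 (lift (axis c) i)) = (fun z => z 0 i).
    by apply/funext => z; rewrite mxE liftK.
  have [_ E1] := is_derive_coord y (delta_mx 0 i) i.
  by rewrite /partial E1 mxE !eqxx mulr1.
move=> j ji; rewrite !mxE.
have -> : (fun z : 'rV[R]_m => chart_map c z 0 (lift (axis c) i)) = (fun z => z 0 i).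
  by apply/funext => z; rewrite mxE liftK.
have [_ E1] := is_derive_coord y (delta_mx 0 j) i.
by rewrite /partial E1 mxE eqxx eq_sym (negbTE ji) mulr0.
Qed.

Lemma Ck_chart_metric k i j : Ck k setT (fun y => chart_metric c y i j).
Proof.
under eq_fun do rewrite mxE.
apply: Ck_sum => [|l]; first exact: openT.
by apply: CkM; [exact: openT| |]; exact: (Ck_derive _ (smooth_chart_map l k.+1)).
Qed.

Lemma Ck_invmx_metric k i j : Ck k setT (fun y => invmx (chart_metric c y) i j).
Proof.
have -> : (fun y => invmx (chart_metric c y) i j) =
    (fun y => (\det (chart_metric c y))^-1 * (\adj (chart_metric c y)) i j).
  by apply/funext => y; rewrite /invmx chart_metric_unit mxE.
apply: CkM; first exact: openT.
  apply: CkV; first exact: openT.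
    by move=> y _; rewrite -unitfE -unitmxE chart_metric_unit.
  by apply: Ck_det; [exact: openT|move=> *; exact: Ck_chart_metric].
by apply: Ck_adj; [exact: openT|move=> *; exact: Ck_chart_metric].
Qed.

Let vol y := Num.sqrt (\det (chart_metric c y)).

Lemma continuous_vol : continuous vol.
Proof.
move=> y; have cd : Ck 0 setT (fun y => \det (chart_metric c y)).
  by apply: Ck_det; [exact: openT|move=> *; exact: Ck_chart_metric].
exact: (@continuous_comp _ _ _ (fun y => \det (chart_metric c y)) (@Num.sqrt R) y
  (Ck_continuous cd I) (@sqrt_continuous _ _)).
Qed.

(** For G = J^T J and B = J G^-1, the product B^T B is G^-1 G G^-1. *)
Lemma invmx_metricE y : exists B : 'M[R]_(m.+1, m),
  invmx (chart_metric c y) = B^T *m B.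
Proof.
exists (chart_jac y *m invmx (chart_metric c y)).
have sym : (chart_metric c y)^T = chart_metric c y.
  by rewrite chart_metricE trmx_mul trmxK.
have uG := chart_metric_unit y.
rewrite trmx_mul trmx_inv sym mulmxA -(mulmxA (invmx _)) -chart_metricE.
by rewrite mulVmx// mul1mx.
Qed.

Section AtMinimum.
Variables (U : set 'rV[R]_m) (F : 'rV[R]_m -> R) (y0 : 'rV[R]_m).
Hypotheses (oU : open U) (Uy0 : U y0) (cF : Ck 2 U F).
Hypothesis Fmin : forall y, U y -> F y0 <= F y.

(** The Hessian form at v is the second derivative in the direction v. *)
Lemma hessian_psd (v : 'I_m -> R) :
  0 <= \sum_i \sum_j v i * v j * partial i (partial j F) y0.
Proof.
pose w : 'rV[R]_m := \row_i v i.
suff -> : \sum_i \sum_j v i * v j * partial i (partial j F) y0 = 'D_w ('D_w F) y0.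
  exact: local_min_derive2 oU Uy0 cF Fmin.
rewrite (C1_derive w oU Uy0 (Ck_derive w cF)); apply: eq_bigr => i _; rewrite mxE.
have -> : partial i ('D_w F) y0 = partial i (fun y => \sum_j v j * partial j F y) y0.
  apply: near_eq_derive; apply: near_open Uy0 _ => // y Uy.
  rewrite (C1_derive w oU Uy (CkS cF)); by apply: eq_bigr => j _; rewrite mxE.
have D : is_derive y0 (delta_mx 0 i) (\sum_(j < m) (fun y => v j * partial j F y))
    (\sum_j v j * partial i (partial j F) y0).
  apply: is_derive_sum => j.
  have d := Ck_derivable (delta_mx 0 i) (Ck_derive (delta_mx 0 j) cF) Uy0.
  have := is_deriveM (@is_derive_cst _ _ R (v j) y0 (delta_mx 0 i)) (derivableP d).
  by rewrite scaler0 addr0.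
have E : (\sum_(j < m) (fun y => v j * partial j F y))
  = (fun y => \sum_j v j * partial j F y).
  by apply/funext => y; rewrite fct_sumE.
rewrite /partial -E; have [_ ->] := D; rewrite mulr_sumr.
by apply: eq_bigr => j _; rewrite mulrA.
Qed.

(** At a critical point the derivatives of the metric drop out. What remains is
    the trace of the inverse metric times the Hessian, which [invmx_metricE]
    writes as a sum of values of the Hessian form. *)
Lemma chart_laplace_beltrami_min (f : 'rV[R]_m.+1 -> R) (x : 'rV[R]_m.+1) :
  F = f \o chart_map c -> y0 = col' (axis c) x ->
  0 <= chart_laplace_beltrami c f x.
Proof.
move=> FE y0E; rewrite /chart_laplace_beltrami -y0E -FE -/vol.
have D0 j : partial j F y0 = 0 := local_min_derive (delta_mx 0 j) oU Uy0 (CkS cF) Fmin.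
pose A y i j := invmx (chart_metric c y) i j.
have T i : partial i (fun y => vol y * \sum_j A y i j * partial j F y) y0 =
    vol y0 * \sum_j A y0 i j * partial i (partial j F) y0.
  have D : is_derive y0 (delta_mx 0 i)
     (\sum_(j < m) (fun y => (vol y * A y i j) * partial j F y))
     (\sum_j (vol y0 * A y0 i j) * partial i (partial j F) y0).
    apply: is_derive_sum => j; apply: is_derive_mul0.
    - apply: continuousM; first exact: continuous_vol.
      exact: (Ck_continuous (Ck_invmx_metric 0 i j) I).
    - exact: (Ck_derivable _ (Ck_derive _ cF) Uy0).
    - exact: D0.
  have E : (\sum_(j < m) (fun y => (vol y * A y i j) * partial j F y)) =
      (fun y => vol y * \sum_j A y i j * partial j F y).
    by apply/funext => y; rewrite fct_sumE mulr_sumr; apply: eq_bigr => j _;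
      rewrite mulrA.
  rewrite [LHS]/partial -E; have [_ ->] := D; rewrite mulr_sumr.
  by apply: eq_bigr => j _; rewrite mulrA.
under eq_bigr do rewrite T.
rewrite -mulr_sumr; apply: mulr_ge0; first by rewrite invr_ge0 sqrtr_ge0.
apply: mulr_ge0; first exact: sqrtr_ge0.
have [B BE] := invmx_metricE y0.
have -> : \sum_i \sum_j A y0 i j * partial i (partial j F) y0 =
    \sum_k \sum_i \sum_j B k i * B k j * partial i (partial j F) y0.
  rewrite [RHS]exchange_big /=; apply: eq_bigr => i _.
  rewrite [RHS]exchange_big /=; apply: eq_bigr => j _.
  rewrite -mulr_suml /A BE mxE; congr (_ * _).
  by apply: eq_bigr => k _; rewrite mxE.
by apply: sumr_ge0 => k _; exact: hessian_psd.
Qed.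

End AtMinimum.
End LaplaceBeltrami.

(** * Pointwise consequences and cutoff functions *)

Section Initial.
Context {R : realType} {m : nat}.

Lemma avg_le_cst (p q : R) (w : 'rV[R]_m -> R) (a : 'rV[R]_m) (r b : R) :
  1 <= p -> 0 < r -> Lp_le p q w -> (forall y, cube a r y -> w y <= b) -> avg a r w <= b.
Proof.
move=> p1 r0 wq wb; have [M M0 rM] := @bump_bounded R.
have If := integral_mollifier a r0.
have mf := measurable_mollifier a r.
have imf : (lebesgueRn R m).-integrable setT (EFin \o (mollifier a r \o @rowRn R m)).
  apply/integrableP; split; first exact/measurable_EFinP.
  under eq_integral do rewrite /= ger0_norm ?mollifier_ge0//.
  by rewrite If ltry.
have -> : b = \int[lebesgueRn R m]_z (b * (mollifier a r \o @rowRn R m) z).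
  by rewrite RintegralZl// /Rintegral If mulr1.
apply: le_Rintegral => //.
- exact: (integrable_mollifier p1 M0 rM a r0 wq).
- exact: (integrableZl measurableT b imf).
move=> z _ /=; have [zc|zc] := pselect (cube a r (rowRn z)).
  by apply: ler_wpM2r; [exact: mollifier_ge0|exact: wb].
by rewrite mollifier_out// !mulr0.
Qed.

(** A function that is at most -1 on a whole cube has an average that is at
    most -1 there. *)
Lemma sobolev_pointwise (p delta r0 : R) : m.+1%:R < p -> 0 < r0 ->
  exists2 dt : R, 0 < dt & forall (a : 'rV[R]_m) (w : 'rV[R]_m -> R),
    measurable_Rn w -> (sobolev_norm (phase_order delta p) p w < dt%:E)%E ->
    forall i, ~ (forall y, cube a (r0 / 2 ^+ i) y -> w y <= - 1).
Proof.
move=> mp r00; have h2 : 0 < 2^-1 :> R by rewrite invr_gt0.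
have [dt dt0 H] := @sobolev_avg_small R m p delta r0 2^-1 mp r00 h2.
exists dt => // a w mw ws i wneg.
have p1 : 1 <= p by apply: ltW; apply: le_lt_trans mp; rewrite ler1n.
have ri0 : 0 < r0 / 2 ^+ i by rewrite divr_gt0// exprn_gt0.
have wq : Lp_le p (dt `^ p) w.
  apply: Lp_le_norm => //; first exact: ltW.
  by apply: le_trans (ltW ws); exact: sobolev_norm_rec_ge.
have := avg_le_cst p1 ri0 wq wneg.
have := H a w mw ws i; rewrite ler_norml => /andP[h _] h'.
have := le_trans h h'; lra.
Qed.

Definition cutoff (s : R) : R := unit_step (s + 2) * unit_step (2 - s).

Lemma smooth_cutoff : smooth_open setT cutoff.
Proof.
move=> k; apply: CkM; first exact: openT.
  apply: Ck_comp_real; [exact: openT|exact: smooth_unit_step|].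
  exact: CkD openT (Ck_id k) (Ck_cst k setT 2).
apply: Ck_comp_real; [exact: openT|exact: smooth_unit_step|].
exact: CkB openT (Ck_cst k setT 2) (Ck_id k).
Qed.

Lemma cutoff1 s : `|s| <= 1 -> cutoff s = 1.
Proof.
by rewrite ler_norml => /andP[? ?]; rewrite /cutoff !unit_step1 ?mulr1//; lra.
Qed.

Lemma cutoff0 s : 2 < `|s| -> cutoff s = 0.
Proof.
move=> s2; rewrite /cutoff; have [s0|s0] := leP 0 s.
  by rewrite ger0_norm// in s2; rewrite [X in _ * X]unit_step0 ?mulr0//; lra.
by rewrite ltr0_norm// in s2; rewrite unit_step0 ?mul0r//; lra.
Qed.

Definition cutoffs (y0 : 'rV[R]_m) (r : R) (y : 'rV[R]_m) : R :=
  \prod_k cutoff ((y 0 k - y0 0 k) / r).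

Lemma cutoffs1 y0 r y : 0 < r -> `|y - y0| <= r -> cutoffs y0 r y = 1.
Proof.
move=> r0 yr; rewrite /cutoffs big1// => k _; apply: cutoff1.
rewrite normrM normfV (gtr0_norm r0) ler_pdivrMr// mul1r.
by apply: le_trans yr; have := coord_norm_le (y - y0) k; rewrite !mxE.
Qed.

Lemma cutoffs_test y0 r (O : set 'rV[R]_m) : 0 < r ->
  (forall y, `|y - y0| <= 2 * r -> O y) -> test_function O (cutoffs y0 r).
Proof.
move=> r0 HO; split.
  move=> k; apply: Ck_prod => [|i]; first exact: openT.
  apply: Ck_comp_real; [exact: openT|exact: smooth_cutoff|].
  apply: CkM; [exact: openT| |exact: Ck_cst].
  exact: CkB openT (Ck_coord k i openT) (Ck_cst k setT (y0 0 i)).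
have r20 : 0 <= 2 * r by rewrite mulr_ge0// ltW.
exists (cube (\row_k (y0 0 k - 2 * r)) (4 * r)); split.
- exact: cube_compact.
- move=> y yc; apply: HO; apply: row_norm_le => // k; rewrite !mxE ler_norml.
  move: (yc k); rewrite /= in_itv /= !mxE => /andP[? ?].
  by apply/andP; split; lra.
- move=> y /existsNP[k yk]; rewrite /cutoffs (bigD1 k)//= cutoff0 ?mul0r//.
  rewrite ltNge; apply/negP => h; apply: yk.
  move: h; rewrite normrM normfV (gtr0_norm r0) ler_pdivrMr// ler_norml => /andP[? ?].
  by rewrite /= in_itv /= !mxE; apply/andP; split; lra.
Qed.

Lemma row_ball n (x : 'rV[R]_n) (P : set 'rV[R]_n) : nbhs x P ->
  exists2 e : R, 0 < e & forall y, `|y - x| <= e -> P y.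
Proof.
move=> /nbhs_ballP[e /= e0 H]; exists (e / 2); first by rewrite divr_gt0.
move=> y ye; apply: H; rewrite -ball_normE /= distrC; apply: le_lt_trans ye _.
by rewrite ltr_pdivrMr// mulr2n mulrDr mulr1 ltrDl.
Qed.

Lemma open_chart_dom (c : graph_chart R m) : smooth_open setT (height c) ->
  open (Defs.patch c) -> open (chart_dom c).
Proof.
move=> ch op; apply: (@open_comp _ _ (chart_map c)) => // y _.
by apply: continuous_row => j; exact: (Ck_continuous (smooth_chart_map ch j 0)
  (I : setT y)).
Qed.

End Initial.

(** * Lower bound at a small positive time *)

Section GlobalSolution.
Context {R : realType} {m : nat}.
Variables (Omega : set 'rV[R]_m.+1) (p d delta : R) (g : R -> R)
  (u0 : 'rV[R]_m.+1 -> R) (u : R -> 'rV[R]_m.+1 -> R).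
Hypothesis hOmega : smooth_bounded_domain Omega.
Hypothesis hp : m.+1%:R < p.
Hypothesis hu : is_solution Omega p d delta g u0 +oo u.

Let oOmega : open Omega. Proof. by case: hOmega. Qed.
Let bOmega : bounded_set Omega. Proof. by case: hOmega. Qed.

Lemma boundary_closure x : boundary Omega x -> closure Omega x.
Proof. by move=> /(boundaryE oOmega)[]. Qed.

Lemma local_extension (t : R) x : 0 < t -> closure Omega x ->
  exists (O : set (R * 'rV[R]_m.+1)) (F : R * 'rV[R]_m.+1 -> R),
    [/\ open O, O (t, x), smooth_open O F &
        forall s y, O (s, y) -> 0 < s -> closure Omega y -> F (s, y) = u s y].
Proof.
move=> t0 xc; have [|O [F [oO Ox sF FE]]] := sol_smooth hu (z := (t, x)).
  by split=> //=; rewrite ltry.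
exists O, F; split=> // s y Oy s0 yc; apply: (FE (s, y)) => //=.
by split=> //=; rewrite ltry.
Qed.

Lemma small_dyadic (a e : R) : 0 < a -> 0 < e -> exists i, a / 2 ^+ i <= e.
Proof.
move=> a0 e0; exists (Num.truncn (a / e)).+1.
set i := (Num.truncn _).+1.
have h1 : a / e < i%:R by apply: truncnS_gt.
have h2 : (i%:R : R) <= 2 ^+ i by rewrite -natrX ler_nat ltnW// ltn_expl.
rewrite ler_pdivrMr ?exprn_gt0// mulrC -ler_pdivrMr//.
by apply: le_trans h2; exact: ltW.
Qed.

(** Around a boundary point, w = eta * (u t - u 0) has a small norm for small
    t, by continuity in time with values in the Sobolev space. If u t were less
    than C - 1 at some point, this would persist on a small cube in the chart,
    where w <= -1 because u 0 >= C; this contradicts [sobolev_pointwise].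
    Compactness of the boundary makes the time uniform. *)
Lemma initial_lower_bound (C : R) : (forall x, boundary Omega x -> C <= u0 x) ->
  exists2 t0 : R, 0 < t0 & forall x, boundary Omega x -> C - 1 <= u t0 x.
Proof.
move=> u0C.
have cov := (compact_near_coveringP _).1 (boundary_compact oOmega bOmega).
have [hbd hct] := sol_continuous hu.
have J0 (t : R) : 0 <= t -> [set t : R | 0 <= t /\ (t%:E < +oo)%E] t.
  by move=> ?; split=> //; rewrite ltry.
have : \forall t \near (0 : R)^'+,
    boundary Omega `<=` [set x | boundary Omega x -> C - 1 <= u t x].
  apply: cov => x bx.
  have [_ _ _ _ /(_ x bx)[c hc px]] := hOmega.
  have [op ch cO] := hc.
  pose y := col' (axis c) x.
  have lx := boundary_level oOmega hc px bx.
  have chy : chart_map c y = x by exact: level0_chart_map.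
  have dy : chart_dom c y by rewrite /chart_dom /= chy.
  have [e e0 He] := row_ball (open_nbhs_nbhs (conj (open_chart_dom ch op) dy)).
  pose r := e / 2; have r0 : 0 < r by rewrite divr_gt0.
  pose rho := r / 2; have rho0 : 0 < rho by rewrite divr_gt0.
  (* eta is 1 at distance at most r = 2 rho from y, hence on the cubes of side at
     most rho at points that are at distance at most rho from y *)
  pose eta := cutoffs y r.
  have teta : test_function (chart_dom c) eta.
    by apply: cutoffs_test => // z zr; apply: He; apply: le_trans zr _; rewrite /r; lra.
  have [dt dt0 Hdt] := sobolev_pointwise delta hp rho0.
  pose w t := localize c eta (fun x => u t x - u 0 x).
  pose A : set 'rV[R]_m.+1 :=
    [set x' | Defs.patch c x' /\ `|y - col' (axis c) x'| <= rho].
  pose B : set R :=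
    [set t | 0 < t /\ (sobolev_norm (phase_order delta p) p (w t) < dt%:E)%E].
  exists (A, B); first split=> /=.
  - have ccol : {for x, continuous (fun z : 'rV[R]_m.+1 => col' (axis c) z)}.
      apply: continuous_row => j.
      have -> : (fun z : 'rV[R]_m.+1 => col' (axis c) z 0 j)
        = (fun z => z 0 (lift (axis c) j)).
        by apply/funext => z; rewrite mxE.
      exact: coord_continuous.
    have h1 : \forall z \near x, Defs.patch c z by exact: open_nbhs_nbhs.
    have h2 : \forall z \near x, `|y - col' (axis c) z| <= rho.
      by have /cvgrPdist_le/(_ _ rho0) := ccol.
    by apply: filterS2 h1 h2 => z.
  - have cw := hct 0 (J0 0 (lexx _)) c eta hc teta.
    have : nbhs (0%:E : \bar R) [set z | (z < dt%:E)%E].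
      by apply: open_nbhs_nbhs; split; [exact: open_ereal_lt_ereal|rewrite /= lte_fin].
    move=> /cw; rewrite /= /nbhs /= /within /= => near0.
    by apply: filterS near0 => t Ht t0; split=> //; apply: Ht; apply: J0; exact: ltW.
  move=> [x' t] /= [[px' yx'] [t0 wt]] bx'.
  rewrite leNgt; apply/negP => ux'.
  pose y' := col' (axis c) x'.
  have chy' : chart_map c y' = x'.
    by apply: level0_chart_map; exact: boundary_level bx'.
  have dy' : chart_dom c y' by rewrite /chart_dom /= chy'.
  have [ O [F [oO Ox sF FE]]] := local_extension t0 (boundary_closure bx').
  have cmap : {for y', continuous (chart_map c)}.
    by apply: continuous_row => j; exact: (Ck_continuous (smooth_chart_map ch j 0)
      (I : setT y')).
  have Fslice := Ck_slice t (sF 0%N).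
  have oOt : open [set z | O (t, z)].
    exact: open_slice.
  have Fx' : F (t, x') < C - 1 by rewrite FE//; exact: boundary_closure.
  have n1 : \forall z \near x', O (t, z) by exact: open_nbhs_nbhs.
  have n2 : \forall z \near x', F (t, z) < C - 1.
    exact: (cvgr_lt _ (Ck_continuous Fslice Ox) _ Fx').
  rewrite -chy' in n1 n2.
  have n3 : \forall z \near y', chart_dom c z.
    by apply: open_nbhs_nbhs; split=> //; exact: open_chart_dom.
  have nn : \forall z \near y', chart_dom c z /\ O (t, chart_map c z)
    /\ F (t, chart_map c z) < C - 1.
    have n1' := cmap _ n1; have n2' := cmap _ n2.
    by apply: filterS3 n3 n1' n2' => z.
  have [e' e'0 He'] := row_ball nn.
  have [i ie'] := small_dyadic rho0 e'0.
  have mw : measurable_Rn (w t).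
    have [m1 _] := hbd t (J0 t (ltW t0)) c eta hc teta.
    have [m2 _] := hbd 0 (J0 0 (lexx _)) c eta hc teta.
    have := measurable_funB m1 m2; rewrite /measurable_Rn.
    congr (measurable_fun _ _); apply/funext => z.
    by rewrite /w /localize /= mulrBr.
  apply: (Hdt y' (w t) mw wt i) => z zc.
  have zy' : `|z - y'| <= rho / 2 ^+ i.
    apply: row_norm_le => [|k]; first by rewrite divr_ge0 ?exprn_ge0// ltW.
    move: (zc k); rewrite /= in_itv /= => /andP[h1 h2].
    rewrite 2!mxE ger0_norm; last by rewrite subr_ge0.
    by rewrite lerBlDl.
  have [dz [Oz Fz]] := He' z (le_trans zy' ie').
  have bz : boundary Omega (chart_map c z) by exact: (chart_map_boundary oOmega hc).
  have etaz : eta z = 1.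
    apply: cutoffs1 => //.
    have -> : z - y = (z - y') - (y - y') by rewrite opprB addrA subrK.
    apply: le_trans (ler_normB _ _) _.
    have h1 : rho / 2 ^+ i <= rho.
      by rewrite ler_pdivrMr ?exprn_gt0// ler_peMr ?(ltW rho0)// exprn_ege1// ler1n.
    have h2 : `|y - y'| <= rho by [].
    have := lerD (le_trans zy' h1) h2; rewrite /rho; lra.
  rewrite /w /localize etaz mul1r.
  rewrite (FE _ _ Oz t0 (boundary_closure bz)) in Fz.
  have := u0C _ bz; rewrite -(sol_init hu bz) => ?; lra.
move=> near0.
have [t [t0 Ht]] : exists t : R, 0 < t /\
    boundary Omega `<=` [set x | boundary Omega x -> C - 1 <= u t x].
  have : \forall t \near (0 : R)^'+, 0 < t /\
      boundary Omega `<=` [set x | boundary Omega x -> C - 1 <= u t x].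
    by near=> t; split; near: t; [exact: nbhs_right_gt|exact: near0].
  by move=> /filter_ex.
by exists t => // x bx; exact: Ht.
Unshelve. all: by end_near.
Qed.

End GlobalSolution.

(** * Growth at minima over the boundary *)

Section Growth.
Context {R : realType} {m : nat}.
Variables (Omega : set 'rV[R]_m.+1) (p d delta : R) (g : R -> R)
  (u0 : 'rV[R]_m.+1 -> R) (u : R -> 'rV[R]_m.+1 -> R).
Hypothesis hOmega : smooth_bounded_domain Omega.
Hypotheses (hd : 0 < d) (hdelta : 0 <= delta).
Hypothesis hu : is_solution Omega p d delta g u0 +oo u.

Let oOmega : open Omega. Proof. by case: hOmega. Qed.
Let bOmega : bounded_set Omega. Proof. by case: hOmega. Qed.

Lemma Ck_solution_inside t k : 0 < t -> Ck k Omega (u t).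
Proof.
move=> t0; apply: Ck_local => x Ox.
have [ O [F [oO Otx sF FE]]] := local_extension hu t0 (subset_closure Ox).
exists ([set z | O (t, z)] `&` Omega); split=> //.
have oI : open ([set z | O (t, z)] `&` Omega) by apply: openI => //; exact: open_slice.
apply: (@Ck_eq _ _ _ _ (fun z => F (t, z))) => //.
  by move=> z [Oz Omz]; apply: FE => //; exact: subset_closure.
by apply: Ck_sub (Ck_slice t (sF k)) => z [].
Qed.

Lemma continuous_solution_closure t : 0 < t -> {within closure Omega, continuous (u t)}.
Proof.
move=> t0; apply/subspace_continuousP => x xc.
have [ O [F [oO Otx sF FE]]] := local_extension hu t0 xc.
have cF : (fun z => F (t, z)) @ x --> u t x.
  by rewrite -(FE _ _ Otx t0 xc); exact: (Ck_continuous (Ck_slice t (sF 0%N)) Otx).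
apply: cvg_trans (cvg_trans (cvg_app _ (@cvg_within _ (nbhs x) _ (closure Omega))) cF).
apply: near_eq_cvg.
have nO : \forall z \near x, O (t, z).
  by apply: open_nbhs_nbhs; split=> //; exact: open_slice.
by apply: filterS nO => z Oz zc; exact: FE.
Qed.

Lemma continuous_solution (B : set (R * 'rV[R]_m.+1)) :
  (forall z, B z -> 0 < z.1 /\ closure Omega z.2) ->
  {within B, continuous (fun z => u z.1 z.2)}.
Proof.
move=> HB; apply/subspace_continuousP => -[t x] Bx; have [/= t0 xc] := HB _ Bx.
have [ O [F [oO Otx sF FE]]] := local_extension hu t0 xc.
have cF : F @ (t, x) --> u t x.
  by rewrite -(FE _ _ Otx t0 xc); exact: (Ck_continuous (sF 0%N) Otx).
apply: cvg_trans (cvg_trans (cvg_app _ (@cvg_within _ (nbhs (t, x)) _ B)) cF).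
apply: near_eq_cvg.
have nO : \forall z \near (t, x), O z by exact: open_nbhs_nbhs.
apply: filterS nO => -[s z] Oz Bz; have [/= s0 zc] := HB _ Bz.
exact: FE.
Qed.

Lemma derivable_solution t x : 0 < t -> closure Omega x -> derivable (u ^~ x) t 1.
Proof.
move=> t0 xc; have [ O [F [oO Otx sF FE]]] := local_extension hu t0 xc.
have dF : derivable (fun s => F (s, x)) t 1.
  by have [-> _] := derive_slice_time F t x; exact: (Ck_derivable _ (sF 1%N) Otx).
have H : \forall s \near t, F (s, x) = u s x.
  have nO : \forall s \near t, O (s, x)
    by exact: (@continuous_pairr _ _ x t O (open_nbhs_nbhs (conj oO Otx))).
  have n0 : \forall s \near t, 0 < s by exact: lt_nbhsr.
  by apply: filterS2 nO n0 => s Os s0; exact: FE.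
by have := near_eq_derivable H dF; apply.
Qed.

(** The outer normal is that of some chart, so the points x - h nu belong to
    the domain for small h, by [chart_normal_inward], and the difference
    quotients are nonpositive. They converge because u t extends smoothly
    across the boundary. *)
Lemma normal_derivative_min t x : 0 < t -> boundary Omega x ->
  (forall y, closure Omega y -> u t x <= u t y) ->
  normal_derivative Omega (u t) x <= 0.
Proof.
move=> t0 bx umin; have xc := boundary_closure hOmega bx.
have [_ _ _ _ /(_ x bx)[c0 hc0 px0]] := hOmega.
have [c [hc px nE]] : exists c, [/\ is_chart Omega c, Defs.patch c x &
    outer_normal Omega x = chart_normal c x].
  rewrite /outer_normal; set S := [set v | _].
  by apply: (@getPex _ S); exists (chart_normal c0 x), c0.
rewrite /normal_derivative nE.
set nu := chart_normal c x.
have [e e0 He] := chart_normal_inward oOmega hc px bx.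
have [ O [F [oO Otx sF FE]]] := local_extension hu t0 xc.
have dF : derivable (fun y => F (t, y)) x (- nu).
  exact: (Ck_derivable (- nu) (Ck_slice t (sF 1%N)) Otx).
have [e' e'0 He'] := near_line (- nu) (open_slice t oO) Otx.
have near_e : \forall h \near (0 : R)^'+, 0 < h /\ (h < e) /\ (h < e').
  by near=> h; do ! split; near: h; [exact: nbhs_right_gt|exact: nbhs_right_lt|exact:
    nbhs_right_lt].
have L : (fun h : R => h^-1 * (u t x - u t (x - h *: nu))) @ (0 : R)^'+ -->
    - 'D_(- nu) (fun y => F (t, y)) x.
  have L0 : (fun h : R => - (h^-1 *: (((fun y => F (t, y)) \o shift x) (h *: (- nu))
    - F (t, x))))
      @ (0 : R)^'+ --> - 'D_(- nu) (fun y => F (t, y)) x.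
    by apply: cvgN; apply: cvg_dnbhs_at_right; exact: dF.
  apply: cvg_trans L0; apply: near_eq_cvg; apply: filterS near_e => h [h0 [he he']] /=.
  have E : h *: (- nu) + x = x - h *: nu by rewrite scalerN addrC.
  have Oh : O (t, x - h *: nu) by rewrite -E; apply: He'; rewrite gtr0_norm.
  have ch : closure Omega (x - h *: nu) by apply: subset_closure; apply: He; rewrite h0.
  by rewrite /shift /= E (FE _ _ Oh t0 ch) (FE _ _ Otx t0 xc)
    /GRing.scale /= -mulrN opprB.
rewrite (cvg_lim _ L)//; rewrite -(cvg_lim _ L)//; apply: limr_le; first by apply/cvg_ex;
  eexists; exact: L.
apply: filterS near_e => h [h0 [he he']].
rewrite pmulr_rle0 ?invr_gt0// subr_le0; apply: umin.
by apply: subset_closure; apply: He; rewrite h0.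
Unshelve. all: by end_near.
Qed.

(** The operator is computed in some chart, where the pullback of u t has a
    local minimum. *)
Lemma laplace_beltrami_min t x : 0 < t -> boundary Omega x ->
  (forall y, boundary Omega y -> u t x <= u t y) ->
  0 <= laplace_beltrami Omega (u t) x.
Proof.
move=> t0 bx umin; have xc := boundary_closure hOmega bx.
have [_ _ _ _ /(_ x bx)[c0 hc0 px0]] := hOmega.
have [c [hc px ->]] : exists c, [/\ is_chart Omega c, Defs.patch c x &
    laplace_beltrami Omega (u t) x = chart_laplace_beltrami c (u t) x].
  rewrite /laplace_beltrami; set S := [set l | _].
  by apply: (@getPex _ S); exists (chart_laplace_beltrami c0 (u t) x), c0.
have [op ch _] := hc.
have [ O [F [oO Otx sF FE]]] := local_extension hu t0 xc.
pose y0 := col' (axis c) x.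
have cy0 : chart_map c y0 = x by apply: level0_chart_map; exact: boundary_level bx.
pose U : set 'rV[R]_m := chart_dom c `&` [set y | O (t, chart_map c y)].
have ccm : continuous (chart_map c).
  move=> y; apply: continuous_row => j.
  exact: (Ck_continuous (smooth_chart_map ch j 0) (I : setT y)).
have oU : open U.
  apply: openI; first exact: open_chart_dom.
  apply: (@open_comp _ _ (chart_map c) [set z | O (t, z)]); last exact: open_slice.
  by move=> y _; exact: ccm.
have Uy0 : U y0 by split; rewrite /chart_dom /= cy0.
have bU y : U y -> boundary Omega (chart_map c y).
  by move=> [dy _]; exact: (chart_map_boundary oOmega hc).
have cF : Ck 2 U (u t \o chart_map c).
  apply: (@Ck_eq _ _ _ _ ((fun z => F (t, z)) \o chart_map c)) => //.
    by move=> y Uy; apply: FE => //; [exact: Uy.2|exact: boundary_closure (bU y Uy)].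
  apply: (@Ck_comp_row _ _ _ _ [set z | O (t, z)]) => //; first exact: open_slice.
  - by move=> y [].
  - exact: Ck_slice (sF 2%N).
  - by move=> j; apply: Ck_sub (smooth_chart_map ch j 2).
apply: (chart_laplace_beltrami_min ch oU Uy0 cF) => // y Uy.
by rewrite /= cy0; apply: umin; exact: bU.
Qed.

(** By the minimum principle, x also minimizes u t over the closure; neither
    surface diffusion nor the normal derivative can then slow down the growth
    due to g. *)
Lemma boundary_min_growth t x : 0 < t -> boundary Omega x ->
  (forall y, boundary Omega y -> u t x <= u t y) ->
  g (u t x) <= derive1 (u ^~ x) t.
Proof.
move=> t0 bx umin.
have uminc y : closure Omega y -> u t x <= u t y.
  apply: (harmonic_min oOmega bOmega (continuous_solution_closure t0)) => //.
    exact: Ck_solution_inside.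
  by move=> z Oz; apply: (sol_harmonic hu) => //; rewrite ltry.
have := sol_boundary hu t0 (ltry t) bx => <-.
have h1 := laplace_beltrami_min t0 bx umin.
have h2 := normal_derivative_min t0 bx uminc.
have h3 : 0 <= delta * laplace_beltrami Omega (u t) x by exact: mulr_ge0.
have h4 : d * normal_derivative Omega (u t) x <= 0 by rewrite pmulr_rle0.
lra.
Qed.

End Growth.

(** * Travel time of the ordinary differential equation *)

Section OsgoodPrimitive.
Context {R : realType}.
Variables (g : R -> R) (xi0 : R).
Hypothesis cg : continuous g.
Hypothesis hg_pos : forall xi, xi0 <= xi -> 0 < g xi.
Hypothesis hg_int :
  (\int[lebesgue_measure]_(xi in `[xi0, +oo[) ((g xi)^-1)%:E < +oo)%E.

Let mu := @lebesgue_measure R.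

(** The time that solutions of y' = g y take from xi0 to xi. *)
Definition travel_time (xi : R) : R := \int[mu]_(y in `[xi0, xi]) (g y)^-1.

Let measurable_invg : measurable_fun `[xi0, +oo[ (fun y => ((g y)^-1)%:E).
Proof.
apply/measurable_EFinP.
apply: (@eq_measurable_fun _ _ _ _ _ (fun y => g y `^ (-1))).
  move=> y; rewrite inE /= in_itv /= andbT => y0.
  by rewrite powR_inv1// ltW// hg_pos.
apply: measurable_funTS; apply: (measurableT_comp (measurable_powR (-1))).
exact: continuous_measurable_fun.
Qed.

Let invg_ge0 y : `[xi0, +oo[%classic y -> (0 <= ((g y)^-1)%:E)%E.
Proof. by rewrite /= in_itv /= andbT => y0; rewrite lee_fin invr_ge0 ltW// hg_pos. Qed.

Let sub_itv xi : `[xi0, xi]%classic `<=` `[xi0, +oo[%classic.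
Proof. by move=> y; rewrite /= !in_itv /= andbT => /andP[]. Qed.

Lemma integrable_invg xi : mu.-integrable `[xi0, xi] (EFin \o (fun y => (g y)^-1)).
Proof.
apply: (@integrableS _ _ _ mu `[xi0, +oo[) => //.
apply/integrableP; split=> //.
rewrite (_ : integral _ _ _ = (\int[mu]_(xi in `[xi0, +oo[) ((g xi)^-1)%:E)%E)//.
by apply: eq_integral => y; rewrite inE => /invg_ge0; rewrite lee_fin /= => /ger0_norm ->.
Qed.

Lemma travel_time_bounded : exists2 I : R, 0 <= I & forall xi, travel_time xi <= I.
Proof.
exists (fine (\int[mu]_(xi in `[xi0, +oo[) ((g xi)^-1)%:E)%E).
  by apply: fine_ge0; apply: integral_ge0 => y; exact: invg_ge0.
move=> xi; apply: fine_le.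
- by apply: integrable_fin_num => //; exact: integrable_invg.
- by rewrite ge0_fin_numE//; apply: integral_ge0 => y; exact: invg_ge0.
- by apply: ge0_subset_integral.
Qed.

Lemma travel_time_ge0 xi : 0 <= travel_time xi.
Proof.
apply: Rintegral_ge0 => y; rewrite /= in_itv /= => /andP[y0 _].
by rewrite invr_ge0 ltW// hg_pos.
Qed.

Lemma is_derive_travel_time (xi : R) : xi0 < xi -> is_derive xi 1 travel_time (g xi)^-1.
Proof.
move=> xi0xi; have xi1 : xi < xi + 1 by rewrite ltrDl.
have ci : {for xi, continuous (fun y => (g y)^-1)}.
  by apply: cvgV; [rewrite gt_eqF// hg_pos// ltW|exact: cg].
have [dK DK] := continuous_FTC1_closed xi1 (integrable_invg (xi + 1)) xi0xi ci.
by apply: DeriveDef; [exact: dK|rewrite -derive1E].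
Qed.

Lemma travel_time_lt (a b : R) : xi0 < a -> a < b -> travel_time a < travel_time b.
Proof.
move=> xa ab.
have d (s : R) : a <= s -> is_derive s 1 travel_time (g s)^-1.
  by move=> as_; apply: is_derive_travel_time; exact: lt_le_trans as_.
have [||s] := @MVT R travel_time (fun s => (g s)^-1) a b ab.
- by move=> s; rewrite in_itv /= => /andP[as_ _]; apply: d; exact: ltW.
- apply: derivable_within_continuous => s; rewrite in_itv /= => /andP[as_ _].
  by have [] := d s as_.
rewrite in_itv /= => /andP[as_ _] E.
rewrite -subr_gt0 E mulr_gt0 ?subr_gt0// invr_gt0 hg_pos// ltW//.
exact: lt_trans as_.
Qed.

End OsgoodPrimitive.

(** * Blow-up *)

Section BlowUp.
Context {R : realType} {m : nat}.

Lemma left_min_derive (f : R -> R) (a t : R) : derivable f t 1 -> a < t ->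
  (forall s, a < s < t -> f t <= f s) -> derive1 f t <= 0.
Proof.
move=> df at0 fmin; rewrite leNgt; apply/negP => pos.
have df' : is_derive t 1 f (f^`()%classic t) by rewrite derive1E; exact/derivableP.
pose h (s : R) := f t - f (t - s).
have dh : is_derive (0 : R) 1 h (f^`()%classic t).
  have dl : is_derive (0 : R) 1 (fun s : R => t - s) (-1).
    have : is_derive (0 : R) 1 (cst t - (id : R -> R)) (0 - 1) by apply: is_deriveB.
    by rewrite sub0r.
  have df0 : is_derive (t - 0) 1 f (f^`()%classic t) by rewrite subr0.
  have dc := @is_derive1_comp R f (fun s => t - s) 0 _ _ df0 dl.
  have := is_deriveB (@is_derive_cst R R R (f t) 0 1) dc.
  by rewrite mulrN1 opprK add0r.
have h0 : h 0 = 0 by rewrite /h subr0 subrr.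
have [e e0 He] := derive_pos_right dh pos h0.
pose s := Num.min e (t - a) / 2.
have ta0 : 0 < t - a by rewrite subr_gt0.
have min0 : 0 < Num.min e (t - a) by rewrite lt_min e0.
have smin : s < Num.min e (t - a) by rewrite /s ltr_pdivrMr// mulr2n mulrDr mulr1 ltrDl.
have s0 : 0 < s by rewrite divr_gt0.
have /andP[se sta] : (s < e) && (s < t - a) by rewrite -lt_min.
have : 0 < h s by apply: He; rewrite s0.
rewrite subr_gt0 ltNge fmin//; apply/andP; split; first by rewrite ltrBrDr addrC -ltrBrDr.
by rewrite ltrBlDr ltrDl.
Qed.

Variables (Omega : set 'rV[R]_m.+1) (p d delta : R) (g : R -> R)
  (u0 : 'rV[R]_m.+1 -> R) (u : R -> 'rV[R]_m.+1 -> R) (xi0 : R).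
Hypothesis hOmega : smooth_bounded_domain Omega.
Hypotheses (hd : 0 < d) (hdelta : 0 <= delta).
Hypothesis hu : is_solution Omega p d delta g u0 +oo u.
Hypothesis cg : continuous g.
Hypothesis hg_pos : forall xi, xi0 <= xi -> 0 < g xi.
Hypothesis hg_int :
  (\int[lebesgue_measure]_(xi in `[xi0, +oo[) ((g xi)^-1)%:E < +oo)%E.

Variable t0 : R.
Hypothesis t00 : 0 < t0.
Hypothesis above0 : forall x, boundary Omega x -> xi0 < u t0 x.

Let oOmega : open Omega. Proof. by case: hOmega. Qed.
Let bOmega : bounded_set Omega. Proof. by case: hOmega. Qed.

Let cylinder (t1 : R) : set (R * 'rV[R]_m.+1) := `[t0, t1]%classic `*` boundary Omega.

Let cylinder_compact t1 : compact (cylinder t1).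
Proof. exact: compact_setX (@segment_compact _ _ _) (boundary_compact oOmega bOmega). Qed.

Let cylinder_pos t1 z : cylinder t1 z -> 0 < z.1 /\ closure Omega z.2.
Proof.
case; rewrite /= in_itv /= => /andP[h _] hb; split; first exact: lt_le_trans h.
exact: boundary_closure hb.
Qed.

(** At the first time when the value xi0 is reached somewhere on the boundary,
    it is the minimum and it is approached from above, so that the time
    derivative is nonpositive; but it is at least g xi0 > 0 by
    [boundary_min_growth]. *)
Lemma stays_above t x : t0 <= t -> boundary Omega x -> xi0 < u t x.
Proof.
move=> t0t bx; rewrite ltNge; apply/negP => uxi.
pose f (z : R * 'rV[R]_m.+1) := u z.1 z.2.
pose S := cylinder t `&` [set z | f z <= xi0].
have cf : {within cylinder t, continuous f}.
  by apply: (continuous_solution hu) => z; exact: cylinder_pos.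
have cS : compact S.
  have cl : closed ([set z | f z <= xi0] : set (subspace (cylinder t))).
    exact: ((@continuous_closedP (subspace (cylinder t)) R f).1 cf _ (@closed_le R xi0)).
  have [W cW WE] := (closed_subspaceP _ _).1 cl.
  rewrite /S setIC -WE setIC; apply: compact_closedI => //; exact: cylinder_compact.
have S0 : S !=set0.
  exists (t, x); split => //=; split=> //=; by rewrite in_itv /= t0t lexx.
have [|[ts xs]] := @compact_EVT_min _ R (fun z : R * 'rV[R]_m.+1 => z.1) S S0 cS.
  by apply: continuous_subspaceT => z; exact: cvg_fst.
rewrite inE => -[[/= + bxs] uxs] tmin; rewrite in_itv /= => /andP[t0ts tst].
rewrite /f /= in uxs.
have t0ts' : t0 < ts.
  rewrite lt_neqAle t0ts andbT; apply/eqP => E.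
  by have := above0 bxs; rewrite E ltNge uxs.
have before s y : t0 <= s < ts -> boundary Omega y -> xi0 < u s y.
  move=> /andP[t0s sts] by_; rewrite ltNge; apply/negP => usy.
  have := tmin (s, y); rewrite inE /= leNgt sts => /(_ _)/negP; apply=> //.
  split => //=; split => //=; rewrite in_itv /= t0s /=.
  by apply: ltW; exact: lt_le_trans tst.
have ts0 : 0 < ts by exact: lt_trans t0ts'.
have above y : boundary Omega y -> xi0 <= u ts y.
  move=> by_; rewrite leNgt; apply/negP => uy.
  have dy := derivable_solution hu ts0 (boundary_closure hOmega by_).
  have cy : {for ts, continuous (u ^~ y)}.
    by apply: differentiable_continuous; apply/derivable1_diffP.
  have n1 : \forall s \near ts, u s y < xi0 by exact: (cvgr_lt _ cy _ uy).
  have n2 : \forall s \near ts^'-, u s y < xi0 /\ t0 < s /\ s < ts.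
    near=> s; do ! split.
    - by near: s; exact: (@cvg_within _ (nbhs ts) _ _ _ n1).
    - by near: s; exact: nbhs_left_gt.
    - by near: s; exact: nbhs_left_lt.
  have [s [us [t0s sts]]] := @filter_ex _ _ (at_left_proper_filter ts) _ n2.
  by have := before s y; rewrite (ltW t0s) sts ltNge (ltW us) => /(_ isT by_).
have uxsE : u ts xs = xi0 by apply/eqP; rewrite eq_le uxs above.
have grow := boundary_min_growth hOmega hd hdelta hu ts0 bxs.
have {grow}grow : g (u ts xs) <= derive1 (u ^~ xs) ts.
  by apply: grow => y by_; rewrite uxsE; exact: above.
have dxs := derivable_solution hu ts0 (boundary_closure hOmega bxs).
have le0 : derive1 (u ^~ xs) ts <= 0.
  apply: (left_min_derive dxs t0ts') => s /andP[t0s sts].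
  by rewrite uxsE ltW// before// (ltW t0s).
have := hg_pos (lexx xi0); rewrite -uxsE => gpos.
by have := lt_le_trans gpos (le_trans grow le0); rewrite ltxx.
Unshelve. all: by end_near.
Qed.

Let K := travel_time g xi0.

(** The minimum of K (u t x) - (t - t0) / 2 over the space-time cylinder cannot
    occur after t0, because the time derivative at such a point would be at
    least 1 - 1 / 2. Any slope less than 1 could replace 1 / 2. *)
Lemma travel_time_grows t1 x : t0 <= t1 -> boundary Omega x ->
  (t1 - t0) / 2 <= K (u t1 x).
Proof.
move=> t01 bx.
pose Z (z : R * 'rV[R]_m.+1) := K (u z.1 z.2) - (z.1 - t0) / 2.
have abv z : cylinder t1 z -> xi0 < u z.1 z.2.
  by move=> [/= + bz]; rewrite in_itv /= => /andP[h _]; exact: stays_above.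
have cZ : {within cylinder t1, continuous Z}.
  have /subspace_continuousP cu : {within cylinder t1, continuous (fun z => u z.1 z.2)}.
    by apply: (continuous_solution hu) => z; exact: cylinder_pos.
  apply/subspace_continuousP => z cz; apply: cvgB.
    have dK := is_derive_travel_time cg hg_pos hg_int (abv z cz).
    have cK : {for (u z.1 z.2), continuous K}.
      by apply: differentiable_continuous; apply/derivable1_diffP; have [] := dK.
    have cuz : u y.1 y.2 @[y --> within (cylinder t1) (nbhs z)] --> u z.1 z.2 := cu z cz.
    by apply: continuous_cvg cuz; exact: cK.
  apply: cvgMr_tmp; apply: cvgB; last exact: cvg_cst.
  have c1 : (fun y : R * 'rV[R]_m.+1 => y.1) @ nbhs z --> z.1 by exact: cvg_fst.
  exact: cvg_within_filter c1.
have C0 : cylinder t1 !=set0 by exists (t1, x); split=> //=; rewrite in_itv /= t01 lexx.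
have [[ts xs]] := @compact_EVT_min _ R Z _ C0 (cylinder_compact (t1 := t1)) cZ.
rewrite inE => cyl Zmin; have [/= + bxs] := cyl; rewrite in_itv /= => /andP[t0ts tst1].
have ts0 : 0 < ts by exact: lt_le_trans t0ts.
have uxs := abv _ cyl; rewrite /= in uxs.
have Zmin' s y : t0 <= s <= t1 -> boundary Omega y -> Z (ts, xs) <= Z (s, y).
  by move=> st by_; apply: Zmin; rewrite inE; split=> //=; rewrite in_itv.
have tsE : ts = t0.
  apply/eqP; rewrite eq_le t0ts andbT leNgt; apply/negP => t0ts'.
  have umin y : boundary Omega y -> u ts xs <= u ts y.
    move=> by_; rewrite leNgt; apply/negP => uy.
    have := Zmin' ts y; rewrite t0ts tst1 => /(_ isT by_).
    rewrite /Z /= lerD2r leNgt => /negP; apply.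
    by apply: (travel_time_lt cg hg_pos hg_int _ uy); exact: stays_above.
  have grow := boundary_min_growth hOmega hd hdelta hu ts0 bxs umin.
  have dxs := derivable_solution hu ts0 (boundary_closure hOmega bxs).
  have du : is_derive ts 1 (u ^~ xs) (derive1 (u ^~ xs) ts).
    by rewrite derive1E; exact/derivableP.
  have dK := is_derive_travel_time cg hg_pos hg_int uxs.
  have dKu := @is_derive1_comp R K (u ^~ xs) ts _ _ dK du.
  have dl : is_derive ts 1 (fun s : R => (s - t0) / 2) 2^-1.
    have dB : is_derive ts 1 ((id : R -> R) - cst t0) (1 - 0) by apply: is_deriveB.
    have := is_deriveM dB (@is_derive_cst R R R 2^-1 ts 1).
    by rewrite scaler0 add0r subr0 [2^-1%:A]mulr1.
  have dZ : is_derive ts 1 (fun s => Z (s, xs))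
      ((g (u ts xs))^-1 * derive1 (u ^~ xs) ts - 2^-1) by exact: is_deriveB dKu dl.
  have [dZ1 dZ2] := dZ.
  have le0 : derive1 (fun s => Z (s, xs)) ts <= 0.
    apply: (left_min_derive dZ1 t0ts') => s /andP[t0s sts].
    apply: Zmin' => //; rewrite (ltW t0s) /=; apply: ltW; exact: lt_le_trans tst1.
  rewrite derive1E dZ2 in le0.
  have gpos : 0 < g (u ts xs) by apply: hg_pos; exact: ltW.
  have : 1 <= (g (u ts xs))^-1 * derive1 (u ^~ xs) ts.
    by rewrite -ler_pdivrMl ?invr_gt0// invrK mulr1.
  by move=> h; have := le_trans (lerB h (lexx 2^-1)) le0; lra.
have := Zmin' t1 x; rewrite t01 lexx => /(_ isT bx).
rewrite tsE /Z /= subrr mul0r subr0 => h.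
have K0 : 0 <= K (u t0 xs) := travel_time_ge0 hg_pos _.
by rewrite -subr_ge0; exact: le_trans h.
Qed.

Lemma no_global_solution : False.
Proof.
have [x bx] : boundary Omega !=set0.
  by apply: boundary_nonempty => //; case: hOmega.
have [I I0 KI] := travel_time_bounded cg hg_pos hg_int.
have h : t0 <= t0 + 2 * (I + 1) by rewrite lerDl mulr_ge0// addr_ge0.
have := travel_time_grows h bx; rewrite addrAC subrr add0r => h1.
by have := le_trans h1 (KI _); rewrite mulrC mulKf//; lra.
Qed.

End BlowUp.

Theorem proposition5p6 (R : realType) (m : nat) (Omega : set 'rV[R]_m.+1)
    (hOmega : smooth_bounded_domain Omega)
    (p : R) (hp : m.+1%:R < p)
    (g : R -> R) (hg : smooth_open setT g)
    (d delta : R) (hd : 0 < d) (hdelta : 0 <= delta)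
    (xi0 : R) (hg_pos : forall xi, xi0 <= xi -> 0 < g xi)
    (hg_int : (\int[lebesgue_measure]_(xi in `[xi0, +oo[) ((g xi)^-1)%:E < +oo)%E) :
  exists2 C : R, 0 < C &
    forall u0 : 'rV[R]_m.+1 -> R,
      phase_space Omega delta p u0 ->
      (forall x, boundary Omega x -> C <= u0 x) ->
      blows_up_in_finite_time Omega p d delta g u0.
Proof.
have cg : continuous g by move=> s; exact: (Ck_continuous (hg 0%N) (I : setT s)).
(* one unit is lost by the time t0, another one makes the bound by xi0 strict *)
exists (`|xi0| + 2); first by rewrite ltr_wpDl.
move=> u0 _ u0C tplus u [hu _].
rewrite ltNge leye_eq; apply/negP => /eqP tE; rewrite {}tE in hu.
have [t0 t00 Ht0] := initial_lower_bound hOmega hp hu u0C.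
apply: (no_global_solution hOmega hd hdelta hu cg hg_pos hg_int t00) => x bx.
by have := Ht0 x bx; have := ler_norm xi0; lra.
Qed.
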